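(* Let $(X_m)_{m\in\mathbb{N}_0}$ be a homogeneous irreducible discrete-time Markov chain on a finite set $\mathcal{X}$ with transition probabilities $P_{xy}$, and let $(A_m)_{m\in\mathbb{N}}$ be a discrete-time process on $\mathbb{R}^d$ (on the same probability space). For $x,y\in\mathcal{X}$ let $q^{xy}(da):=\mathbb{P}(A_1\in da\mid X_0=x,X_1=y)$ and let $\phi^{xy},\phi^{xy*},\phi^{xy}_{|\cdot|},\phi^{xy*}_{|\cdot|}$ be as defined in the context. Assume that (i) for all $n\in\mathbb{N}$ and $x_0,\dots,x_n\in\mathcal{X}$, $$\mathbb{P}\big(A_1\in da_1,\dots,A_n\in da_n\mid X_0=x_0,\dots,X_n=x_n\big)=\prod_{m=1}^n q^{x_{m-1}x_m}(da_m);$$ (ii) $\displaystyle\liminf_{r\to\infty}\frac{\phi^{xy*}_{|\cdot|}(r)}{r}=\infty$ for all $x,y\in\mathcal{X}$. For $n\in\mathbb{N}$ define $K^n=(K^{n,xy})_{x,y}\in(\mathbb{R}^d)^{\mathcal{X}\times\mathcal{X}}$ and $\Theta^n=(\Theta^n_{xy})_{x,y}\in\mathcal{P}(\mathcal{X}\times\mathcal{X})$ by $$K^{n,xy}:=\frac1n\sum_{m=1}^n\mathbf{1}\{X_{m-1}=x,\,X_m=y\}\,A_m,\qquad \Theta^n_{xy}:=\frac1n\sum_{m=1}^n\mathbf{1}\{X_{m-1}=x,\,X_m=y\}.$$ Then the sequence $(K^n,\Theta^n)_{n}$ satisfies the large-deviation principle in $(\mathbb{R}^d)^{\mathcal{X}\times\mathcal{X}}\times\mathcal{P}(\mathcal{X}\times\mathcal{X})$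 with speed $n$ and good rate functional $$I(k,\theta):=\begin{cases}\displaystyle\sum_{x,y\in\mathcal{X}}\theta_{xy}\,\phi^{xy*}\Big(\frac{k^{xy}}{\theta_{xy}}\Big)+\sum_{x,y\in\mathcal{X}}s\big(\theta_{xy}\mid(e^1\#\theta)_xP_{xy}\big), & k\ll\theta\ \text{and}\ e^1\#\theta=e^2\#\theta,\\ \infty,&\text{otherwise.}\end{cases}$$
   Context: $\mathcal{P}(\mathcal{X}\times\mathcal{X})\subset\mathbb{R}^{\mathcal{X}\times\mathcal{X}}$ is the set of probability measures on $\mathcal{X}\times\mathcal{X}$; all spaces are finite-dimensional with their usual topology. For $x,y\in\mathcal{X}$, $$\phi^{xy}(\lambda):=\log\int e^{\lambda\cdot a}\,q^{xy}(da),\quad \phi^{xy*}(a):=\sup_{\lambda\in\mathbb{R}^d}[\lambda\cdot a-\phi^{xy}(\lambda)],$$ $$\phi^{xy}_{|\cdot|}(s):=\log\int e^{s|a|_1}\,q^{xy}(da),\quad \phi^{xy*}_{|\cdot|}(r):=\sup_{s\in\mathbb{R}}[rs-\phi^{xy}_{|\cdot|}(s)],$$ with values in $(-\infty,\infty]$, where $|\cdot|_1$ is the $\ell^1$-norm on $\mathbb{R}^d$. The function $s$ is $$s(a\mid b):=\begin{cases}a\log\frac ab-a+b,&a,b>0,\\ b,&a=0,\ b\ge0,\\ \infty,&\text{otherwise.}\end{cases}$$ Marginals: $(e^1\#\theta)_x:=\sum_{y}\theta_{xy}$ and $(e^2\#\theta)_y:=\sum_x\theta_{xy}$. The notation $k\ll\theta$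 means $k^{xy}=0$ whenever $\theta_{xy}=0$. Convention: $\theta_{xy}\phi^{xy*}(k^{xy}/\theta_{xy}):=0$ whenever $\theta_{xy}=0$ and $k^{xy}=0$. The family $q^{xy}$ is understood as a family of probability measures on $\mathbb{R}^d$, a version of the stated conditional laws for which (i) holds (conditioning in (i) is only relevant for paths of positive probability; for pairs where the conditioning is void, $q^{xy}$ is any fixed probability measure, still subject to (ii)). A good rate functional is a lower semicontinuous $[0,\infty]$-valued functional with compact sublevel sets. *)

(* Defs.v *)
From HB Require Import structures.
From mathcomp Require Import all_boot all_order all_algebra.
From mathcomp Require Import all_classical all_reals all_analysis.

Set Implicit Arguments.
Unset Strict Implicit.
Unset Printing Implicit Defensive.

Import Order.TTheory GRing.Theory Num.Theory.
Import numFieldNormedType.Exports.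
Local Open Scope classical_set_scope.
Local Open Scope ring_scope.

(** Vectors of R^d with the Borel sigma-algebra.  [borel_rV R d] is an alias of
    ['rV[R]_d]: the algebra and the topology live on the latter. *)
Definition borel_rV (R : realType) (d : nat) :=
  g_sigma_algebraType (@open ('rV[R]_d : topologicalType)).

Section cumulants.
Context {R : realType} {d : nat}.
Implicit Types (mu : probability (borel_rV R d) R) (lam a : 'rV[R]_d).

Definition dot lam a : R := \sum_(i < d) lam 0 i * a 0 i.

(* The norm provided by the library on ['rV[R]_d] is the sup norm. *)
Definition norm1 a : R := \sum_(i < d) `|a 0 i|.

Local Open Scope ereal_scope.

Definition phi mu lam : \bar R := lne (\int[mu]_a (expR (dot lam a))%:E).

Definition phi_star mu a : \bar R :=
  ereal_sup [set (dot lam a)%:E - phi mu lam | lam in [set: 'rV[R]_d]].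

Definition phi_abs mu (s : R) : \bar R :=
  lne (\int[mu]_a (expR (s * norm1 a))%:E).

Definition phi_abs_star mu (r : R) : \bar R :=
  ereal_sup [set (r * s)%:E - phi_abs mu s | s in [set: R]].

End cumulants.

Section markov.
Context {R : realType} {X : finType}.
Implicit Types P : X -> X -> R.

Definition stochastic P : Prop :=
  (forall x y, 0 <= P x y) /\ (forall x, \sum_y P x y = 1).

Fixpoint transition_pow P (n : nat) (x y : X) : R :=
  if n is n'.+1 then \sum_z P x z * transition_pow P n' z y
  else (x == y)%:R.

Definition irreducible P : Prop :=
  forall x y, exists n, 0 < transition_pow P n x y.

Context {dsp : measure_display} {Omega : measurableType dsp}.
Variable Pr : probability Omega R.
Implicit Types Xs : nat -> Omega -> X.

(* Only used when [Pr B > 0]. *)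
Definition cond_prob (A B : set Omega) : R := fine (Pr (A `&` B)) / fine (Pr B).

(* {X_0 = x 0, ..., X_n = x n}; the values of [x] beyond [n] are irrelevant. *)
Definition path_event Xs (n : nat) (x : nat -> X) : set Omega :=
  [set w | forall m, (m <= n)%N -> Xs m w = x m].

Definition homogeneous_markov_chain P Xs : Prop :=
  [/\ stochastic P,
      (forall m x, measurable [set w | Xs m w = x]) &
      (forall n (x : nat -> X), (0 < Pr (path_event Xs n x))%E ->
        cond_prob [set w | Xs n.+1 w = x n.+1] (path_event Xs n x) =
        P (x n) (x n.+1))].

Section marks.
Context {d : nat}.
Implicit Types (A : nat -> Omega -> 'rV[R]_d)
  (q : X -> X -> probability (borel_rV R d) R).

(* q^{xy}(da) = Pr(A_1 \in da | X_0 = x, X_1 = y) *)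
Definition is_cond_law Xs A q : Prop :=
  forall x y (B : set (borel_rV R d)), measurable B ->
    (0 < Pr [set w | Xs 0%N w = x /\ Xs 1%N w = y])%E ->
    (q x y B = (cond_prob [set w | B (A 1%N w)]
                          [set w | Xs 0%N w = x /\ Xs 1%N w = y])%:E)%E.

(* The identity of measures on (R^d)^n is stated on measurable boxes
   B 1 x ... x B n. *)
Definition cond_product_law Xs A q : Prop :=
  forall n (x : nat -> X) (B : nat -> set (borel_rV R d)), (0 < n)%N ->
    (forall m, measurable (B m)) ->
    (0 < Pr (path_event Xs n x))%E ->
    ((cond_prob [set w | forall m, (1 <= m <= n)%N -> B m (A m w)]
                (path_event Xs n x))%:E =
     \prod_(1 <= m < n.+1) q (x m.-1) (x m) (B m))%E.

End marks.
End markov.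

Section large_deviations.
Context {R : realType} {E : topologicalType}.
Local Open Scope ereal_scope.

Definition good_rate_functional (I : E -> \bar R) : Prop :=
  [/\ (forall z, 0 <= I z),
      lower_semicontinuous I &
      (forall c : R, compact [set z | I z <= c%:E])].

(* [Y n] is the n-th term of the sequence and [v n] its speed.
   The values of [Pr] are only meaningful on measurable events, whence the
   Borel measurability of [Y n] as a first clause. *)
Definition large_deviation_principle (dsp : measure_display)
    (Omega : measurableType dsp) (Pr : probability Omega R)
    (v : nat -> R) (Y : nat -> Omega -> E) (I : E -> \bar R) : Prop :=
  [/\ (forall n (O : set E), open O -> measurable (Y n @^-1` O)),
      (forall O : set E, open O ->
        - ereal_inf (I @` O) <=
        limn_einf (fun n => ((v n)^-1)%:E * lne (Pr (Y n @^-1` O)))) &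
      (forall C : set E, closed C ->
        limn_esup (fun n => ((v n)^-1)%:E * lne (Pr (Y n @^-1` C))) <=
        - ereal_inf (I @` C))].

End large_deviations.

(** P(X x X) as a subset of R^{X x X}; as a type, it carries the subspace
    topology. *)
Definition prob_simplex (R : realType) (X : finType) :
    set {ptws X * X -> R} :=
  [set th | (forall z, 0 <= th z) /\ \sum_z th z = 1].

Definition state_space (R : realType) (X : finType) (d : nat) :=
  ({ptws X * X -> 'rV[R]_d} * set_type (@prob_simplex R X))%type.

Section empirical.
Context {R : realType} {X : finType} {d : nat} {T : Type}.
Variables (Xs : nat -> T -> X) (A : nat -> T -> 'rV[R]_d).

Definition jump (m : nat) (w : T) (z : X * X) : bool :=
  (Xs m.-1 w == z.1) && (Xs m w == z.2).

Definition emp_K (n : nat) (w : T) : {ptws X * X -> 'rV[R]_d} :=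
  fun z => n%:R^-1 *: \sum_(1 <= m < n.+1) (jump m w z)%:R *: A m w.

Definition emp_Theta (n : nat) (w : T) : {ptws X * X -> R} :=
  fun z => n%:R^-1 * \sum_(1 <= m < n.+1) (jump m w z)%:R.

Lemma emp_Theta_simplex n w : prob_simplex (emp_Theta n.+1 w).
Proof.
split=> [z|]; first by rewrite mulr_ge0 ?invr_ge0 ?sumr_ge0.
rewrite -mulr_sumr exchange_big /=.
under eq_bigr => m _.
  rewrite (bigD1 (Xs m.-1 w, Xs m w)) //= {1}/jump !eqxx big1 ?addr0 => [|z].
    over.
  rewrite /jump => /negPf; rewrite -pair_eqE /= ![_ == Xs _ w]eq_sym.
  by case: z => x y /= ->.
by rewrite sumr_const_nat subSS subn0 mulVf ?pnatr_eq0.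
Qed.

(* (K^n, Theta^n) for n >= 1, indexed by n - 1. *)
Definition emp_pair (n : nat) (w : T) : state_space R X d :=
  (emp_K n.+1 w, SigSub (mem_set (emp_Theta_simplex n w))).

End empirical.

Section rate.
Context {R : realType} {X : finType} {d : nat}.
Variables (P : X -> X -> R) (q : X -> X -> probability (borel_rV R d) R).

Definition rel_ent (a b : R) : \bar R :=
  if (0 < a) && (0 < b) then (a * ln (a / b) - a + b)%:E
  else if (a == 0) && (0 <= b) then b%:E
  else +oo%E.

Definition marg1 (th : X * X -> R) (x : X) : R := \sum_y th (x, y).
Definition marg2 (th : X * X -> R) (y : X) : R := \sum_x th (x, y).

Definition abs_cont (k : X * X -> 'rV[R]_d) (th : X * X -> R) : Prop :=
  forall z, th z = 0 -> k z = 0.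

(* theta phi^*(k / theta), read as 0 when theta = 0; under [abs_cont k th]
   one then also has k = 0. *)
Definition mark_cost (mu : probability (borel_rV R d) R)
    (k : 'rV[R]_d) (t : R) : \bar R :=
  if t == 0 then 0%E else (t%:E * phi_star mu (t^-1 *: k))%E.

Definition rate (z : state_space R X d) : \bar R :=
  let k : X * X -> 'rV[R]_d := z.1 in
  let th : X * X -> R := set_val z.2 in
  if `[< abs_cont k th /\ marg1 th =1 marg2 th >] then
    (\sum_(x : X) \sum_(y : X) mark_cost (q x y) (k (x, y)) (th (x, y)) +
     \sum_(x : X) \sum_(y : X) rel_ent (th (x, y)) (marg1 th x * P x y)%R)%E
  else +oo%E.

End rate.

(* Main.v *)
Require Import Defs.
From HB Require Import structures.
From mathcomp Require Import all_boot all_order all_algebra.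
From mathcomp Require Import all_classical all_reals all_analysis.
From mathcomp Require Import measurable_realfun ring lra.

Set Implicit Arguments.
Unset Strict Implicit.
Unset Printing Implicit Defensive.

Import Order.TTheory GRing.Theory Num.Theory.
Import numFieldNormedType.Exports.
Local Open Scope classical_set_scope.
Local Open Scope ring_scope.

(** Write [z = (k, theta)] for a point of the state space and [u . z] for the
    pairing with the list of its real coordinates.

    The rate functional is a supremum of linear functionals.  By definition
    [theta phi^*(k / theta)] is the supremum over [lam] of
    [lam . k - theta phi lam], and [s (a | b)] is the supremum over [g] of
    [a g - b (exp g - 1)].  Hence for every choice of vectors [lam x y] and reals
    [g x y] there is a linear functional, [dual_vector], that is at most the rate
    ([dual_le_rate]), and on balanced [theta] these functionals come arbitrarily
    close to it ([dual_ge]).  The superlinearity hypothesis gives the marks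
    all exponential moments ([finite_exp_moment]), so that the functionals are
    finite.  Lower semicontinuity and compactness of the sublevel
    sets follow ([rate_good]).

    Upper bound.  If [u] is a dual functional, [exp (n u . Y_n)] has mean at most
    one: given the past, a step from [x] contributes [exp (- D x) (1 + D x)] on
    average, where [D x] is the sum over [y] of [P x y (exp (g x y) - 1)]
    ([process_moment], [dual_vector_chernoff]).  So every half space above level
    [c] of a dual functional has probability at most [exp (- n c)].  The flow of
    [Y_n] through a state telescopes and is at most [1 / n], which handles the
    unbalanced points.  Exponential tightness and a finite cover give the bound
    for closed sets ([ldp_upper]).

    Lower bound.  No tilted measure is constructed.  Fix a state [x0] of positive
    initial mass, and call a rate [v] reached at [y] when, for some [m], the loops
    of length [m] at [x0] whose mean increment is within [eta] of [y] have
    probability at least [exp (m v)].  Loops can be concatenated, so the set of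
    pairs [(y, v)] is convex ([hypograph_convex]).  If [(z, - I)] with
    [I = rate z] were at a positive distance from it, a separating functional
    [ell] would satisfy [ell . y + v <= ell . z - I - e] for all reached pairs.
    Discretize the marks over a fine grid.  There are only polynomially many
    types of words, hence the powers of the matrix tilted by [ell] grow at most
    like [exp (m (ell . z - I - e))] at [(x0, x0)] ([tilted_power_growth]), and
    this matrix has a positive subinvariant vector [r] for a slightly larger
    eigenvalue ([subinvariant_vector]).  With [g] the logarithm of the tilted
    matrix, normalized by [r], the value at [z] of the dual functional exceeds
    the rate, since the terms [ln (r y) - ln (r x)] cancel on a balanced flow.
    This contradiction is [attains_rate].  Repeating the loops found in this way,
    and completing with a piece of a loop, gives the bound along all times
    ([open_lower_bound]).

    Only product events enter the lower bound, so that the hypothesis on the law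
    of the marks applies to them directly.  For the upper bound it is extended
    from product events to products of functions ([path_moment]). *)

(** * Separation of a point from a convex set *)

Lemma cvg_lower_bound {R : realType} (f : nat -> R) (l c : R) :
  f n @[n --> \oo] --> l -> (forall n, c <= f n) -> c <= l.
Proof.
move=> fl fc; rewrite -(cvg_lim _ fl) //.
by apply: limr_ge; [apply/cvg_ex; exists l|exact: nearW].
Qed.

Lemma cvg_upper_bound {R : realType} (f : nat -> R) (l c : R) :
  f n @[n --> \oo] --> l -> (forall n, f n <= c) -> l <= c.
Proof.
move=> fl fc; rewrite -lerN2.
by apply: (cvg_lower_bound (cvgN fl)) => n; rewrite lerN2.
Qed.

Section separation.
Context {R : realType} {J : finType}.
Implicit Types (u v w y : J -> R) (C : set (J -> R)).

Definition pairing u v : R := \sum_j u j * v j.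

Definition midpoint u v : J -> R := fun j => (u j + v j) / 2.

Definition midpoint_convex C := forall u v, C u -> C v -> C (midpoint u v).

Lemma parallelogram u v :
  pairing (fun j => u j - v j) (fun j => u j - v j) =
  2 * pairing u u + 2 * pairing v v
  - 4 * pairing (midpoint u v) (midpoint u v).
Proof.
rewrite /pairing !mulr_sumr -!big_split -sumrN -big_split /=.
by apply: eq_bigr => j _; rewrite /midpoint; field.
Qed.

(** Concatenation of loops only yields midpoints; their iteration gives the dyadic
    weights, which are small enough to move a little from [u] towards [v]. *)
Lemma midpoint_convex_dyadic C k u v : midpoint_convex C -> C u -> C v ->
  C (fun j => u j + (1 / 2) ^+ k * (v j - u j)).
Proof.
move=> Cc Cu Cv; elim: k => [|k IH].
  by rewrite (_ : (fun _ => _) = v) //; apply/funext => j; rewrite expr0; ring.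
have := Cc _ _ Cu IH; congr (C _); apply/funext => j.
by rewrite /midpoint exprS; field.
Qed.

(** The first variation of the norm at a near minimizer, in the direction of
    another point of the set. *)
Lemma near_minimizers_inner C (D e : R) u v k : midpoint_convex C ->
  (forall y, C y -> D <= pairing y y) -> C u -> C v -> pairing u u <= D + e ->
  - e <= 2 * (1 / 2) ^+ k * pairing u (fun j => v j - u j)
         + ((1 / 2) ^+ k) ^+ 2
           * pairing (fun j => v j - u j) (fun j => v j - u j).
Proof.
move=> Cc CD Cu Cv ue.
have := CD _ (midpoint_convex_dyadic k Cc Cu Cv).
set t := (1 / 2) ^+ k.
rewrite (_ : pairing (fun j => u j + _) _ = pairing u u
    + (2 * t * pairing u (fun j => v j - u j)
    + t ^+ 2 * pairing (fun j => v j - u j) (fun j => v j - u j))).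
  by lra.
rewrite /pairing !mulr_sumr -!big_split /=; apply: eq_bigr => j _; ring.
Qed.

Lemma cvg_pairing (F : set_system nat) (FF : Filter F) (f g : nat -> J -> R) u v :
  (forall j, f n j @[n --> F] --> u j) ->
  (forall j, g n j @[n --> F] --> v j) ->
  pairing (f n) (g n) @[n --> F] --> pairing u v.
Proof.
move=> fu gv; rewrite /pairing.
by apply: cvg_big => [|j _]; [exact: add_continuous|exact: cvgM].
Qed.

(** The minimizer of the norm over the closure of the convex set is the
    separating functional; it is the limit of a minimizing sequence, which is
    Cauchy by the parallelogram law. *)
Lemma separation0 C (D0 : R) : midpoint_convex C -> C !=set0 -> 0 < D0 ->
  (forall y, C y -> D0 <= pairing y y) ->
  exists l e, 0 < e /\ forall y, C y -> e <= pairing l y.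
Proof.
move=> Cc [y0 Cy0] D0gt0 CD0.
pose S := [set pairing y y | y in C].
have Sinf : has_inf S by split; [exists (pairing y0 y0), y0|
  exists D0 => _ [y Cy <-]; exact: CD0].
pose D := inf S.
have CD y : C y -> D <= pairing y y.
  by move=> Cy; apply: ge_inf; [case: Sinf|exists y].
have D0D : D0 <= D.
  by apply: lb_le_inf; [case: Sinf|move=> _ [y Cy <-]; exact: CD0].
have /choice[f fP] : forall n : nat, exists y, C y /\ pairing y y <= D + n.+1%:R^-1.
  move=> n; have [|_ [y Cy <-] yD] := inf_adherent (eps := n.+1%:R^-1) _ Sinf.
    by rewrite invr_gt0 ltr0n.
  by exists y; split => //; exact: ltW.
have close n m : pairing (fun j => f n j - f m j) (fun j => f n j - f m j) <=
    2 * n.+1%:R^-1 + 2 * m.+1%:R^-1.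
  rewrite parallelogram.
  have := CD _ (Cc _ _ (fP n).1 (fP m).1).
  have := (fP n).2; have := (fP m).2.
  move: (n.+1%:R^-1) (m.+1%:R^-1) => a b; lra.
have hinv : n.+1%:R^-1 @[n --> \oo] --> (0 : R) := @cvg_harmonic R.
have fcvg j : cvgn (fun n => f n j).
  apply/cauchy_cvgP; apply: cauchy_exP => e e0.
  have e2 : 0 < e ^+ 2 / 4 by rewrite divr_gt0 ?exprn_gt0.
  have [N _ HN] : \forall n \near \oo, n.+1%:R^-1 < e ^+ 2 / 4 :=
    cvgr_lt _ hinv _ e2.
  exists (f N j), N => // m /= Nm; rewrite /ball /=.
  have /= := HN _ (leqnn N); have /= := HN _ Nm => hm hn.
  have := close N m; move: (N.+1%:R^-1) (m.+1%:R^-1) hn hm => a b hn hm.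
  have : (f N j - f m j) ^+ 2 <=
     pairing (fun j => f N j - f m j) (fun j => f N j - f m j).
    rewrite /pairing (bigD1 j) //= expr2 lerDl; apply: sumr_ge0 => i _.
    by rewrite -expr2 sqr_ge0.
  move=> h1 h2; rewrite -ltr_sqr ?nnegrE ?normr_ge0 ?ltW //.
  by rewrite real_normK ?num_real //; lra.
pose l := fun j => limn (fun n => f n j).
have fl j : f n j @[n --> \oo] --> l j by exact: fcvg.
have lD : D <= pairing l l.
  apply: (cvg_lower_bound (cvg_pairing _ fl fl)) => n.
  exact: CD (fP n).1.
exists l, D; split=> [|y Cy]; first exact: lt_le_trans D0D.
pose p := pairing l (fun j => y j - l j).
pose N := pairing (fun j => y j - l j) (fun j => y j - l j).
have fy j : y j - f n j @[n --> \oo] --> y j - l j.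
  by apply: cvgB => //; exact: cvg_cst.
have pN k : 0 <= 2 * p + (1 / 2) ^+ k * N.
  set t := (1 / 2) ^+ k; have t0 : 0 < t by rewrite exprn_gt0.
  rewrite -(pmulr_rge0 _ t0).
  apply: (cvg_lower_bound (f := fun n =>
     t * (2 * pairing (f n) (fun j => y j - f n j)
     + t * pairing (fun j => y j - f n j) (fun j => y j - f n j)) + n.+1%:R^-1)).
    rewrite -[X in _ --> X]addr0; apply: cvgD => //; apply: cvgMl_tmp.
    by apply: cvgD; apply: cvgMl_tmp; exact: cvg_pairing.
  move=> n.
  have := near_minimizers_inner k Cc CD (fP n).1 Cy (fP n).2.
  rewrite -/t expr2; move: (n.+1%:R^-1) => a; lra.
(* the dyadic weight tends to zero *)
have p0 : 0 <= 2 * p.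
  apply: (cvg_lower_bound (f := fun k => 2 * p + (1 / 2) ^+ k * N)) => //.
  rewrite -[X in _ --> X]addr0; apply: cvgD; first exact: cvg_cst.
  rewrite -[X in _ --> X](mul0r N); apply: cvgMr_tmp.
  by apply: cvg_expr; rewrite ger0_norm; lra.
have -> : pairing l y = p + pairing l l.
  by rewrite /p /pairing -big_split /=; apply: eq_bigr => j _; ring.
lra.
Qed.

Lemma separation C z (D0 : R) : midpoint_convex C -> C !=set0 -> 0 < D0 ->
  (forall y, C y -> D0 <= pairing (fun j => y j - z j) (fun j => y j - z j)) ->
  exists l e, 0 < e /\ forall y, C y -> e <= pairing l (fun j => y j - z j).
Proof.
move=> Cc [y0 Cy0] D00 H.
have [||_ [y Cy <-]|l [e [e0 le]]] :=
  @separation0 [set (fun j => y j - z j) | y in C] D0 _ _ D00.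
- move=> _ _ [u Cu <-] [v Cv <-]; exists (midpoint u v); first exact: Cc.
  by apply/funext => j; rewrite /midpoint; field.
- by exists (fun j => y0 j - z j), y0.
- exact: H.
by exists l, e; split => // y Cy; apply: le; exists y.
Qed.

End separation.

(** * Families of words *)

Section words.
Context {R : realType} {X : finType} {d : nat}.
Variables (P : X -> X -> R) (q : X -> X -> probability (borel_rV R d) R).

(** The coordinates of a pair [(k, theta)]: [(x, y, Some i)] is the entry [i] of
    [k^{xy}], and [(x, y, None)] is [theta_{xy}]. *)
Notation coordinate := ((X * X) * option 'I_d)%type.

(** A trajectory lists the states reached, and the marks received, after a given
    starting state; a word prescribes the states and restricts each mark to a set. *)
Definition traj := seq (X * 'rV[R]_d).
Definition word := seq (X * set (borel_rV R d)).

Definition step_vec (x y : X) (a : 'rV[R]_d) (j : coordinate) : R :=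
  ((x == j.1.1) && (y == j.1.2))%:R * (if j.2 is Some i then a 0 i else 1).

Fixpoint total_vec (x : X) (s : traj) (j : coordinate) : R :=
  if s is l :: s' then step_vec x l.1 l.2 j + total_vec l.1 s' j else 0.

Fixpoint fits (w : word) (s : traj) : bool :=
  match w, s with
  | [::], [::] => true
  | L :: w', l :: s' => [&& L.1 == l.1, `[< L.2 l.2 >] & fits w' s']
  | _, _ => false
  end.

Fixpoint weight (x : X) (w : word) : R :=
  if w is L :: w' then P x L.1 * fine (q x L.1 L.2) * weight L.1 w' else 1.

Definition endpoint {T : Type} (x : X) (w : seq (X * T)) : X :=
  last x [seq l.1 | l <- w].

Fixpoint bounded_word (M : R) (w : word) : Prop :=
  if w is L :: w' then
    [/\ measurable L.2, (forall a, L.2 a -> forall i, `|a 0 i| <= M) &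
        bounded_word M w']
  else True.

Definition cube (m : nat) (y : coordinate -> R) (eta : R) :
    set (coordinate -> R) :=
  [set u | forall j, `|u j - m%:R * y j| <= m%:R * eta].

(** Some event made of loops of length [m] at [x0], which force the sum of the
    increments into [U], has mass at least [c].  The event is presented as a
    finite disjoint union of product events; disjointness is stated by counting
    the words that a trajectory fits, which turns concatenation of families
    into a product of counts. *)
Definition attains (x0 : X) (m : nat) (c : R) (U : set (coordinate -> R)) :=
  exists (I : finType) (sel : pred I) (W : I -> word) (M : R),
    [/\ forall i, sel i ->
          [/\ size (W i) = m, bounded_word M (W i) & endpoint x0 (W i) = x0],
        forall s, (\sum_(i | sel i) fits (W i) s <= 1)%N,
        forall i s, sel i -> fits (W i) s -> U (total_vec x0 s) &
        c <= \sum_(i | sel i) weight x0 (W i)].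

Lemma fits_endpoint x w s : fits w s -> endpoint x s = endpoint x w.
Proof.
rewrite /endpoint; elim: w s x => [|L w IH] [|l s] x //=.
by case/and3P => /eqP -> _ /IH; exact.
Qed.

Lemma fits_cat w1 w2 s :
  fits (w1 ++ w2) s =
  fits w1 (take (size w1) s) && fits w2 (drop (size w1) s).
Proof.
elim: w1 s => [|L w IH] [|l s] //=; rewrite ?take0 ?drop0 //.
by rewrite IH !andbA.
Qed.

Lemma total_vec_cat x s1 s2 j :
  total_vec x (s1 ++ s2) j = total_vec x s1 j + total_vec (endpoint x s1) s2 j.
Proof.
by elim: s1 x => [|l s IH] x /=; rewrite ?add0r // IH addrA.
Qed.

Lemma weight_cat x w1 w2 :
  weight x (w1 ++ w2) = weight x w1 * weight (endpoint x w1) w2.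
Proof.
by elim: w1 x => [|L w IH] x /=; rewrite ?mul1r // IH !mulrA.
Qed.

Lemma endpoint_cat (T : Type) x (w1 w2 : seq (X * T)) :
  endpoint x (w1 ++ w2) = endpoint (endpoint x w1) w2.
Proof. by rewrite /endpoint map_cat last_cat. Qed.

Lemma bounded_word_cat M w1 w2 :
  bounded_word M (w1 ++ w2) <-> bounded_word M w1 /\ bounded_word M w2.
Proof.
elim: w1 => [|L w IH] /=; first by split=> [|[]].
by split=> [[? ? /IH[]]|[[? ? ?] ?]] //; split => //; apply/IH.
Qed.

Lemma bounded_word_le M M' w : M <= M' -> bounded_word M w -> bounded_word M' w.
Proof.
move=> MM'; elim: w => //= L w IH [? h /IH ?]; split => // a La i.
exact: le_trans (h _ La i) MM'.
Qed.

Hypothesis P_ge0 : forall x y, 0 <= P x y.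

Lemma weight_ge0 x w : 0 <= weight x w.
Proof.
by elim: w x => //= L w IH x; rewrite !mulr_ge0 // fine_ge0.
Qed.

Variable x0 : X.

Lemma attains_sub m c (U U' : set _) :
  U `<=` U' -> attains x0 m c U -> attains x0 m c U'.
Proof.
move=> UU' [I [sel [W [M [h1 h2 h3 h4]]]]].
by exists I, sel, W, M; split => // i s si /(h3 _ _ si)/UU'.
Qed.

Lemma attains_le m c c' U : c' <= c -> attains x0 m c U -> attains x0 m c' U.
Proof.
move=> cc' [I [sel [W [M [h1 h2 h3 h4]]]]].
by exists I, sel, W, M; split => //; exact: le_trans cc' h4.
Qed.

Lemma attains0 : attains x0 0 1 [set (fun=> 0)].
Proof.
exists unit, predT, (fun=> [::]), 0; split => //.
- by move=> s; rewrite big_const card_unit /=; case: s.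
- by move=> _ [|l s] //= _ _; apply/funext.
- by rewrite big_const card_unit /= addr0.
Qed.

(** All words start and end at [x0], so the weight of a concatenation is the product
    of the weights; disjointness is kept because a trajectory fits [w1 ++ w2] when
    its two parts fit [w1] and [w2]. *)
Lemma attains_cat m1 m2 c1 c2 U1 U2 : 0 <= c1 -> 0 <= c2 ->
  attains x0 m1 c1 U1 -> attains x0 m2 c2 U2 ->
  attains x0 (m1 + m2) (c1 * c2)
    [set u | exists2 u1, U1 u1 & exists2 u2, U2 u2 &
             u = (fun j => u1 j + u2 j)].
Proof.
move=> c10 c20 [I1 [sel1 [W1 [M1 [len1 dis1 in1 mass1]]]]].
move=> [I2 [sel2 [W2 [M2 [len2 dis2 in2 mass2]]]]].
have sz1 i : sel1 i -> size (W1 i) = m1 by case/len1.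
exists (I1 * I2)%type, (fun i => sel1 i.1 && sel2 i.2),
  (fun i => W1 i.1 ++ W2 i.2), (Num.max M1 M2); split.
- move=> [i1 i2] /= /andP[s1 s2].
  have [l1 b1 e1] := len1 _ s1; have [l2 b2 e2] := len2 _ s2; split.
  + by rewrite size_cat l1 l2.
  + apply/bounded_word_cat; split.
      by apply: bounded_word_le b1; rewrite le_max lexx.
    by apply: bounded_word_le b2; rewrite le_max lexx orbT.
  + by rewrite endpoint_cat e1.
- move=> s.
  rewrite -(pair_big sel1 sel2 (fun i1 i2 => nat_of_bool (fits (W1 i1 ++ W2 i2) s))) /=.
  under eq_bigr => i1 s1.
    under eq_bigr => i2 s2 do rewrite fits_cat (sz1 _ s1) -mulnb.
    rewrite -big_distrr /=; over.
  rewrite -big_distrl /=.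
  exact: (leq_mul (dis1 _) (dis2 _)).
- move=> [i1 i2] s /= /andP[s1 s2]; have [l1 b1 e1] := len1 _ s1.
  rewrite fits_cat l1 => /andP[f1 f2].
  exists (total_vec x0 (take m1 s)); first exact: in1 f1.
  exists (total_vec x0 (drop m1 s)); first exact: in2 f2.
  apply/funext => j; rewrite -{1}(cat_take_drop m1 s) total_vec_cat.
  by rewrite (fits_endpoint _ f1) e1.
- rewrite -(pair_big sel1 sel2 (fun i1 i2 => weight x0 (W1 i1 ++ W2 i2))) /=.
  under eq_bigr => i1 s1.
    have [_ _ e1] := len1 _ s1.
    under eq_bigr => i2 s2 do rewrite weight_cat e1.
    rewrite -big_distrr /=; over.
  rewrite -big_distrl /=.
  exact: ler_pM.
Qed.

Lemma attains_cube_cat m1 m2 c1 c2 y1 y2 y eta : 0 <= c1 -> 0 <= c2 ->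
  (forall j, (m1 + m2)%:R * y j = m1%:R * y1 j + m2%:R * y2 j) ->
  attains x0 m1 c1 (cube m1 y1 eta) -> attains x0 m2 c2 (cube m2 y2 eta) ->
  attains x0 (m1 + m2) (c1 * c2) (cube (m1 + m2) y eta).
Proof.
move=> c10 c20 yE a1 a2; apply: attains_sub (attains_cat c10 c20 a1 a2).
move=> _ [u1 h1 [u2 h2 ->]] j; rewrite yE natrD mulrDl.
have -> : u1 j + u2 j - (m1%:R * y1 j + m2%:R * y2 j) =
  (u1 j - m1%:R * y1 j) + (u2 j - m2%:R * y2 j) by ring.
by apply: (le_trans (ler_normD _ _)); apply: lerD; [exact: h1|exact: h2].
Qed.

Lemma attains_cube_iter m c y eta k : 0 <= c ->
  attains x0 m c (cube m y eta) ->
  attains x0 (k * m) (c ^+ k) (cube (k * m) y eta).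
Proof.
move=> c0 a; elim: k => [|k IH].
  rewrite mul0n expr0; apply: attains_sub attains0 => _ -> j.
  by rewrite mul0r mul0r subrr normr0.
rewrite mulSn exprS; apply: attains_cube_cat a IH => //.
  by rewrite exprn_ge0.
by move=> j; rewrite natrD mulrDl.
Qed.

(** The exponential lower rates that are reached in a cube of radius [eta].
    The last coordinate, [None], is the rate. *)
Definition hypograph (eta : R) : set (option coordinate -> R) :=
  [set f | exists2 m : nat, (0 < m)%N &
     attains x0 m (expR (m%:R * f None)) (cube m (f \o Some) eta)].

(** To average two loops of lengths [m1] and [m2], repeat them [m2] and [m1] times. *)
Lemma hypograph_convex eta : midpoint_convex (hypograph eta).
Proof.
move=> f g [m1 m10 a1] [m2 m20 a2].
exists (m2 * m1 + m1 * m2)%N; first by rewrite addn_gt0 muln_gt0 m10 m20.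
have e1 := attains_cube_iter m2 (expR_ge0 _) a1.
have e2 := attains_cube_iter m1 (expR_ge0 _) a2.
have -> : expR ((m2 * m1 + m1 * m2)%:R * midpoint f g None) =
   expR (m1%:R * f None) ^+ m2 * expR (m2%:R * g None) ^+ m1.
  rewrite -!expRM_natl -expRD; congr expR.
  by rewrite /midpoint natrD !natrM; field.
apply: attains_cube_cat e1 e2; rewrite ?exprn_ge0 ?expR_ge0 // => j.
by rewrite /= /midpoint natrD !natrM; field.
Qed.

Lemma hypograph_down eta f f' : hypograph eta f ->
  f' \o Some = f \o Some -> f' None <= f None -> hypograph eta f'.
Proof.
move=> [m m0 a] E le; exists m => //; rewrite E.
by apply: attains_le a; rewrite ler_expR ler_wpM2l.
Qed.

End words.

(** * A subinvariant vector for a nonnegative matrix *)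

Section subinvariant.
Context {R : realType}.

Lemma polynomial_le_exp (D : nat) (e : R) : 0 < e ->
  exists2 K, 0 < K & forall m : nat, m.+1%:R ^+ D <= K * expR (m%:R * e).
Proof.
move=> e0; pose D' : R := D.+1%:R; have D'0 : 0 < D' by rewrite ltr0n.
exists ((D' / e) ^+ D.+1 * expR e).
  by rewrite mulr_gt0 ?expR_gt0 // exprn_gt0 // divr_gt0.
move=> m; apply: (@le_trans _ _ (m.+1%:R ^+ D.+1)).
  by apply: ler_weXn2l => //; rewrite ler1n.
have -> : (D' / e) ^+ D.+1 * expR e * expR (m%:R * e) =
          (D' / e * expR (m.+1%:R * e / D')) ^+ D.+1.
  rewrite [RHS]exprMn -[in RHS]expRM_natl -mulrA -expRD; congr (_ * expR _).
  by rewrite -/D' -natr1; field; rewrite gt_eqF.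
rewrite ler_pXn2r ?nnegrE ?ler0n //; last first.
  by rewrite mulr_ge0 ?expR_ge0 // ltW // divr_gt0.
rewrite -ler_pdivrMl ?divr_gt0 // invf_div mulrC.
apply: le_trans (expR_ge1Dx _); rewrite -mulrA.
by move: (_ * (e / D')) => t; lra.
Qed.

Lemma sum_geometric_le (t : R) n : 0 <= t < 1 ->
  \sum_(i < n) t ^+ i <= (1 - t)^-1.
Proof.
move=> /andP[t0 t1]; have t10 : 0 < 1 - t by lra.
rewrite -(ler_pM2l t10) mulfV ?gt_eqF //.
have := subrX1 t n; have : 0 <= t ^+ n by rewrite exprn_ge0.
move: (\sum_(i < n) _) (t ^+ n) => a b; lra.
Qed.

Context {X : finType}.
Variables (Q : X -> X -> R) (V : nat -> X -> R) (x0 : X).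
Hypothesis Q_ge0 : forall x y, 0 <= Q x y.
(* [V m x] is the entry [(x, x0)] of the [m]-th power of [Q] *)
Hypothesis V0 : forall x, V 0%N x = (x == x0)%:R.
Hypothesis VS : forall m x, V m.+1 x = \sum_y Q x y * V m y.
Hypothesis reach : forall x y, exists n k,
  0 < k /\ forall m, k * V m y <= V (n + m)%N x.

Lemma powers_ge0 m x : 0 <= V m x.
Proof.
elim: m x => [|m IH] x; first by rewrite V0.
by rewrite VS; apply: sumr_ge0 => y _; rewrite mulr_ge0.
Qed.

(** If the diagonal entry at [x0] of the powers of [Q] grows like
    [exp (m Lam)], then the spectral radius is at most [exp Lam]: the resolvent
    series at [exp (Lam + del)], started from [x0], converges, and it is
    subinvariant by a shift of the index. *)
Lemma subinvariant_vector (D : nat) (Lam del : R) : 0 < del ->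
  (forall m, V m x0 <= m.+1%:R ^+ D * expR (m%:R * Lam)) ->
  exists r : X -> R, (forall x, 0 < r x) /\
    forall x, \sum_y Q x y * r y <= expR (Lam + del) * r x.
Proof.
move=> del0 growth.
pose S N x : R := \sum_(m < N) expR (- (m%:R * (Lam + del))) * V m x.
have a_ge0 m x : 0 <= expR (- (m%:R * (Lam + del))) * V m x.
  by rewrite mulr_ge0 ?expR_ge0 ?powers_ge0.
have SS N x : S N.+1 x = S N x + expR (- (N%:R * (Lam + del))) * V N x.
  by rewrite /S big_ord_recr.
have Smono x : {homo S^~ x : n m / (n <= m)%N >-> n <= m}.
  by apply/nondecreasing_seqP => N; rewrite SS lerDl.
have [K K0 polyK] := polynomial_le_exp D (divr_gt0 del0 (ltr0n _ 2)).
have Sbnd x : exists C, forall N, S N x <= C.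
  have [n [k [k0 kV]]] := reach x0 x.
  pose C := k^-1 * K * expR (n%:R * (Lam + del / 2)).
  pose t := expR (- (del / 2)).
  have t01 : 0 <= t < 1 by rewrite expR_ge0 expR_lt1; lra.
  have aC m : expR (- (m%:R * (Lam + del))) * V m x <= C * t ^+ m.
    have h : V m x <= C * expR (m%:R * (Lam + del / 2)).
      rewrite -(ler_pM2l k0); apply: (le_trans (kV m)).
      apply: (le_trans (growth _)).
      have := polyK (n + m)%N => h.
      have E : expR (n%:R * (Lam + del / 2)) * expR (m%:R * (Lam + del / 2)) =
          expR ((n + m)%:R * (del / 2)) * expR ((n + m)%:R * Lam).
        by rewrite -!expRD natrD; congr expR; field.
      have -> : k * (C * expR (m%:R * (Lam + del / 2))) =
          K * (expR (n%:R * (Lam + del / 2)) * expR (m%:R * (Lam + del / 2))).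
        by rewrite /C; field; rewrite gt_eqF.
      rewrite E [leRHS]mulrA.
      exact: (ler_wpM2r (expR_ge0 _) h).
    apply: (le_trans (ler_wpM2l (expR_ge0 _) h)).
    rewrite mulrCA -expRD /t -expRM_natl ler_wpM2l //.
      by rewrite /C !mulr_ge0 ?expR_ge0 ?invr_ge0 ?ltW.
    by rewrite ler_expR le_eqVlt; apply/orP; left; apply/eqP; field.
  exists (C * (1 - t)^-1) => N.
  apply: (le_trans (ler_sum _ (fun (m : 'I_N) _ => aC m))).
  rewrite -mulr_sumr ler_wpM2l ?sum_geometric_le //.
  by rewrite /C !mulr_ge0 ?expR_ge0 ?invr_ge0 ?ltW.
have hasub x : has_ubound (range (S^~ x)).
  by have [C SC] := Sbnd x; exists C => _ [N _ <-].
pose r x := sup (range (S^~ x)).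
have Sr x : S N x @[N --> \oo] --> r x by exact: nondecreasing_cvgn.
have S_le N x : S N x <= r x by apply: ub_le_sup => //; exists N.
exists r; split=> x.
  have [n [k [k0 kV]]] := reach x x0.
  apply: lt_le_trans (S_le n.+1 x); rewrite SS; apply: ltr_wpDl.
    exact: sumr_ge0.
  rewrite mulr_gt0 ?expR_gt0 //; apply: lt_le_trans k0 _.
  by have := kV 0%N; rewrite V0 eqxx mulr1 addn0.
apply: (cvg_upper_bound (f := fun N => \sum_y Q x y * S N y)).
  by apply: cvg_big => [|y _]; [exact: add_continuous|exact: cvgMl_tmp].
move=> N; apply: le_trans (ler_wpM2l (expR_ge0 _) (S_le N.+1 x)).
rewrite /S big_ord_recl mulrDr mulr_sumr.
apply: ler_wpDl; first by rewrite mulr_ge0 ?expR_ge0.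
under eq_bigr => y _ do rewrite mulr_sumr.
rewrite exchange_big /=; apply: ler_sum => m _.
rewrite VS mulrA -expRD !mulr_sumr; apply: ler_sum => y _.
rewrite mulrCA le_eqVlt; apply/orP; left; apply/eqP; congr (expR _ * _).
by rewrite /bump /= natrD; ring.
Qed.

End subinvariant.

(** * Exponential moments of the loops over a finite alphabet of cells *)

Lemma sum_bool_le1 (I : finType) (p b : pred I) :
  (forall i j, p i -> p j -> b i -> b j -> i = j) ->
  (\sum_(i | p i) b i <= 1)%N.
Proof.
move=> uni; case: (pickP (fun i => p i && b i)) => [i /andP[pi bi]|none].
  rewrite (bigD1 i) //= bi big1 ?addn0 // => j /andP[pj ji].
  by case bj: (b j) => //; rewrite (uni j i) ?eqxx in ji.
by rewrite big1 // => i pi; have := none i; rewrite pi /= => ->.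
Qed.

Lemma big_tuple_cons {R : realType} (L : finType) m (F : seq L -> R) :
  \sum_(t : m.+1.-tuple L) F t = \sum_(l : L) \sum_(t : m.-tuple L) F (l :: t).
Proof.
rewrite (reindex (fun p : L * m.-tuple L => [tuple of p.1 :: p.2])) /=.
  by rewrite pair_big.
exists (fun t => (thead t, [tuple of behead t])) => [[l t] _|t _] /=.
  by rewrite theadE; congr (_, _); apply: val_inj.
by rewrite -tuple_eta.
Qed.

Section cells.
Context {R : realType} {X : finType} {d : nat}.
Variables (P : X -> X -> R) (q : X -> X -> probability (borel_rV R d) R).
Hypothesis P_ge0 : forall x y, 0 <= P x y.
Variable x0 : X.
Variables (C : finType) (cell : C -> set (borel_rV R d)) (rep : C -> 'rV[R]_d).
Variables (eta M : R).
Hypothesis eta_ge0 : 0 <= eta.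
Hypothesis cell_measurable : forall c, measurable (cell c).
Hypothesis cell_disjoint : forall c c' a, cell c a -> cell c' a -> c = c'.
Hypothesis cell_bounded : forall c a, cell c a -> forall i, `|a 0 i| <= M.
Hypothesis cell_rep : forall c a, cell c a -> forall i, `|a 0 i - rep c 0 i| <= eta.

Let word_of (t : seq (X * C)) : word := [seq (l.1, cell l.2) | l <- t].
Let traj_of (t : seq (X * C)) : @traj R X d := [seq (l.1, rep l.2) | l <- t].

Fixpoint count_steps (x : X) (t : seq (X * C)) (k : X * X * C) : nat :=
  if t is l :: t' then ((x, l.1, l.2) == k) + count_steps l.1 t' k else 0.

Let count_steps_le x t k : (count_steps x t k <= size t)%N.
Proof.
elim: t x => //= l t IH x; apply: (@leq_trans (1 + count_steps l.1 t k)).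
  by rewrite leq_add2r leq_b1.
by rewrite add1n ltnS.
Qed.

Let total_count x t j : total_vec x (traj_of t) j =
  \sum_k (count_steps x t k)%:R * step_vec k.1.1 k.1.2 (rep k.2) j.
Proof.
elim: t x => [|l t IH] x /=; first by rewrite big1 // => k _; rewrite mul0r.
under eq_bigr => k _ do rewrite natrD mulrDl.
rewrite big_split /= -IH; congr (_ + _).
rewrite (bigD1 (x, l.1, l.2)) //= eqxx mul1r big1 ?addr0 // => k kl.
by rewrite eq_sym (negPf kl) mul0r.
Qed.

Let word_of_inj t t' s : fits (word_of t) s -> fits (word_of t') s -> t = t'.
Proof.
elim: t t' s => [|l t IH] [|l' t'] [|a s] //= /and3P[/eqP e /asboolP c f].
move=> /and3P[/eqP e' /asboolP c' f']; rewrite (IH _ _ f f').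
by case: l l' e c e' c' => [x k] [x' k'] /= -> c -> c'; rewrite (cell_disjoint c c').
Qed.

Let total_near x t s j : fits (word_of t) s ->
  `|total_vec x s j - total_vec x (traj_of t) j| <= (size t)%:R * eta.
Proof.
elim: t x s => [|l t IH] x [|a s] //=; first by rewrite subrr normr0 mul0r.
move=> /and3P[/eqP <- /asboolP c f]; have := IH l.1 _ f.
rewrite -natr1 mulrDl mul1r => h.
have -> : step_vec x l.1 a.2 j + total_vec l.1 s j -
   (step_vec x l.1 (rep l.2) j + total_vec l.1 (traj_of t) j) =
   (total_vec l.1 s j - total_vec l.1 (traj_of t) j) +
   (step_vec x l.1 a.2 j - step_vec x l.1 (rep l.2) j) by ring.
apply: (le_trans (ler_normD _ _)); apply: lerD => //.
rewrite /step_vec -mulrBr normrM.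
case: j.2 => [i|]; last by rewrite subrr normr0 mulr0.
rewrite -[leRHS]mul1r; apply: ler_pM => //; last exact: cell_rep.
by case: (_ && _); rewrite ?normr1 ?normr0.
Qed.

Let bounded_word_of t : bounded_word M (word_of t).
Proof. by elim: t => //= l t IH; split => // a; exact: cell_bounded. Qed.

Let endpoint_word_of x t : endpoint x (word_of t) = endpoint x t.
Proof. by rewrite /endpoint -map_comp. Qed.

Variables (ell : (X * X) * option 'I_d -> R) (Lam : R).
Hypothesis below : forall f, hypograph P q x0 eta f ->
  pairing ell (f \o Some) + f None <= Lam.

Definition tilted_power m x : R := \sum_(t : m.-tuple (X * C) | endpoint x t == x0)
  weight P q x (word_of t) * expR (pairing ell (total_vec x (traj_of t))).

Definition tilted_matrix x y : R := \sum_(c : C)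
  P x y * fine (q x y (cell c)) * expR (pairing ell (step_vec x y (rep c))).

Lemma tilted_power0 x : tilted_power 0 x = (x == x0)%:R.
Proof.
rewrite /tilted_power big_mkcond (bigD1 [tuple]) //= big1 ?addr0.
  rewrite {1}/endpoint /=; case: eqP => // _.
  by rewrite mul1r /pairing big1 ?expR0 // => j _; rewrite mulr0.
by move=> t /eqP []; exact: tuple0.
Qed.

Lemma tilted_powerS m x :
  tilted_power m.+1 x = \sum_y tilted_matrix x y * tilted_power m y.
Proof.
rewrite /tilted_power big_mkcond /=.
rewrite (big_tuple_cons _ (fun t : seq (X * C) => if endpoint x t == x0 then
  weight P q x (word_of t) * expR (pairing ell (total_vec x (traj_of t))) else 0)).
rewrite -(pair_big predT predT (fun y c => \sum_(t : m.-tuple (X * C))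
  if endpoint x ((y, c) :: t) == x0 then
  weight P q x (word_of ((y, c) :: t)) *
  expR (pairing ell (total_vec x (traj_of ((y, c) :: t)))) else 0)) /=.
apply: eq_bigr => y _; rewrite mulr_suml; apply: eq_bigr => c _.
rewrite [in RHS]big_mkcond /= mulr_sumr; apply: eq_bigr => t _.
have -> : endpoint x ((y, c) :: t) = endpoint y t by [].
case: ifP; rewrite ?mulr0 // => _.
rewrite (_ : pairing ell (fun j => step_vec _ _ _ _ + _) =
  pairing ell (step_vec x y (rep c)) + pairing ell (total_vec y (traj_of t))).
  by rewrite expRD; ring.
by rewrite /pairing -big_split /=; apply: eq_bigr => j _; rewrite -mulrDr.
Qed.

(** All the words with the same numbers of steps of each kind have the same sum
    of representatives, so they form one event of the kind counted by
    [hypograph]; and there are only polynomially many such numbers. *)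
Lemma tilted_power_growth m :
  tilted_power m x0 <= m.+1%:R ^+ #|{: X * X * C}| * expR (m%:R * Lam).
Proof.
case: m => [|m']; first by rewrite tilted_power0 eqxx expr1n mul0r expR0 mul1r.
set m := m'.+1; have m0 : (0 < m)%N by [].
pose key (t : m.-tuple (X * C)) : {ffun X * X * C -> 'I_m.+1} :=
  [ffun k => inord (count_steps x0 t k)].
have keyE t t' : key t = key t' ->
    total_vec x0 (traj_of t) = total_vec x0 (traj_of t').
  move=> /ffunP E; apply/funext => j; rewrite !total_count.
  apply: eq_bigr => k _; have := E k; rewrite !ffunE.
  move=> /(congr1 (@nat_of_ord _)); rewrite !inordK ?ltnS => [->//| |].
    by rewrite -[leqRHS](size_tuple t') count_steps_le.
  by rewrite -[leqRHS](size_tuple t) count_steps_le.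
rewrite /tilted_power (partition_big key predT) //=.
have -> : m.+1%:R ^+ #|{: X * X * C}| * expR (m%:R * Lam) =
    \sum_(tau : {ffun X * X * C -> 'I_m.+1}) expR (m%:R * Lam).
  by rewrite sumr_const card_ffun card_ord -[RHS]mulr_natl natrX.
apply: ler_sum => tau _.
case: (pickP (fun t : m.-tuple (X * C) =>
    (endpoint x0 t == x0) && (key t == tau))) => [t0 /andP[_ /eqP kt0]|none];
  last by rewrite big_pred0 ?expR_ge0.
pose u := total_vec x0 (traj_of t0).
pose S := \sum_(t : m.-tuple (X * C) | (endpoint x0 t == x0) && (key t == tau))
  weight P q x0 (word_of t).
rewrite (eq_bigr (fun t : m.-tuple (X * C) =>
   weight P q x0 (word_of t) * expR (pairing ell u))); last first.
  by move=> t /andP[_ /eqP kt]; rewrite (keyE t t0) // kt kt0.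
rewrite -mulr_suml -/S.
have [S0|S0] := leP S 0.
  by apply: le_trans (expR_ge0 _); rewrite mulr_le0_ge0 ?expR_ge0.
have mR : (m%:R : R) != 0 by rewrite pnatr_eq0.
pose f o := if o is Some j then u j / m%:R else ln S / m%:R.
have /below : hypograph P q x0 eta f.
  exists m => //; rewrite /f mulrCA mulfV // mulr1 lnK ?posrE //.
  exists (m.-tuple (X * C) : finType),
    (fun t : m.-tuple (X * C) => (endpoint x0 t == x0) && (key t == tau)),
    (fun t : m.-tuple (X * C) => word_of t), M.
  split=> //.
  - move=> t /andP[/eqP et _]; split => //; last by rewrite endpoint_word_of.
    by rewrite size_map size_tuple.
  - move=> s; apply: sum_bool_le1 => t t' _ _ ft ft'.
    by apply: val_inj; exact: word_of_inj ft ft'.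
  - move=> t s /andP[_ /eqP kt] /(total_near x0) near j.
    have := near j; rewrite size_tuple (keyE t t0) ?kt ?kt0 //.
    by rewrite /= mulrCA mulfV // mulr1.
move=> h; rewrite -[S]lnK ?posrE // -expRD ler_expR.
have -> : ln S + pairing ell u = m%:R * (pairing ell (f \o Some) + f None).
  rewrite /f /= mulrDr mulrCA mulfV // mulr1 addrC; congr (_ + _).
  by rewrite /pairing mulr_sumr; apply: eq_bigr => j _ /=; field.
by apply: ler_wpM2l.
Qed.

Lemma tilted_matrix_ge0 x y : 0 <= tilted_matrix x y.
Proof.
by apply: sumr_ge0 => c _; rewrite !mulr_ge0 ?expR_ge0 ?fine_ge0.
Qed.

Lemma tilted_power_ge0 m x : 0 <= tilted_power m x.
Proof.
by apply: sumr_ge0 => t _; rewrite mulr_ge0 ?expR_ge0 ?weight_ge0.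
Qed.

Hypothesis irr : irreducible P.
Hypothesis cells_charged : forall x y, exists c, 0 < fine (q x y (cell c)).

Lemma tilted_matrix_gt0 x y : 0 < P x y -> 0 < tilted_matrix x y.
Proof.
move=> Pxy; have [c qc] := cells_charged x y.
rewrite /tilted_matrix (bigD1 c) //=; apply: ltr_pwDl.
  by rewrite !mulr_gt0 ?expR_gt0.
by apply: sumr_ge0 => c' _; rewrite !mulr_ge0 ?expR_ge0 ?fine_ge0.
Qed.

Lemma tilted_reach x y : exists n k,
  0 < k /\ forall m, k * tilted_power m y <= tilted_power (n + m) x.
Proof.
have [n] := irr x y; elim: n x => [|n IH] x /=.
  case: eqP => [->|_]; last by rewrite ltxx.
  by move=> _; exists 0%N, 1; split=> // m; rewrite mul1r.
move=> pos.
have [z /andP[Pxz tz]] : exists z, (0 < P x z) && (0 < transition_pow P n z y).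
  apply/existsP; apply: contraLR pos; rewrite negb_exists -leNgt => /forallP h.
  apply: sumr_le0 => z _; have := h z; rewrite negb_and -!leNgt.
  have tge0 : 0 <= transition_pow P n z y.
    elim: n z {IH h} => [|n IH] z //=; apply: sumr_ge0 => w _.
    by rewrite mulr_ge0.
  by move=> /orP[h'|h']; [rewrite mulr_le0_ge0|rewrite mulr_ge0_le0].
have [n' [k [k0 kV]]] := IH _ tz.
exists n'.+1, (tilted_matrix x z * k); split.
  by rewrite mulr_gt0 // tilted_matrix_gt0.
move=> m; rewrite addSn tilted_powerS (bigD1 z) //= -mulrA ler_wpDr //.
  apply: sumr_ge0 => w _.
  by rewrite mulr_ge0 ?tilted_matrix_ge0 ?tilted_power_ge0.
by apply: ler_wpM2l => //; exact: tilted_matrix_ge0.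
Qed.

Lemma tilted_subinvariant (del : R) : 0 < del ->
  exists r : X -> R, (forall x, 0 < r x) /\
    forall x, \sum_y tilted_matrix x y * r y <= expR (Lam + del) * r x.
Proof.
move=> del0.
exact: (subinvariant_vector tilted_matrix_ge0 tilted_power0 tilted_powerS
  tilted_reach del0 tilted_power_growth).
Qed.

End cells.

(** * Finite exponential moments and discretization of the marks *)

Section cumulants.
Context {R : realType} {d : nat}.
Implicit Types (mu : probability (borel_rV R d) R) (lam a : 'rV[R]_d).

Lemma continuous_measurable_rV (f : 'rV[R]_d -> R) :
  continuous f -> measurable_fun [set: borel_rV R d] f.
Proof.
move=> cf; apply: (measurability _ (RGenOpens.measurableE R)).
move=> _ [_ [x [y ->]] <-]; rewrite setTI; apply: sub_sigma_algebra.
by apply: open_comp; [move=> z _; exact: cf|exact: interval_open].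
Qed.

Lemma continuous_coord (i : 'I_d) : continuous (fun a : 'rV[R]_d => a 0 i).
Proof. exact: coord_continuous. Qed.

Lemma measurable_coord (i : 'I_d) :
  measurable_fun [set: borel_rV R d] (fun a : 'rV[R]_d => a 0 i).
Proof. exact: (continuous_measurable_rV (@continuous_coord i)). Qed.

Lemma measurable_dot lam : measurable_fun [set: borel_rV R d] (dot lam).
Proof.
by apply: measurable_sum => i; apply: measurable_funM => //; exact: measurable_coord.
Qed.

Lemma measurable_norm1 : measurable_fun [set: borel_rV R d] (@norm1 R d).
Proof.
apply: measurable_sum => i; apply: measurableT_comp => //.
exact: measurable_coord.
Qed.

Lemma norm1_ge0 a : 0 <= norm1 a.
Proof. by apply: sumr_ge0. Qed.

Lemma dot_le_norm1 lam a : `|dot lam a| <= norm1 lam * norm1 a.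
Proof.
apply: (le_trans (ler_norm_sum _ _ _)).
rewrite /norm1 mulr_suml; apply: ler_sum => i _; rewrite normrM ler_wpM2l //.
by rewrite (bigD1 i) //= lerDl; exact: sumr_ge0.
Qed.

Let measurable_expR_norm1 s :
  measurable_fun [set: borel_rV R d] (fun a => (expR (s * norm1 a))%:E).
Proof.
apply/measurable_EFinP; apply: measurableT_comp => //.
by apply: measurable_funM => //; exact: measurable_norm1.
Qed.

Let measurable_expR_dot lam :
  measurable_fun [set: borel_rV R d] (fun a => (expR (dot lam a))%:E).
Proof.
apply/measurable_EFinP; apply: measurableT_comp => //; exact: measurable_dot.
Qed.

Let ball1 (M : nat) : set (borel_rV R d) := [set a | norm1 a <= M%:R].

Let measurable_ball1 M : measurable (ball1 M).
Proof.
have := measurable_norm1 measurableT (measurable_itv `]-oo, (M%:R : R)]).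
by rewrite setTI; congr measurable.
Qed.

Let bigcup_ball1 : \bigcup_M ball1 M = setT.
Proof.
apply/seteqP; split=> // a _; exists (Num.bound (norm1 a)) => //.
by rewrite /ball1 /= ltW // (le_lt_trans _ (archi_boundP _)) ?norm1_ge0.
Qed.

(* Tightness of a single law; the constant one half is arbitrary. *)
Let half_mass mu : exists M, ((1 / 2)%:E <= mu (ball1 M))%E.
Proof.
have : (mu \o ball1) n @[n --> \oo] --> mu (\bigcup_M ball1 M).
  apply: nondecreasing_cvg_mu => //; first by rewrite bigcup_ball1.
  move=> n m nm; apply/subsetPset => a /= h; apply: (le_trans h).
  by rewrite ler_nat.
rewrite bigcup_ball1 probability_setT => /fine_cvgP[_ h].
have [N _ HN] : \forall n \near \oo, 1 / 2 < fine (mu (ball1 n)).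
  by apply: (cvgr_gt _ h); rewrite /=; lra.
exists N; have /= := HN N (leqnn N).
by rewrite -lte_fin fineK ?fin_num_measure // => /ltW.
Qed.

Let integral_ge_half mu (f : borel_rV R d -> R) M c :
  measurable_fun setT f -> (forall a, 0 <= f a) -> 0 <= c ->
  ((1 / 2)%:E <= mu (ball1 M))%E -> (forall a, ball1 M a -> c <= f a) ->
  ((c / 2)%:E <= \int[mu]_a (f a)%:E)%E.
Proof.
move=> mf f0 c0 hM cf.
have mEf : measurable_fun [set: borel_rV R d] (EFin \o f) by exact/measurable_EFinP.
apply: (@le_trans _ _ (\int[mu]_(a in ball1 M) (f a)%:E)%E); last first.
  by apply: ge0_subset_integral => //= a _; rewrite lee_fin.
apply: (@le_trans _ _ (\int[mu]_(a in ball1 M) (cst c%:E a))%E).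
  rewrite integral_cst // -[c / 2]mulr1 -mulrA mulrC (_ : _ * c = c * (1 / 2)).
    by rewrite EFinM; apply: lee_wpmul2l => //; rewrite lee_fin.
  by field.
by apply: ge0_le_integral => //=; exact: measurable_funTS.
Qed.

Let integral1 mu : (\int[mu]_a (cst 1 a) = 1)%E.
Proof.
rewrite integral_cst // mul1e; exact: probability_setT.
Qed.

(** If the exponential moment of order [s0] were infinite, the supremum defining
    the conjugate would only range over [s < s0], and the conjugate would grow
    at most linearly, with slope [s0]. *)
Lemma finite_exp_moment mu :
  limf_einf (fun r : R => phi_abs_star mu r * (r^-1)%:E)%E +oo = +oo%E ->
  forall s, (\int[mu]_a (expR (s * norm1 a))%:E < +oo)%E.
Proof.
move=> sup s0; rewrite ltNge leye_eq; apply/negP => /eqP infty.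
have [M hM] := half_mass mu.
have s0_gt0 : 0 < s0.
  rewrite ltNge; apply/negP => s00.
  suff : (\int[mu]_a (expR (s0 * norm1 a))%:E <= \int[mu]_a (cst 1 a))%E.
    by rewrite infty integral1.
  apply: ge0_le_integral => //= a _; rewrite lee_fin ?expR_ge0 //.
  by rewrite -expR0 ler_expR mulr_le0_ge0 // norm1_ge0.
have bound r : M%:R <= r -> (phi_abs_star mu r <= (r * s0 + ln 2)%:E)%E.
  move=> Mr; have r0 : 0 <= r by apply: le_trans Mr.
  have l2 : 0 <= ln 2 :> R by rewrite ln_ge0 // ler1n.
  apply: ge_ereal_sup => _ [s _ <-]; rewrite /phi_abs.
  have [ss|ss] := leP s0 s.
    suff -> : (\int[mu]_a (expR (s * norm1 a))%:E = +oo)%E by rewrite /= leNye.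
    apply/eqP; rewrite -leye_eq -infty; apply: ge0_le_integral => //= a _.
    by rewrite lee_fin ler_expR ler_wpM2r ?norm1_ge0.
  set I := (\int[mu]_a _)%E.
  have lneI c : 0 < c -> (c%:E <= I)%E -> ((ln c)%:E <= lne I)%E.
    move=> c0 cI; have c0E : (0 <= c%:E)%E by rewrite lee_fin ltW.
    by rewrite -lne_EFin // lee_lne ?in_itv /= ?leey ?andbT // (le_trans c0E).
  have [s_ge0|s_lt0] := leP 0 s.
    have : ((ln (1 : R))%:E <= lne I)%E.
      apply: lneI => //.
      have -> : (1%:E = \int[mu]_a (cst 1 a) :> \bar R)%E.
        by rewrite integral1.
      apply: ge0_le_integral => //= a _; rewrite lee_fin.
      by rewrite -expR0 ler_expR mulr_ge0 // norm1_ge0.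
    rewrite ln1 => h.
    apply: (@le_trans _ _ ((r * s)%:E - 0%:E)%E); first exact: leeB.
    rewrite sube0 lee_fin; have := ler_wpM2l r0 (ltW ss); lra.
  have : ((ln (expR (s * M%:R) / 2))%:E <= lne I)%E.
    apply: lneI; first by rewrite divr_gt0 ?expR_gt0.
    apply: (@integral_ge_half mu (fun a => expR (s * norm1 a)) M) => //.
    - by apply/measurable_EFinP; exact: measurable_expR_norm1.
    - by move=> a Ba; rewrite ler_expR ler_wnM2l // ltW.
  rewrite ln_div ?posrE ?expR_gt0 // expRK => h.
  apply: (@le_trans _ _ ((r * s)%:E - (s * M%:R - ln 2)%:E)%E); first exact: leeB.
  rewrite -EFinB lee_fin.
  have h1 : s * r <= s * M%:R by rewrite ler_wnM2l // ltW.
  have := mulr_ge0 r0 (ltW s0_gt0); lra.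
have : (+oo <= (s0 + ln 2)%:E :> \bar R)%E.
  rewrite -sup limf_einfE; apply: ge_ereal_sup => _ [V [A [Areal AV]] <-].
  pose r := Num.max (Num.max M%:R 1) (A + 1).
  have rV : V r by apply: AV; rewrite /r lt_max ltrDl ltr01 orbT.
  have Mr : M%:R <= r by rewrite /r !le_max lexx.
  have r1 : 1 <= r by rewrite /r !le_max lexx orbT.
  have r0 : 0 < r by apply: lt_le_trans r1.
  apply: (@le_trans _ _ (phi_abs_star mu r * (r^-1)%:E)%E).
    by apply: ereal_inf_lbound; exists r.
  apply: (@le_trans _ _ ((r * s0 + ln 2)%:E * (r^-1)%:E)%E).
    by apply: lee_wpmul2r; [rewrite lee_fin invr_ge0 ltW|exact: bound].
  rewrite -EFinM lee_fin ler_pdivrMr //.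
  have l2 : 0 <= ln 2 :> R by rewrite ln_ge0 // ler1n.
  have := ler_wpM2l l2 r1; lra.
by [].
Qed.

Definition mgf mu lam : R := fine (\int[mu]_a (expR (dot lam a))%:E).

Lemma mgf0 mu : mgf mu 0 = 1.
Proof.
rewrite /mgf (eq_integral (cst 1%E)) => [|a _]; first by rewrite integral1.
by rewrite /dot big1 ?expR0 // => i _; rewrite mxE mul0r.
Qed.

Section finite.
Variable mu : probability (borel_rV R d) R.
Hypothesis fin : forall s, (\int[mu]_a (expR (s * norm1 a))%:E < +oo)%E.

Lemma integral_exp_dot lam : (\int[mu]_a (expR (dot lam a))%:E = (mgf mu lam)%:E)%E.
Proof.
rewrite /mgf fineK // ge0_fin_numE; last first.
  by apply: integral_ge0 => a _; rewrite lee_fin expR_ge0.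
apply: le_lt_trans (fin (norm1 lam)); apply: ge0_le_integral => //= a _.
by rewrite lee_fin ler_expR (le_trans (ler_norm _)) // dot_le_norm1.
Qed.

Lemma mgf_gt0 lam : 0 < mgf mu lam.
Proof.
have [M hM] := half_mass mu.
have : ((expR (- (norm1 lam * M%:R)) / 2)%:E <= (mgf mu lam)%:E)%E.
  rewrite -integral_exp_dot.
  apply: (@integral_ge_half mu (fun a => expR (dot lam a)) M) => //.
    by apply/measurable_EFinP; exact: measurable_expR_dot.
  move=> a Ba; rewrite ler_expR lerNl.
  apply: (le_trans (ler_norm _)); rewrite normrN.
  by apply: (le_trans (dot_le_norm1 _ _)); rewrite ler_wpM2l ?norm1_ge0.
by rewrite lee_fin; apply: lt_le_trans; rewrite divr_gt0 ?expR_gt0.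
Qed.

Lemma phiE lam : phi mu lam = (ln (mgf mu lam))%:E.
Proof. by rewrite /phi integral_exp_dot lne_EFin // mgf_gt0. Qed.

End finite.

(** A finite alphabet for the marks: the cells of mesh [h] inside the cube of side
    [2 h N], each represented by its lowest corner. *)
Section grid.
Variables (h : R) (N : nat).
Hypothesis h_gt0 : 0 < h.
Implicit Types c : {ffun 'I_d -> 'I_(N + N)}.

Definition corner c : 'rV[R]_d := \row_i (h * ((c i)%:R - N%:R)).

Definition grid_cell c : set (borel_rV R d) :=
  [set a | forall i, corner c 0 i <= a 0 i < corner c 0 i + h].

Definition grid_box : set (borel_rV R d) :=
  [set a | forall i, - (h * N%:R) <= a 0 i < h * N%:R].

Lemma measurable_box (u v : 'I_d -> R) :
  measurable ([set a | forall i, u i <= a 0 i < v i] : set (borel_rV R d)).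
Proof.
rewrite [X in measurable X](_ : _ = \bigcap_(i in [set: 'I_d])
    [set a : borel_rV R d | u i <= (a : 'rV[R]_d) 0 i < v i]); last first.
  by apply/seteqP; split=> a /= h1 i; [move=> _; exact: h1|exact: h1 i I].
apply: fin_bigcap_measurable => // i _.
have := measurable_coord i measurableT (measurable_itv `[u i, (v i)[).
by rewrite setTI; congr measurable.
Qed.

Lemma measurable_grid_cell c : measurable (grid_cell c).
Proof. exact: measurable_box. Qed.

Lemma grid_cell_disjoint c c' a : grid_cell c a -> grid_cell c' a -> c = c'.
Proof.
move=> ca c'a; apply/ffunP => i; apply: val_inj => /=.
have := ca i; have := c'a i; rewrite !mxE => /andP[l1 r1] /andP[l2 r2].
apply/eqP; rewrite eqn_leq; apply/andP.
by split; rewrite -ltnS -(ltr_nat R) -natr1 -(ltr_pM2l h_gt0); lra.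
Qed.

Lemma grid_cell_corner c a : grid_cell c a ->
  forall i, `|a 0 i - corner c 0 i| <= h.
Proof.
by move=> ca i; have /andP[l r] := ca i; rewrite ger0_norm; lra.
Qed.

Lemma grid_cell_bounded c a : grid_cell c a -> forall i, `|a 0 i| <= h * N%:R.
Proof.
move=> ca i; have := ca i; rewrite mxE => /andP[l r].
have : (c i)%:R + 1 <= N%:R + N%:R :> R.
  by rewrite natr1 -natrD ler_nat.
have : 0 <= (c i)%:R :> R by [].
move: ((c i)%:R) l r => k l r k0 kN.
have := ler_wpM2l (ltW h_gt0) kN; have := mulr_ge0 (ltW h_gt0) k0.
by rewrite ler_norml => ? ?; apply/andP; split; lra.
Qed.

Lemma grid_box_cover a : grid_box a -> exists c, grid_cell c a.
Proof.
move=> ba.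
pose k i := Num.truncn (a 0 i / h + N%:R).
have k_itv i : (k i)%:R <= a 0 i / h + N%:R < (k i).+1%:R.
  apply: truncn_itv; have /andP[l _] := ba i.
  rewrite -lerBlDr sub0r ler_pdivlMr //; lra.
have kN i : (k i < N + N)%N.
  have /andP[_ r] := ba i; have /andP[l _] := k_itv i.
  rewrite -(ltr_nat R); apply: (le_lt_trans l).
  by rewrite natrD ltrD2r ltr_pdivrMr // mulrC.
exists [ffun i => Ordinal (kN i)] => i; rewrite mxE ffunE /=.
have /andP[] := k_itv i; rewrite -natr1.
have : a 0 i = h * (a 0 i / h) by field; rewrite gt_eqF.
move: (a 0 i) (a 0 i / h) ((k i)%:R) => _ t m -> l r.
have := ler_wpM2l (ltW h_gt0) l; have : h * (t + N%:R) < h * (m + 1).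
  by rewrite ltr_pM2l.
by move=> ? ?; apply/andP; split; lra.
Qed.

(** On a cell the exponent varies by at most [h * norm1 lam]. *)
Lemma grid_mass mu lam :
  (\int[mu]_(a in grid_box) (expR (dot lam a))%:E <=
   ((\sum_c fine (mu (grid_cell c)) * expR (dot lam (corner c)))
    * expR (h * norm1 lam))%:E)%E.
Proof.
have mf D : measurable_fun D (fun a : borel_rV R d => (expR (dot lam a))%:E).
  by apply: measurable_funTS; exact: measurable_expR_dot.
have f0 (a : borel_rV R d) : (0 <= (expR (dot lam a))%:E)%E.
  by rewrite lee_fin expR_ge0.
pose U := \big[setU/set0]_(c <- enum {ffun 'I_d -> 'I_(N + N)}) grid_cell c.
have mU : measurable U.
  by apply: bigsetU_measurable => c _; exact: measurable_grid_cell.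
apply: (@le_trans _ _ (\int[mu]_(a in U) (expR (dot lam a))%:E)%E).
  apply: ge0_subset_integral => //; first exact: measurable_box.
  move=> a /grid_box_cover[c ca]; rewrite /U -bigcup_seq; exists c => //=.
  by rewrite mem_enum.
rewrite /U ge0_integral_bigsetU //=; last first.
- by apply/trivIsetP => c c' _ _; apply: contra_neqP => /eqP/set0P[a [ca c'a]];
    exact: grid_cell_disjoint ca c'a.
- exact: enum_uniq.
- by move=> c; exact: measurable_grid_cell.
rewrite big_enum /= mulr_suml -sumEFin; apply: lee_sum => c _.
apply: (@le_trans _ _ (\int[mu]_(a in grid_cell c)
   cst (expR (dot lam (corner c)) * expR (h * norm1 lam))%:E a)%E).
  apply: ge0_le_integral => //=; first exact: measurable_grid_cell.
  move=> a ca; rewrite lee_fin -expRD ler_expR -lerBlDl /dot -sumrB.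
  rewrite mulrC /norm1 mulr_suml; apply: ler_sum => i _; rewrite -mulrBr.
  apply: (le_trans (ler_norm _)); rewrite normrM ler_wpM2l //.
  exact: grid_cell_corner.
rewrite integral_cst; last exact: measurable_grid_cell.
rewrite -[X in (_ * X)%E]fineK ?fin_num_measure //; last exact: measurable_grid_cell.
by rewrite -EFinM lee_fin le_eqVlt; apply/orP; left; apply/eqP; ring.
Qed.

End grid.

(** A fine grid, in a large cube, loses little of the moment generating function:
    the mesh costs a factor [exp (e / 2)], and so does the tail outside the cube. *)
Lemma grid_approximation mu lam h e : 0 < h -> 0 < e ->
  (forall s, (\int[mu]_a (expR (s * norm1 a))%:E < +oo)%E) ->
  h * norm1 lam <= e / 2 ->
  exists N0, forall N, (N0 <= N)%N ->
    mgf mu lam * expR (- e) <=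
    \sum_c fine (mu (@grid_cell h N c)) * expR (dot lam (@corner h N c)).
Proof.
move=> h0 e0 fin hlam.
have cvg : (\int[mu]_(a in grid_box h n) (expR (dot lam a))%:E)%E @[n --> \oo]
    --> (\int[mu]_(a in \bigcup_n grid_box h n) (expR (dot lam a))%:E)%E.
  apply: ge0_nondecreasing_set_cvg_integral => //.
  - move=> n m nm; apply/subsetPset => a /= ba i; have /andP[l r] := ba i.
    have : h * n%:R <= h * m%:R by rewrite ler_pM2l // ler_nat.
    by move=> nm'; apply/andP; split; lra.
  - by move=> i; exact: measurable_box.
  - by move=> i; apply: measurable_funTS; exact: measurable_expR_dot.
have bT : \bigcup_n grid_box h n = setT.
  apply/seteqP; split=> // a _.
  have [n nP] : exists n : nat, forall i, `|a 0 i| / h < n%:R.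
    exists (\max_(i < d) Num.bound (`|a 0 i| / h)%R)%N => i.
    apply: (lt_le_trans (archi_boundP _)); first by rewrite divr_ge0 // ltW.
    by rewrite ler_nat (leq_bigmax i).
  exists n => // i; have := nP i; rewrite ltr_pdivrMr // mulrC ltr_norml.
  by move=> /andP[l r]; rewrite ltW.
move: cvg; rewrite bT integral_exp_dot // => /fine_cvgP[_ h'].
have mg := mgf_gt0 fin lam.
have [N0 _ HN] : \forall n \near \oo, mgf mu lam * expR (- (e / 2)) <
    fine (\int[mu]_(a in grid_box h n) (expR (dot lam a))%:E)%E.
  by apply: (cvgr_gt _ h'); rewrite gtr_pMr // expR_lt1; lra.
exists N0 => N NN0; have /= big := HN N NN0.
have := grid_mass N h0 mu lam; set I := (\int[mu]_(a in _) _)%E in big *.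
set S := \sum_c _ => IS.
have IfinN : I \is a fin_num.
  rewrite ge0_fin_numE; first by rewrite (le_lt_trans IS) ?ltry.
  by apply: integral_ge0 => a _; rewrite lee_fin expR_ge0.
have {IS} : fine I <= S * expR (h * norm1 lam) by rewrite -lee_fin fineK.
move=> IS.
have S0 : 0 <= S.
  by apply: sumr_ge0 => c _; rewrite mulr_ge0 ?expR_ge0 ?fine_ge0.
have : mgf mu lam * expR (- (e / 2)) <= S * expR (e / 2).
  apply: (le_trans (ltW big)); apply: (le_trans IS).
  by rewrite ler_wpM2l // ler_expR.
have -> : - e = - (e / 2) - e / 2 by field.
rewrite expRD mulrA expRN => H.
by rewrite ler_pdivrMr ?expR_gt0.
Qed.

End cumulants.

(** * The rate functional as a supremum of linear functionals *)

(** The suprema that define the terms of the rate functional can be approached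
    independently of each other. *)
Lemma lt_sum_split {R : realType} (I : finType) (f : I -> \bar R) (c : R) :
  (forall i, (0 <= f i)%E) -> (c%:E < \sum_i f i)%E ->
  exists h : I -> R, (forall i, ((h i)%:E < f i)%E) /\ c <= \sum_i h i.
Proof.
move=> f0 cf; case: (pselect (exists i, f i = +oo%E)) => [[i0 fi0]|nofin].
  (* the other terms are nonnegative, hence above -1 *)
  exists (fun i => if i == i0 then c + #|I|%:R else -1); split=> [i|].
    case: eqP => [->|_]; first by rewrite fi0 ltry.
    by apply: lt_le_trans (f0 i); rewrite lte_fin ltrN10.
  rewrite (bigD1 i0) //= eqxx (eq_bigr (fun=> -1)) => [|i /negPf -> //].
  rewrite sumr_const -addrA lerDl mulNrn subr_ge0 ler_nat.
  exact: max_card.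
have ffin i : f i \is a fin_num.
  by rewrite ge0_fin_numE // ltey; apply/eqP => fi; apply: nofin; exists i.
move: cf; rewrite (eq_bigr (fun i => (fine (f i))%:E)) => [|i _]; last by rewrite fineK.
rewrite sumEFin lte_fin => cf.
pose e := (\sum_i fine (f i) - c) / #|I|.+1%:R.
have e0 : 0 < e by rewrite divr_gt0 ?subr_gt0.
exists (fun i => fine (f i) - e); split=> [i|].
  by rewrite -[ltRHS]fineK // lte_fin ltrBlDr ltrDl.
rewrite sumrB sumr_const; set S := \sum_i _ in cf e e0 *.
have eS : e * #|I|.+1%:R = S - c by rewrite /e divfK // pnatr_eq0.
move: eS; rewrite -natr1 mulrDr mulr1 mulr_natr; move: (e *+ _) => t; lra.
Qed.

Lemma big_option {V : nmodType} (I : finType) (F : option I -> V) :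
  \sum_o F o = F None + \sum_i F (Some i).
Proof.
rewrite (bigD1 None) //=; congr (_ + _).
rewrite (reindex_omap some id) /=; last by case.
by apply: eq_bigl => i; rewrite eqxx.
Qed.

Section duality.
Context {R : realType} {X : finType} {d : nat}.
Variables (P : X -> X -> R) (q : X -> X -> probability (borel_rV R d) R).
Hypothesis P_ge0 : forall x y, 0 <= P x y.
Hypothesis fin : forall x y s, (\int[q x y]_a (expR (s * norm1 a))%:E < +oo)%E.

Notation coordinate := ((X * X) * option 'I_d)%type.
Implicit Types (z : state_space R X d).

Definition state_coord z (j : coordinate) : R :=
  if j.2 is Some i then (z.1 : X * X -> 'rV[R]_d) j.1 0 i
  else (set_val z.2 : X * X -> R) j.1.

Definition linear_functional (lam : X -> X -> 'rV[R]_d) (t : X -> X -> R)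
    (j : coordinate) : R :=
  if j.2 is Some i then lam j.1.1 j.1.2 0 i else t j.1.1 j.1.2.

Lemma pairing_functional lam t u : pairing (linear_functional lam t) u =
  \sum_x \sum_y (\sum_i lam x y 0 i * u ((x, y), Some i)
                 + t x y * u ((x, y), None)).
Proof.
rewrite pair_big /pairing /=.
rewrite (eq_bigr (fun j : coordinate =>
   (fun p o => linear_functional lam t (p, o) * u (p, o)) j.1 j.2)); last by case.
rewrite -(pair_big predT predT
   (fun p o => linear_functional lam t (p, o) * u (p, o))) /=.
apply: eq_bigr => -[x y] _; by rewrite big_option addrC.
Qed.

Lemma phi_starE x y k : phi_star (q x y) k =
  ereal_sup [set (dot lam k - ln (mgf (q x y) lam))%:E | lam in setT].
Proof.
rewrite /phi_star; congr ereal_sup; apply/seteqP.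
by split=> _ [lam _ <-]; exists lam => //; rewrite phiE.
Qed.

Lemma phi_star_ge0 x y k : (0 <= phi_star (q x y) k)%E.
Proof.
rewrite phi_starE; apply: ereal_sup_ubound; exists 0 => //.
by rewrite mgf0 ln1 subr0 /dot big1 // => i _; rewrite mxE mul0r.
Qed.

Lemma dotZ (c : R) (lam k : 'rV[R]_d) : dot lam (c *: k) = c * dot lam k.
Proof.
by rewrite /dot mulr_sumr; apply: eq_bigr => i _; rewrite mxE mulrCA.
Qed.

Lemma mark_cost_ge0 x y k t : 0 <= t -> (0 <= mark_cost (q x y) k t)%E.
Proof.
move=> t0; rewrite /mark_cost; case: eqP => // _.
by rewrite mule_ge0 ?lee_fin // phi_star_ge0.
Qed.

Lemma mark_cost_ge x y lam k t : 0 <= t -> (t = 0 -> k = 0) ->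
  ((dot lam k - t * ln (mgf (q x y) lam))%:E <= mark_cost (q x y) k t)%E.
Proof.
move=> t0 ac; rewrite /mark_cost; case: eqP => [t_eq0|/eqP t_neq0].
  by rewrite ac // t_eq0 mul0r subr0 /dot big1 // => i _; rewrite mxE mulr0.
have t_gt0 : 0 < t by rewrite lt_neqAle eq_sym t_neq0.
rewrite -[k in dot _ k](scalerKV t_neq0) dotZ -mulrBr EFinM.
apply: lee_wpmul2l; first by rewrite lee_fin.
by rewrite phi_starE; apply: ereal_sup_ubound; exists lam.
Qed.

(** When [t = 0] and [k != 0] the supremum over [lam] of [lam . k] is infinite: this
    accounts for the condition that [k] is absolutely continuous. *)
Lemma mark_cost_lt x y k t c : 0 <= t ->
  (t = 0 -> k = 0 -> c < 0) ->
  (t != 0 -> (c%:E < mark_cost (q x y) k t)%E) ->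
  exists lam, c <= dot lam k - t * ln (mgf (q x y) lam).
Proof.
move=> t0 h0 h1; have [t_eq0|t_neq0] := eqVneq t 0.
  have [k0|k_neq0] := eqVneq k 0.
    exists 0; rewrite t_eq0 mul0r subr0 /dot big1; first exact/ltW/h0.
    by move=> i _; rewrite mxE mul0r.
  pose S := \sum_i k 0 i * k 0 i.
  have S0 : 0 < S.
    have [i ki] : exists i, k 0 i != 0.
      apply/existsP; apply: contraR k_neq0; rewrite negb_exists => /forallP h.
      by apply/eqP/rowP => i; rewrite mxE; apply/eqP; have := h i; rewrite negbK.
    rewrite /S (bigD1 i) //=; apply: ltr_pwDl.
      by rewrite -expr2 exprn_even_gt0.
    by apply: sumr_ge0 => j _; rewrite -expr2 sqr_ge0.
  exists ((c / S) *: k); rewrite t_eq0 mul0r subr0 /dot.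
  rewrite (eq_bigr (fun i => c / S * (k 0 i * k 0 i))) => [|i _]; last first.
    by rewrite mxE mulrA.
  by rewrite -mulr_sumr -/S divfK // gt_eqF.
have t_gt0 : 0 < t by rewrite lt_neqAle eq_sym t_neq0.
have := h1 t_neq0; rewrite /mark_cost (negPf t_neq0) phi_starE => clt.
have : ((c / t)%:E < ereal_sup [set (dot lam (t^-1 *: k) -
    ln (mgf (q x y) lam))%:E | lam in setT])%E.
  by rewrite mulrC EFinM lte_pdivrMl.
move=> /ereal_sup_gt[_ [lam _ <-]]; rewrite lte_fin => h.
exists lam; rewrite dotZ in h; apply/ltW.
by move: h; rewrite ltr_pdivrMr // mulrBl mulrAC mulVf // mul1r [_ * t]mulrC.
Qed.

Lemma rel_ent_ge0 (a b : R) : 0 <= a -> 0 <= b -> (0 <= rel_ent a b)%E.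
Proof.
move=> a0 b0; rewrite /rel_ent.
have [-> |a_neq0] := eqVneq a 0; first by rewrite ltxx /= b0 lee_fin.
have a_gt0 : 0 < a by rewrite lt_neqAle eq_sym a_neq0.
rewrite a_gt0 /=; case: ltP => //= b_gt0; rewrite lee_fin.
have := expR_ge1Dx (- ln (a / b)).
rewrite expRN lnK ?posrE ?divr_gt0 // invf_div => h.
have := ler_wpM2l a0 h; rewrite [a * (b / a)]mulrC divfK //; lra.
Qed.

(** With [t = g - ln (a / b)] this is [exp t >= 1 + t]. *)
Lemma rel_ent_ge (g a b : R) : 0 <= a -> 0 <= b ->
  ((a * g - b * (expR g - 1))%:E <= rel_ent a b)%E.
Proof.
move=> a0 b0; rewrite /rel_ent.
have [-> |a_neq0] := eqVneq a 0.
  by rewrite ltxx /= b0 lee_fin; have := mulr_ge0 b0 (expR_ge0 g); lra.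
have a_gt0 : 0 < a by rewrite lt_neqAle eq_sym a_neq0.
rewrite a_gt0 /=; case: ltP => [b_gt0|_] /=; last by rewrite leey.
rewrite lee_fin; have := expR_ge1Dx (g - ln (a / b)).
rewrite expRB lnK ?posrE ?divr_gt0 // => h.
have := ler_wpM2l a0 h.
rewrite (_ : a * (expR g / (a / b)) = b * expR g).
  by move: (expR g) (ln (a / b)) => E L'; lra.
by field; rewrite a_neq0 gt_eqF.
Qed.

(** The supremum is reached at [g = ln (a / b)], or approached at infinity when [a]
    or [b] vanishes. *)
Lemma rel_ent_lt (a b c : R) : 0 <= a -> 0 <= b -> (c%:E < rel_ent a b)%E ->
  exists g : R, c <= a * g - b * (expR g - 1).
Proof.
move=> a0 b0; rewrite /rel_ent.
have [-> |a_neq0] := eqVneq a 0.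
  rewrite ltxx /= b0 lte_fin => cb.
  have [b_eq0|b_neq0] := eqVneq b 0.
    by exists 0; rewrite b_eq0 in cb *; lra.
  have b_gt0 : 0 < b by rewrite lt_neqAle eq_sym b_neq0.
  exists (ln ((b - c) / b)); rewrite lnK ?posrE ?divr_gt0 ?subr_gt0 //.
  rewrite mulrBr mulrCA mulfV // !mulr1; lra.
have a_gt0 : 0 < a by rewrite lt_neqAle eq_sym a_neq0.
rewrite a_gt0 /=; case: (ltP 0 b) => [b_gt0|b_le0] /=.
  rewrite lte_fin => h; exists (ln (a / b)).
  rewrite lnK ?posrE ?divr_gt0 // (_ : b * (a / b - 1) = a - b); first by lra.
  by field; rewrite gt_eqF.
move=> _; exists (c / a); have -> : b = 0 by apply/eqP; rewrite eq_le b_le0.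
by rewrite mul0r subr0 mulrCA mulfV // mulr1.
Qed.

Lemma theta_ge0 z p : 0 <= (set_val z.2 : X * X -> R) p.
Proof. by have [h _] := set_valP z.2; exact: h. Qed.

Lemma theta_sum z : \sum_p (set_val z.2 : X * X -> R) p = 1.
Proof. by have [_ h] := set_valP z.2. Qed.

Lemma theta_le1 z p : (set_val z.2 : X * X -> R) p <= 1.
Proof.
rewrite -[leRHS](theta_sum z) (bigD1 p) //= lerDl; apply: sumr_ge0 => *.
exact: theta_ge0.
Qed.

Lemma marg1_ge0 z x : 0 <= marg1 (set_val z.2) x.
Proof. by apply: sumr_ge0 => y _; exact: theta_ge0. Qed.

(** The terms [b (exp g - 1)] of the entropy, with [b = marg1 theta x * P x y], are
    linear in [theta]; their sum over [y] is moved to the coefficients of the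
    [theta_{xy}]. *)
Definition dual_vector (lam : X -> X -> 'rV[R]_d) (g : X -> X -> R) : coordinate -> R :=
  linear_functional lam (fun x y => g x y - ln (mgf (q x y) (lam x y))
     - \sum_y' P x y' * (expR (g x y') - 1)).

Lemma pairing_dual lam g z : pairing (dual_vector lam g) (state_coord z) =
  \sum_p ((dot (lam p.1 p.2) ((z.1 : X * X -> 'rV[R]_d) p)
           - (set_val z.2 : X * X -> R) p * ln (mgf (q p.1 p.2) (lam p.1 p.2)))
   + ((set_val z.2 : X * X -> R) p * g p.1 p.2
      - marg1 (set_val z.2) p.1 * P p.1 p.2 * (expR (g p.1 p.2) - 1))).
Proof.
rewrite pairing_functional.
transitivity (\sum_x \sum_y ((dot (lam x y) ((z.1 : X * X -> 'rV[R]_d) (x, y))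
           - (set_val z.2 : X * X -> R) (x, y) * ln (mgf (q x y) (lam x y)))
   + ((set_val z.2 : X * X -> R) (x, y) * g x y
      - marg1 (set_val z.2) x * P x y * (expR (g x y) - 1)))); last first.
  by rewrite pair_big /=; apply: eq_bigr => -[x y].
apply: eq_bigr => x _; rewrite /state_coord /=.
pose D := \sum_y' P x y' * (expR (g x y') - 1).
have E : \sum_y marg1 (set_val z.2) x * P x y * (expR (g x y) - 1) =
    \sum_y (set_val z.2 : X * X -> R) (x, y) * D.
  rewrite -mulr_suml -/(marg1 (set_val z.2) x) /D mulr_sumr.
  by apply: eq_bigr => y _; rewrite mulrA.
rewrite [in RHS]big_split /= [X in _ = _ + X]sumrB E.
rewrite -sumrB -[in RHS]big_split /=; apply: eq_bigr => y _.
by rewrite -/D /dot; ring.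
Qed.

Definition balanced z := marg1 (set_val z.2) =1 marg2 (set_val z.2).

Definition supported z :=
  abs_cont (z.1 : X * X -> 'rV[R]_d) (set_val z.2 : X * X -> R).

Lemma rate_infty z : ~ (supported z /\ balanced z) -> rate P q z = +oo%E.
Proof. by move=> h; rewrite /rate; case: asboolP. Qed.

Lemma rateE z : supported z -> balanced z -> rate P q z =
  (\sum_p (mark_cost (q p.1 p.2) ((z.1 : X * X -> 'rV[R]_d) p)
             ((set_val z.2 : X * X -> R) p)
    + rel_ent ((set_val z.2 : X * X -> R) p)
             (marg1 (set_val z.2) p.1 * P p.1 p.2)%R))%E.
Proof.
move=> ac bal; rewrite /rate; case: asboolP => [_|[]//].
rewrite !pair_big /= big_split /=.
by congr (_ + _)%E; apply: eq_bigr => -[x y].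
Qed.

Lemma rate_ge0 z : (0 <= rate P q z)%E.
Proof.
have [[ac bal]|h] := pselect (supported z /\ balanced z); last first.
  by rewrite rate_infty.
rewrite rateE //; apply: sume_ge0 => p _; rewrite adde_ge0 //.
  by rewrite mark_cost_ge0 // theta_ge0.
by rewrite rel_ent_ge0 ?theta_ge0 // mulr_ge0 // marg1_ge0.
Qed.

Lemma dual_le_rate lam g z : ((pairing (dual_vector lam g) (state_coord z))%:E <= rate P q z)%E.
Proof.
have [[ac bal]|h] := pselect (supported z /\ balanced z); last first.
  by rewrite rate_infty // leey.
rewrite rateE // pairing_dual -sumEFin; apply: lee_sum => p _.
rewrite EFinD; apply: leeD.
  by apply: mark_cost_ge; [exact: theta_ge0|exact: ac].
by apply: rel_ent_ge; [exact: theta_ge0|rewrite mulr_ge0 // marg1_ge0].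
Qed.

(** [F] adds to the cost of the marks the value infinity where [k] is not absolutely
    continuous, so that both cases of the rate functional are treated at once. *)
Lemma dual_ge z c : balanced z -> (c%:E < rate P q z)%E ->
  exists lam g, c <= pairing (dual_vector lam g) (state_coord z).
Proof.
move=> bal clt.
pose kz := (z.1 : X * X -> 'rV[R]_d); pose th := (set_val z.2 : X * X -> R).
pose F p : \bar R := if (th p == 0) && (kz p != 0) then +oo%E
   else mark_cost (q p.1 p.2) (kz p) (th p).
pose G p : \bar R := rel_ent (th p) (marg1 th p.1 * P p.1 p.2)%R.
have F0 p : (0 <= F p)%E.
  by rewrite /F; case: ifP => // _; rewrite mark_cost_ge0 // theta_ge0.
have G0 p : (0 <= G p)%E.
  by rewrite rel_ent_ge0 ?theta_ge0 // mulr_ge0 // marg1_ge0.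
have : (c%:E < \sum_p \sum_(b : bool) if b then F p else G p)%E.
  under eq_bigr do rewrite big_bool.
  have [ac|nac] := pselect (supported z).
    move: clt; rewrite rateE // => /lt_le_trans; apply; apply: lee_sum => p _.
    apply: leeD => //; rewrite /F; case: eqP => //= /ac kp.
    by rewrite /kz kp eqxx.
  have [p hp] : exists p, (th p == 0) && (kz p != 0).
    apply: contrapT => h; apply: nac => p tp; apply/eqP; apply: contrapT => kp.
    by apply: h; exists p; rewrite /th tp eqxx; apply/negP.
  rewrite (bigD1 p) //= {1}/F hp addye ?addye ?ltry //.
    rewrite gt_eqF // (lt_le_trans (ltNyr 0)) //; apply: sume_ge0 => p' _.
    by rewrite adde_ge0.
  by rewrite gt_eqF // (lt_le_trans (ltNyr 0)).
move=> /lt_sum_split[p|h [hlt ch]]; first by apply: sume_ge0 => -[].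
have /choice[h2 h2P] p : exists hb : bool -> R,
    (forall b, ((hb b)%:E < if b then F p else G p)%E) /\ h p <= \sum_b hb b.
  by apply: lt_sum_split => // -[].
have /choice[lam lamP] p : exists l, h2 p true <=
    dot l (kz p) - th p * ln (mgf (q p.1 p.2) l).
  apply: mark_cost_lt => [|tp kp|tp]; first exact: theta_ge0.
    have := (h2P p).1 true; rewrite /F kp eqxx andbF /mark_cost tp eqxx.
    by rewrite lte_fin.
  by have := (h2P p).1 true; rewrite /F (negPf tp).
have /choice[g gP] p : exists g : R, h2 p false <=
    th p * g - marg1 th p.1 * P p.1 p.2 * (expR g - 1).
  apply: rel_ent_lt; first exact: theta_ge0.
    by rewrite mulr_ge0 // marg1_ge0.
  exact: (h2P p).1 false.
exists (fun x y => lam (x, y)), (fun x y => g (x, y)).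
rewrite pairing_dual; apply: (le_trans ch); apply: ler_sum => -[x y] _ /=.
apply: (le_trans (h2P _).2); rewrite big_bool; apply: lerD.
  exact: lamP.
exact: gP.
Qed.

End duality.

(** * The topology of the state space, by coordinates *)

Lemma cvg_prod_topology (I : choiceType) (V : topologicalType)
    (F : set_system {ptws I -> V}) (f : {ptws I -> V}) : Filter F ->
  (forall i, (g : I -> V) i @[g --> F] --> (f : I -> V) i) -> F --> f.
Proof.
move=> FF cv; apply/cvg_sup => i; move=> U.
rewrite nbhsE => -[W [[B oB <-] Bf] WU].
have : F ((fun g : {ptws I -> V} => (g : I -> V) i) @^-1` B).
  by apply: (cv i); exact: open_nbhs_nbhs.
by apply: filterS => g /= Bg; exact: WU.
Qed.

Lemma cvg_set_type (V : topologicalType) (A : set V) (F : set_system (set_type A))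
    (a : set_type A) : Filter F ->
  set_val b @[b --> F] --> set_val a -> F --> a.
Proof.
move=> FF cv U; rewrite nbhsE => -[W [[B oB <-] Ba] WU].
have : F (set_val @^-1` B) by apply: cv; exact: open_nbhs_nbhs.
by apply: filterS => b /= Bb; exact: WU.
Qed.

(** A cluster point of the image filter lies in [A], hence lifts to the subtype. *)
Lemma compact_set_type (V : topologicalType) (A : set V) :
  compact A -> compact [set: set_type A].
Proof.
move=> cA F FF _.
have [|v [Av cl]] := cA (fmap set_val F).
  by rewrite /fmap /=; apply: filterS filterT => b _; exact: set_valP.
exists (SigSub (mem_set Av)); split=> // B U FB.
rewrite nbhsE => -[W [[C oC <-] Ca] WU].
have [|w [[b Bb <-] Cw]] := cl (set_val @` B) C _ (open_nbhs_nbhs (conj oC Ca)).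
  by rewrite /fmap /=; apply: filterS FB => b Bb; exists b.
by exists b; split => //; exact: WU.
Qed.

Section topology.
Context {R : realType} {X : finType} {d : nat}.
Notation coordinate := ((X * X) * option 'I_d)%type.
Implicit Types (z : state_space R X d).

Lemma continuous_ev {V : topologicalType} (p : X * X) :
  continuous (fun k : {ptws X * X -> V} => (k : X * X -> V) p).
Proof. exact: (@proj_continuous _ (fun=> V) p). Qed.

Lemma continuous_theta p :
  continuous (fun z => (set_val z.2 : X * X -> R) p).
Proof.
move=> z.
apply: (@continuous_comp _ _ _ (fun z : state_space R X d => z.2)
  (fun t => (set_val t : X * X -> R) p)); first exact: cvg_snd.
apply: (@continuous_comp _ _ _ (set_val : set_type (@prob_simplex R X) -> _)
  (fun k : {ptws X * X -> R} => (k : X * X -> R) p)); last exact: continuous_ev.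
exact: initial_continuous.
Qed.

Lemma continuous_coord_state (j : coordinate) : continuous (fun z => state_coord z j).
Proof.
case: j => p [i|] z /=; last exact: continuous_theta.
apply: (@continuous_comp _ _ _ (fun z : state_space R X d => z.1)
  (fun k : {ptws X * X -> 'rV[R]_d} => (k : X * X -> 'rV[R]_d) p 0 i)).
  exact: cvg_fst.
apply: (@continuous_comp _ _ _ (fun k : {ptws X * X -> 'rV[R]_d} =>
   (k : X * X -> 'rV[R]_d) p) (fun a : 'rV[R]_d => a 0 i)).
  exact: continuous_ev.
exact: coord_continuous.
Qed.

Lemma continuous_pairing_coord (u : coordinate -> R) :
  continuous (fun z => pairing u (state_coord z)).
Proof.
move=> z; rewrite /pairing; apply: cvg_big => [|j _]; first exact: add_continuous.
by apply: cvgMl_tmp; exact: continuous_coord_state.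
Qed.

(** The filter generated by the coordinate boxes around [z] converges to [z], since it
    does so in each factor of the product topology. *)
Lemma nbhs_coord z (U : set (state_space R X d)) : nbhs z U ->
  exists2 e, 0 < e &
    forall z', (forall j, `|state_coord z' j - state_coord z j| < e) -> U z'.
Proof.
pose box e : set (state_space R X d) :=
  [set z' | forall j, `|state_coord z' j - state_coord z j| < e].
pose F : set_system (state_space R X d) :=
  [set B | exists2 e, 0 < e & box e `<=` B].
have FF : Filter F.
  split.
  - by exists 1.
  - move=> A B [e1 e10 h1] [e2 e20 h2]; exists (Num.min e1 e2).
      by rewrite lt_min e10 e20.
    move=> z' h; split; [apply: h1|apply: h2] => j.
      by apply: (lt_le_trans (h j)); rewrite ge_min lexx.
    by apply: (lt_le_trans (h j)); rewrite ge_min lexx orbT.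
  - by move=> A B AB [e e0 h]; exists e => // z' /h/AB.
suff : F --> z by move=> /[apply].
have coordF j : state_coord z' j @[z' --> F] --> state_coord z j.
  by apply/cvgrPdist_lt => e e0; exists e => // z' h; rewrite /= distrC.
have F1 : z'.1 @[z' --> F] --> z.1.
  apply: cvg_prod_topology => p.
  apply/cvg_ballP => e e0.
  exists e => // z' h; split=> // i j.
  rewrite (ord1 i) /ball /= distrC; exact: (h (p, Some j)).
have F2 : z'.2 @[z' --> F] --> z.2.
  by apply: cvg_set_type; apply: cvg_prod_topology => p; exact: (coordF (p, None)).
move=> V; have -> : nbhs z V = nbhs (z.1, z.2) V by case: (z).
move=> zV; have FV : F [set x | V (x.1, x.2)] := cvg_pair F1 F2 zV.
by case: FV => e e0 h; exists e => // -[k th] /h.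
Qed.

Lemma continuous_sum_ev :
  continuous (fun k : {ptws X * X -> R} => \sum_p (k : X * X -> R) p).
Proof.
move=> k.
have ev (p : X * X) : true ->
    (f : X * X -> R) p @[f --> k] --> (k : X * X -> R) p.
  by move=> _; exact: (@continuous_ev R p k).
exact: (@cvg_big R (X * X)%type +%R 0 xpredT (@add_continuous R)
  {ptws X * X -> R} (nbhs k) (index_enum _) (fun p f => (f : X * X -> R) p)
  (k : X * X -> R) _ ev).
Qed.

Lemma compact_prob_simplex : compact (@prob_simplex R X).
Proof.
have cbox : compact [set f : {ptws X * X -> R} |
    forall p, `[0, 1]%classic ((f : X * X -> R) p)].
  apply: (@tychonoff _ (fun=> R) (fun=> `[0, 1]%classic)) => _.
  exact: segment_compact.
apply: (subclosed_compact _ cbox); last first.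
  move=> f [f0 f1] p /=; rewrite in_itv /= f0 /= -f1 (bigD1 p) //= lerDl.
  by apply: sumr_ge0 => p' _; exact: f0.
rewrite (_ : prob_simplex (X:=X) =
  (\bigcap_(p in setT) ((fun k : {ptws X * X -> R} => (k : X * X -> R) p) @^-1`
     [set x | 0 <= x])) `&`
  ((fun k : {ptws X * X -> R} => \sum_p (k : X * X -> R) p) @^-1` [set 1])).
  apply: closedI.
    apply: closed_bigI => p _; apply: closed_comp; last exact: closed_ge.
    by move=> k _; exact: continuous_ev.
  apply: closed_comp; last exact: closed_eq.
  by move=> k _; exact: continuous_sum_ev.
apply/seteqP; split=> f /= [f0 f1]; split=> // p; first by move=> _; exact: f0.
exact: f0.
Qed.

Lemma compact_coord_box (M : R) :
  compact [set z : state_space R X d | forall j, `|state_coord z j| <= M].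
Proof.
pose K : set {ptws X * X -> 'rV[R]_d} := [set f | forall p,
  [set v : 'rV[R]_d | forall i, `[- M, M]%classic (v ord0 i)] (f p)].
have cK : compact K.
  apply: (@tychonoff _ (fun=> 'rV[R]_d) (fun=>
    [set v : 'rV[R]_d | forall i, `[- M, M]%classic (v ord0 i)])) => p.
  by apply: (@rV_compact R d (fun=> `[- M, M]%classic)) => i; exact: segment_compact.
have cX : compact (K `*` [set: set_type (@prob_simplex R X)]).
  by apply: compact_setX => //; apply: compact_set_type; exact: compact_prob_simplex.
apply: (subclosed_compact _ cX); last first.
  move=> z h; split=> // p i /=; rewrite in_itv /= -ler_norml.
  exact: (h (p, Some i)).
rewrite (_ : [set z | _] = \bigcap_(j in [set: coordinate])
    ((fun z => `|state_coord z j|) @^-1` [set x | x <= M])).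
  apply: closed_bigI => j _; apply: closed_comp; last exact: closed_le.
  move=> z _; apply: (@continuous_comp _ _ _ (fun z => state_coord z j) (fun x => `|x|)).
    exact: continuous_coord_state.
  exact: norm_continuous.
by apply/seteqP; split=> z /= h j; [move=> _|]; exact: h.
Qed.

End topology.

(** * Goodness of the rate functional *)

Lemma lt_EFin_between {R : realType} (c : R) (v : \bar R) : (c%:E < v)%E ->
  exists2 c', c < c' & (c'%:E < v)%E.
Proof.
case: v => [v||]; rewrite ?lte_fin // => cv.
  by exists ((c + v) / 2); rewrite ?lte_fin; lra.
by exists (c + 1); rewrite ?ltry // ltrDl.
Qed.

Section good.
Context {R : realType} {X : finType} {d : nat}.
Variables (P : X -> X -> R) (q : X -> X -> probability (borel_rV R d) R).
Hypothesis P_ge0 : forall x y, 0 <= P x y.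
Hypothesis fin : forall x y s, (\int[q x y]_a (expR (s * norm1 a))%:E < +oo)%E.
Notation coordinate := ((X * X) * option 'I_d)%type.
Implicit Types (z : state_space R X d).

(** The flow out of [x] minus the flow into [x], as a linear functional *)
Definition flux (x : X) : coordinate -> R :=
  linear_functional (fun _ _ => 0) (fun a b => (a == x)%:R - (b == x)%:R).

Lemma pairing_flux x z : pairing (flux x) (state_coord z) =
  marg1 (set_val z.2) x - marg2 (set_val z.2) x.
Proof.
rewrite pairing_functional.
transitivity (\sum_a \sum_b ((a == x)%:R * (set_val z.2 : X * X -> R) (a, b) -
    (b == x)%:R * (set_val z.2 : X * X -> R) (a, b))).
  apply: eq_bigr => a _; apply: eq_bigr => b _; rewrite -mulrBl.
  by rewrite big1 ?add0r // => i _; rewrite mxE mul0r.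
under eq_bigr => a _ do rewrite sumrB.
rewrite sumrB; congr (_ - _).
  rewrite (bigD1 x) //= [X in _ + X]big1 ?addr0 => [|a /negPf ax]; last first.
    by rewrite big1 // => b _; rewrite ax mul0r.
  by apply: eq_bigr => b _; rewrite eqxx mul1r.
apply: eq_bigr => a _.
rewrite (bigD1 x) //= big1 ?addr0 => [|b /negPf bx]; last by rewrite bx mul0r.
by rewrite eqxx mul1r.
Qed.

Lemma balanced_flux z : balanced z <-> forall x, pairing (flux x) (state_coord z) = 0.
Proof.
split=> [bal x|h x]; first by rewrite pairing_flux bal subrr.
by apply/eqP; rewrite -subr_eq0 -pairing_flux; apply/eqP.
Qed.

(** Where the flow is unbalanced the functional is infinite in a neighborhood;
    elsewhere it is approached from below by continuous functionals. *)
Lemma rate_lower_semicontinuous : lower_semicontinuous (rate P q).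
Proof.
move=> z c cz; have [bal|unbal] := pselect (balanced z).
  have [c' cc' c'z] := lt_EFin_between cz.
  have [lam [g c'L]] := dual_ge P_ge0 fin bal c'z.
  exists [set z' | c < pairing (dual_vector P q lam g) (state_coord z')].
    apply: (cvgr_gt _ (@continuous_pairing_coord _ _ _ _ z)).
    exact: lt_le_trans cc' c'L.
  move=> z' /= cL; apply: lt_le_trans (dual_le_rate P_ge0 fin lam g z').
  by rewrite lte_fin.
have [x nx] : exists x, pairing (flux x) (state_coord z) != 0.
  apply: contrapT => h; apply: unbal; apply/balanced_flux => x.
  by apply/eqP; apply: contrapT => nx; apply: h; exists x; apply/negP.
exists [set z' | pairing (flux x) (state_coord z') != 0].
  have := cvgr_neq0 _ (@continuous_pairing_coord R X d (flux x) z).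
  exact.
move=> z' /= nx'; rewrite rate_infty ?ltry // => -[_ /balanced_flux/(_ x) e].
by rewrite e eqxx in nx'.
Qed.

Lemma dot_delta (s : R) (i : 'I_d) (k : 'rV[R]_d) :
  dot (s *: delta_mx 0 i) k = s * k 0 i.
Proof.
rewrite /dot (bigD1 i) //= big1 ?addr0 => [|j /negPf ji]; last first.
  by rewrite !mxE ji andbF mulr0 mul0r.
by rewrite !mxE !eqxx mulr1.
Qed.

(** Test vectors [lam] carried by one pair and one axis bound the entries of [k] on a
    sublevel set. *)
Lemma coord_le_rate z p i (s : R) :
  ((s * (z.1 : X * X -> 'rV[R]_d) p 0 i - (set_val z.2 : X * X -> R) p
    * ln (mgf (q p.1 p.2) (s *: delta_mx 0 i)))%:E <= rate P q z)%E.
Proof.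
pose lam x y : 'rV[R]_d := if (x, y) == p then s *: delta_mx 0 i else 0.
have := dual_le_rate P_ge0 fin lam (fun _ _ => 0) z.
rewrite pairing_dual (bigD1 p) //= big1 => [|p' /negPf pp']; last first.
  rewrite /lam -surjective_pairing pp' expR0 mgf0 ln1 subrr !mulr0 !subr0 addr0.
  by rewrite /dot big1 // => j _; rewrite mxE mul0r.
rewrite /lam -surjective_pairing eqxx expR0 subrr !mulr0 subr0 !addr0.
by rewrite dot_delta.
Qed.

Lemma rate_good : good_rate_functional (rate P q).
Proof.
split; [exact: rate_ge0|exact: rate_lower_semicontinuous|move=> c].
pose B (p : X * X) i s := `|ln (mgf (q p.1 p.2) (s *: delta_mx 0 i))|.
pose M := 1 + `|c| + \sum_p \sum_i (B p i 1 + B p i (-1)).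
apply: (subclosed_compact _ (@compact_coord_box R X d M)).
  rewrite -openC openE => z /= /negP; rewrite -ltNge.
  move=> /rate_lower_semicontinuous[V zV Vc].
  by apply: filterS zV => z' /Vc h; apply/negP; rewrite -ltNge.
move=> z /= zc [p o].
have th1 := theta_le1 z p.
have B0 p' i s : 0 <= B p' i s by exact: normr_ge0.
have S0 : 0 <= \sum_p \sum_i (B p i 1 + B p i (-1)).
  by apply: sumr_ge0 => *; apply: sumr_ge0 => *; rewrite addr_ge0.
case: o => [i|]; rewrite /state_coord /=; last first.
  rewrite ger0_norm ?theta_ge0 // (le_trans th1) // /M -addrA lerDl.
  by rewrite addr_ge0.
have Bi : B p i 1 + B p i (-1) <= \sum_p \sum_i (B p i 1 + B p i (-1)).
  rewrite (bigD1 p) //= (bigD1 i) //= -addrA lerDl addr_ge0 //.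
    by apply: sumr_ge0 => *; rewrite addr_ge0.
  by apply: sumr_ge0 => *; apply: sumr_ge0 => *; rewrite addr_ge0.
have le s : s * (z.1 : X * X -> 'rV[R]_d) p 0 i <= `|c| + B p i s.
  have := le_trans (coord_le_rate z p i s) zc; rewrite lee_fin lerBlDr => h.
  apply: (le_trans h); apply: lerD; first exact: ler_norm.
  apply: (le_trans (ler_norm _)); rewrite normrM -[leRHS]mul1r.
  by apply: ler_pM => //; rewrite ger0_norm ?theta_ge0.
have := le 1; have := le (-1); have := B0 p i 1; have := B0 p i (-1).
rewrite ler_norml /M; move: (B p i 1) (B p i (-1)) Bi => b1 b2.
move: (\sum_p _) => S; move: (`|c|) => C ? ? ? ? ?; apply/andP; split; lra.
Qed.

End good.

(** * Loops that realize the rate functional *)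

Section loops.
Context {R : realType} {X : finType} {d : nat}.
Variables (P : X -> X -> R) (q : X -> X -> probability (borel_rV R d) R).
Hypothesis P_ge0 : forall x y, 0 <= P x y.
Hypothesis P_sum : forall x, \sum_y P x y = 1.
Hypothesis irr : irreducible P.
Hypothesis fin : forall x y s, (\int[q x y]_a (expR (s * norm1 a))%:E < +oo)%E.
Notation coordinate := ((X * X) * option 'I_d)%type.
Implicit Types (z : state_space R X d).

(** A separating functional that is bounded above on [H] has a nonnegative slope in
    the direction of the rates, because [H] is closed downwards.  If the slope is positive it can be normalized
    to one.  If it is zero, a large multiple of the functional will do, because
    the rates are nonpositive. *)
Lemma hypograph_support (H : set (option coordinate -> R)) (y : coordinate -> R)
    (v e : R) : midpoint_convex H ->
  (forall f f', H f -> f' \o Some = f \o Some -> f' None <= f None -> H f') ->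
  (forall f, H f -> f None <= 0) -> 0 < e ->
  (forall f, H f -> v - e <= f None -> exists j, e < `|f (Some j) - y j|) ->
  exists ell : coordinate -> R, forall f, H f ->
    pairing ell (f \o Some) + f None <= pairing ell y + v.
Proof.
move=> Hc Hdown Hle0 e0 far.
have [[f0 Hf0]|Hempty] := pselect (H !=set0); last first.
  by exists (fun=> 0) => f Hf; exfalso; apply: Hempty; exists f.
pose z o := if o is Some j then y j else v.
have far2 f : H f -> e ^+ 2 <= pairing (fun o => f o - z o) (fun o => f o - z o).
  move=> Hf; have sq o : (f o - z o) ^+ 2 <=
      pairing (fun o => f o - z o) (fun o => f o - z o).
    rewrite /pairing (bigD1 o) //= expr2 lerDl; apply: sumr_ge0 => o' _.
    by rewrite -expr2 sqr_ge0.
  have [vf|fv] := leP (v - e) (f None).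
    have [j ej] := far f Hf vf; apply: (le_trans _ (sq (Some j))).
    by rewrite -[leRHS]real_normK ?num_real // ler_sqr ?nnegrE ?normr_ge0 ?(ltW e0) // ltW.
  apply: (le_trans _ (sq None)); rewrite /= -[leRHS]real_normK ?num_real //.
  rewrite ler_sqr ?nnegrE ?normr_ge0 ?(ltW e0) // ltW // ltr_normr.
  by apply/orP; right; lra.
have [l [del [del0 sep]]] := separation Hc (ex_intro _ f0 Hf0)
  (exprn_gt0 2 e0) far2.
have sepE f : pairing l (fun o => f o - z o) =
    l None * (f None - v) + pairing (l \o Some) (fun j => f (Some j) - y j).
  by rewrite /pairing big_option.
have l0 : l None <= 0.
  rewrite leNgt; apply/negP => l_gt0.
  pose S := pairing (l \o Some) (fun j => f0 (Some j) - y j).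
  (* a point of [H] so low that a positive slope of [l], which is bounded below
     on [H], is impossible *)
  pose f o := if o is Some j then f0 (Some j)
    else Num.min (f0 None) (v - S / l None).
  have Hf : H f by apply: (Hdown f0) => //; rewrite /f ge_min lexx.
  have := sep _ Hf; rewrite sepE -/S.
  have : f None <= v - S / l None by rewrite /f ge_min lexx orbT.
  move: (f None) => t h.
  have := ler_wpM2l (ltW l_gt0) h.
  rewrite (_ : l None * (v - S / l None) = l None * v - S); first by lra.
  by field; rewrite gt_eqF.
have pairingZB (c : R) f : pairing (fun j => c * l (Some j)) (f \o Some) =
    pairing (fun j => c * l (Some j)) y
    + c * pairing (l \o Some) (fun j => f (Some j) - y j).
  by rewrite /pairing mulr_sumr -big_split /=; apply: eq_bigr => j _; ring.
have [l_eq0|l_neq0] := eqVneq (l None) 0.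
  exists (fun j => - (`|v| / del) * l (Some j)) => f Hf; rewrite pairingZB -addrA lerD2l.
  have := sep _ Hf; rewrite sepE l_eq0 mul0r add0r => h.
  have c0 : 0 <= `|v| / del by rewrite divr_ge0 // ltW.
  have := ler_wpM2l c0 h; rewrite divfK ?gt_eqF // mulNr.
  have := Hle0 _ Hf; have : - v <= `|v| by rewrite -normrN ler_norm.
  by lra.
have l_lt0 : 0 < - l None by rewrite oppr_gt0 lt_neqAle l_neq0.
exists (fun j => - (- l None)^-1 * l (Some j)) => f Hf.
rewrite pairingZB -addrA lerD2l.
have := sep _ Hf; rewrite sepE => h.
rewrite -(ler_pM2l l_lt0) mulrDr mulrA mulrN mulfV ?gt_eqF // mulN1r.
by move: h; move: (pairing _ _) => S; rewrite mulrBr; nra.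
Qed.

Lemma linear_functionalE (ell : coordinate -> R) :
  ell = linear_functional (fun x y => \row_i ell ((x, y), Some i))
          (fun x y => ell ((x, y), None)).
Proof.
apply/funext => -[[x y] [i|]] //; by rewrite /linear_functional /= mxE.
Qed.

Lemma pairing_step_vec (lam : X -> X -> 'rV[R]_d) (c : X -> X -> R) (x y : X)
    (a : 'rV[R]_d) :
  pairing (linear_functional lam c) (step_vec x y a) = dot (lam x y) a + c x y.
Proof.
rewrite pairing_functional (bigD1 x) //= [X in _ + X]big1 ?addr0 => [|x' nx]; last first.
  rewrite big1 // => y' _; rewrite /step_vec /= eq_sym (negPf nx) /= !mul0r.
  by rewrite mulr0 addr0 big1 // => i _; rewrite mul0r mulr0.
rewrite (bigD1 y) //= [X in _ + X]big1 ?addr0 => [|y' ny]; last first.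
  rewrite /step_vec /= [y == y']eq_sym (negPf ny) andbF /= !mul0r.
  by rewrite mulr0 addr0 big1 // => i _; rewrite mul0r mulr0.
rewrite /step_vec /= !eqxx mul1r mulr1; congr (_ + _).
by apply: eq_bigr => i _; rewrite mul1r.
Qed.

Variable x0 : X.
Hypothesis mass_le1 : forall m c U, attains P q x0 m c U -> c <= 1.

(** Otherwise a functional [ell] bounds the hypograph strictly below the point
    [(z, - I)].  It bounds the spectral radius of the matrix tilted by [ell] over
    a fine enough grid, and a subinvariant vector [r] turns this into a dual
    functional whose value at [z] exceeds the rate: on a balanced [z] the terms
    [ln (r y) - ln (r x)] cancel. *)
Lemma attains_rate z (I eta eps : R) : 0 < eta -> 0 < eps ->
  (rate P q z <= I%:E)%E ->
  exists2 m, (0 < m)%N &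
    attains P q x0 m (expR (- (m%:R * (I + eps)))) (cube m (state_coord z) eta).
Proof.
move=> eta0 eps0 zI; apply: contrapT => none.
have bal : balanced z.
  apply: contrapT => nb; move: zI; rewrite rate_infty; first by [].
  by move=> -[].
have eta20 : 0 < eta / 2 by rewrite divr_gt0.
(* Half of [eta] is the width of the cubes in the hypograph, the other half its
   distance to [z]; likewise for [eps]. *)
pose H := hypograph P q x0 (eta / 2).
pose e := Num.min (eta / 2) (eps / 2).
have e0 : 0 < e by rewrite lt_min eta20 divr_gt0.
have e_eta : e <= eta / 2 by rewrite ge_min lexx.
have e_eps : e <= eps / 2 by rewrite ge_min lexx orbT.
have [|||||ell ellP] := @hypograph_support H (state_coord z) (- (I + eps / 2)) e.
- exact: hypograph_convex.
- by move=> f f' Hf E le; exact: hypograph_down Hf E le.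
- move=> f [m m0 /mass_le1]; by rewrite expR_le1 pmulr_rle0 ?ltr0n.
- exact: e0.
- move=> f [m m0 att] hf; apply: contrapT => near; apply: none; exists m => //.
  have mR : 0 < m%:R :> R by rewrite ltr0n.
  apply: (@attains_le _ _ _ _ _ _ m (expR (m%:R * f None))).
    by rewrite ler_expR -mulrN ler_pM2l //; lra.
  apply: attains_sub att => u uU j.
  have fz : `|f (Some j) - state_coord z j| <= e.
    by rewrite leNgt; apply/negP => h; apply: near; exists j.
  have := uU j; rewrite /= => h1.
  have -> : u j - m%:R * state_coord z j = (u j - m%:R * f (Some j)) +
    m%:R * (f (Some j) - state_coord z j) by ring.
  apply: (le_trans (ler_normD _ _)).
  have -> : m%:R * eta = m%:R * (eta / 2) + m%:R * (eta / 2) by field.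
  apply: lerD => //; rewrite normrM ger0_norm // ler_pM2l //.
  exact: le_trans fz e_eta.
set Lam := pairing ell (state_coord z) + - (I + eps / 2) in ellP.
pose lam (x y : X) : 'rV[R]_d := \row_i ell ((x, y), Some i).
pose c x y := ell ((x, y), None).
have ellE : ell = linear_functional lam c by exact: linear_functionalE.
pose S1 := \sum_p norm1 (lam p.1 p.2).
have S1_ge x y : norm1 (lam x y) <= S1.
  rewrite /S1 (bigD1 (x, y)) //= lerDl; apply: sumr_ge0 => p _; exact: norm1_ge0.
have S10 : 0 <= S1 by apply: sumr_ge0 => p _; exact: norm1_ge0.
(* the mesh is small enough for the cells to respect the cubes and for the
   discretization to cost at most [eps / 8] in each exponent *)
pose h := Num.min (eta / 2) (eps / 8 / 2 / (1 + S1)).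
have h0 : 0 < h.
  rewrite lt_min eta20 divr_gt0 ?divr_gt0 //; lra.
have h_eta : h <= eta / 2 by rewrite ge_min lexx.
have eps80 : 0 < eps / 8 by rewrite divr_gt0.
have hlam x y : h * norm1 (lam x y) <= eps / 8 / 2.
  have h1 : h <= eps / 8 / 2 / (1 + S1) by rewrite ge_min lexx orbT.
  rewrite ler_pdivlMr in h1; last by lra.
  apply: le_trans h1; apply: ler_wpM2l; first exact: ltW.
  by have := S1_ge x y; lra.
have /choice[N0 N0P] p := grid_approximation h0 eps80 (fin p.1 p.2) (hlam p.1 p.2).
pose N := (\max_p N0 p)%N.
pose S x y := \sum_c0 fine (q x y (@grid_cell R d h N c0))
    * expR (dot (lam x y) (@corner R d h N c0)).
have SP x y : mgf (q x y) (lam x y) * expR (- (eps / 8)) <= S x y.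
  by apply: (N0P (x, y)); exact: leq_bigmax.
have mg x y : 0 < mgf (q x y) (lam x y) by exact: mgf_gt0.
have S_gt0 x y : 0 < S x y.
  by apply: lt_le_trans (SP x y); rewrite mulr_gt0 ?expR_gt0.
have charged x y : exists c0, 0 < fine (q x y (@grid_cell R d h N c0)).
  apply: contrapT => no; have := S_gt0 x y; rewrite ltNge => /negP; apply.
  apply: sumr_le0 => c0 _; rewrite mulr_le0_ge0 ?expR_ge0 //.
  by rewrite leNgt; apply/negP => pos; apply: no; exists c0.
have below f : hypograph P q x0 h f -> pairing ell (f \o Some) + f None <= Lam.
  move=> [m m0 att]; apply: ellP; exists m => //.
  by apply: attains_sub att => u uU j; apply: (le_trans (uU j)); rewrite ler_wpM2l.
have [r [r0 rP]] := tilted_subinvariant P_ge0 (ltW h0)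
  (@measurable_grid_cell R d h N) (@grid_cell_disjoint R d h N h0)
  (@grid_cell_bounded R d h N h0) (@grid_cell_corner R d h N)
  below irr charged eps80.
pose g x y := c x y + ln (S x y) + ln (r y) - ln (r x) - (Lam + eps / 8).
have tiltedE x y : tilted_matrix P q (@grid_cell R d h N) (@corner R d h N) ell x y
    = P x y * (expR (c x y) * S x y).
  rewrite /tilted_matrix /S !mulr_sumr; apply: eq_bigr => c0 _.
  by rewrite ellE pairing_step_vec expRD; ring.
have gP x : \sum_y P x y * expR (g x y) <= 1.
  have E y : P x y * expR (g x y) =
      (tilted_matrix P q (@grid_cell R d h N) (@corner R d h N) ell x y * r y)
      / (expR (Lam + eps / 8) * r x).
    rewrite tiltedE /g !expRB !expRD !lnK ?posrE //.
    by field; rewrite !gt_eqF ?expR_gt0 ?mulr_gt0.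
  under eq_bigr => y _ do rewrite E.
  rewrite -mulr_suml ler_pdivrMr ?mulr_gt0 ?expR_gt0 // mul1r; exact: rP.
have := le_trans (dual_le_rate P_ge0 fin lam g z) zI; rewrite lee_fin.
pose th := (set_val z.2 : X * X -> R).
have th0 p : 0 <= th p by exact: theta_ge0.
have lower : pairing (linear_functional lam (fun x y => c x y - eps / 8
     - (Lam + eps / 8) + (ln (r y) - ln (r x)))) (state_coord z)
     <= pairing (dual_vector P q lam g) (state_coord z).
  rewrite !pairing_functional; apply: ler_sum => x _; apply: ler_sum => y _.
  rewrite lerD2l; apply: ler_wpM2r; first exact: th0.
  have : \sum_y' P x y' * (expR (g x y') - 1) <= 0.
    under eq_bigr => y' _ do rewrite mulrBr mulr1.
    by rewrite sumrB P_sum subr_le0.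
  have : ln (mgf (q x y) (lam x y)) - eps / 8 <= ln (S x y).
    rewrite -[X in _ - X]opprK -[X in _ + - - X](expRK (- (eps / 8))).
    by rewrite opprK -lnM ?posrE ?expR_gt0 // ler_ln ?posrE ?mulr_gt0 ?expR_gt0.
  rewrite /g; lra.
move=> upper; have := le_trans lower upper.
have -> : pairing (linear_functional lam (fun x y => c x y - eps / 8
     - (Lam + eps / 8) + (ln (r y) - ln (r x)))) (state_coord z) =
   pairing ell (state_coord z) - eps / 8 - (Lam + eps / 8).
  rewrite [in RHS]ellE !pairing_functional.
  pose K := - eps / 8 - (Lam + eps / 8).
  transitivity (\sum_x \sum_y ((\sum_i lam x y 0 i * state_coord z (x, y, Some i)
      + c x y * state_coord z (x, y, None)) + K * th (x, y)
      + (ln (r y) * th (x, y) - ln (r x) * th (x, y)))).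
    apply: eq_bigr => x _; apply: eq_bigr => y _.
    by rewrite /K /state_coord /= -/th; ring.
  have cancel : \sum_x \sum_y (ln (r y) * th (x, y) - ln (r x) * th (x, y)) = 0.
    under eq_bigr => x _ do rewrite sumrB.
    rewrite sumrB exchange_big /= -sumrB big1 // => x _.
    by rewrite -!mulr_sumr -mulrBr -/(marg2 th x) -/(marg1 th x) bal subrr mulr0.
  under eq_bigr => x _ do rewrite 2!big_split /=.
  rewrite big_split /= cancel addr0 big_split /=.
  have -> : \sum_x \sum_y K * th (x, y) = K.
    under eq_bigr => x _ do rewrite -mulr_sumr.
    rewrite -mulr_sumr pair_big /= (eq_bigr th) => [|[x y]] //.
    by rewrite theta_sum mulr1.
  by rewrite /K; ring.
by rewrite /Lam; lra.
Qed.

End loops.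

(** * Probabilities of paths and marks *)

Section process.
Context {R : realType} {dsp : measure_display} {Omega : measurableType dsp}.
Variable Pr : probability Omega R.
Context {X : finType} {d : nat}.
Variables (P : X -> X -> R) (Xs : nat -> Omega -> X) (A : nat -> Omega -> 'rV[R]_d)
  (q : X -> X -> probability (borel_rV R d) R).
Hypothesis markov : homogeneous_markov_chain Pr P Xs.
Hypothesis measA : forall m, (0 < m)%N ->
  measurable_fun [set: Omega] (A m : Omega -> borel_rV R d).
Hypothesis indep : cond_product_law Pr Xs A q.

Definition mass (S : set Omega) : R := fine (Pr S).

Lemma massE S : measurable S -> Pr S = (mass S)%:E.
Proof. by move=> mS; rewrite /mass fineK // fin_num_measure. Qed.

Lemma mass_ge0 S : 0 <= mass S.
Proof. by rewrite /mass fine_ge0. Qed.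

Lemma le_mass S T : measurable S -> measurable T -> S `<=` T -> mass S <= mass T.
Proof.
move=> mS mT ST; rewrite -lee_fin -!massE //.
by apply: le_measure => //; rewrite inE.
Qed.

Lemma measurable_state m x : measurable [set w | Xs m w = x].
Proof. by case: markov. Qed.

Lemma path_event0 x : path_event Xs 0 x = [set w | Xs 0%N w = x 0%N].
Proof.
apply/seteqP; split=> w /= h; first exact: h.
by move=> m; rewrite leqn0 => /eqP ->.
Qed.

Lemma path_eventS n x :
  path_event Xs n.+1 x = [set w | Xs n.+1 w = x n.+1] `&` path_event Xs n x.
Proof.
apply/seteqP; split=> w /=.
  by move=> h; split=> [|m mn]; apply: h => //; exact: leqW.
by move=> [h2 h1] m; rewrite leq_eqVlt => /orP[/eqP ->|/h1].
Qed.

Lemma measurable_path_event n x : measurable (path_event Xs n x).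
Proof.
elim: n => [|n IH]; first by rewrite path_event0; exact: measurable_state.
by rewrite path_eventS; apply: measurableI => //; exact: measurable_state.
Qed.

Lemma mass_path n x : mass (path_event Xs n x) =
  mass [set w | Xs 0%N w = x 0%N] * \prod_(0 <= m < n) P (x m) (x m.+1).
Proof.
elim: n => [|n IH].
  by rewrite big_geq // mulr1 path_event0.
rewrite big_nat_recr //= mulrA -IH path_eventS.
have mp := measurable_path_event n x.
have [pos|zero] := ltP 0 (mass (path_event Xs n x)).
  have [_ _ /(_ n x)] := markov; rewrite massE // lte_fin => /(_ pos) <-.
  by rewrite /cond_prob mulrCA mulfV ?mulr1 // gt_eqF.
have z : mass (path_event Xs n x) = 0 by apply/eqP; rewrite eq_le zero mass_ge0.
rewrite z mul0r; apply/eqP; rewrite eq_le mass_ge0 andbT -z.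
apply: le_mass => //.
by apply: measurableI => //; exact: measurable_state.
Qed.

Definition marks_in n (B : nat -> set (borel_rV R d)) : set Omega :=
  [set w | forall m, (1 <= m <= n)%N -> B m (A m w)].

Lemma measurable_marks_in n B : (forall m, measurable (B m)) ->
  measurable (marks_in n B).
Proof.
move=> mB; elim: n => [|n IH].
  rewrite (_ : marks_in _ _ = setT) //.
  by apply/seteqP; split=> // w _ m /andP[m1]; rewrite leqn0 => /eqP m0; rewrite m0 in m1.
rewrite (_ : marks_in _ _ = marks_in n B `&` A n.+1 @^-1` B n.+1).
  apply: measurableI => //; rewrite -[X in measurable X]setTI.
  exact: measA.
apply/seteqP; split=> w /=.
  move=> h; split=> [m /andP[m1 mn]|]; apply: h; last by rewrite /= leqnn.
  by rewrite m1 leqW.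
move=> [h1 h2] m /andP[m1]; rewrite leq_eqVlt => /orP[/eqP -> //|mn].
by apply: h1; rewrite m1.
Qed.

(** The hypothesis is a statement about conditional probabilities; on a path of mass
    zero both sides vanish. *)
Lemma mass_marked_path n x B : (forall m, measurable (B m)) ->
  mass (marks_in n B `&` path_event Xs n x) =
  mass (path_event Xs n x) * \prod_(0 <= m < n) fine (q (x m) (x m.+1) (B m.+1)).
Proof.
move=> mB; have mp := measurable_path_event n x.
have mm := measurable_marks_in n mB.
have [pos|zero] := ltP 0 (mass (path_event Xs n x)); last first.
  have z : mass (path_event Xs n x) = 0 by apply/eqP; rewrite eq_le zero mass_ge0.
  rewrite z mul0r; apply/eqP; rewrite eq_le mass_ge0 andbT -z.
  by apply: le_mass => //; exact: measurableI.
case: n mp mm pos => [|n] mp mm pos.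
  rewrite big_geq // mulr1; congr mass; apply/seteqP; split=> [w []|w h] //.
  by split=> // m /andP[m1]; rewrite leqn0 => /eqP m0; rewrite m0 in m1.
have := @indep n.+1 x B isT mB; rewrite massE // lte_fin => /(_ pos).
rewrite big_add1 /=.
rewrite (eq_bigr (fun m => (fine (q (x m) (x m.+1) (B m.+1)))%:E)) => [|m _]; last first.
  by rewrite fineK // fin_num_measure.
rewrite prodEFin => -[] <-.
by rewrite /cond_prob mulrCA mulfV ?mulr1 // gt_eqF.
Qed.

(** * Observed trajectories and words *)

Fixpoint observed (n : nat) (w : Omega) : @traj R X d :=
  if n is n'.+1 then rcons (observed n' w) (Xs n w, A n w) else [::].

Lemma size_observed n w : size (observed n w) = n.
Proof. by elim: n => //= n IH; rewrite size_rcons IH. Qed.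

Lemma nth_observed n w m : (m < n)%N ->
  nth (Xs 0%N w, 0) (observed n w) m = (Xs m.+1 w, A m.+1 w).
Proof.
elim: n => //= n IH; rewrite ltnS leq_eqVlt nth_rcons size_observed.
by move=> /orP[/eqP ->|mn]; [rewrite ltnn eqxx|rewrite mn IH].
Qed.

Lemma endpoint_observed n w : endpoint (Xs 0%N w) (observed n w) = Xs n w.
Proof.
by case: n => [|n] //=; rewrite /endpoint map_rcons last_rcons.
Qed.

Lemma fitsP (w : @word R X d) (s : @traj R X d) x0 : size s = size w ->
  reflect (forall m, (m < size w)%N ->
     (nth (x0, setT) w m).1 = (nth (x0, 0) s m).1 /\
     (nth (x0, setT) w m).2 (nth (x0, 0) s m).2) (fits w s).
Proof.
elim: w s => [|L w IH] [|l s] //=; first by move=> _; apply: ReflectT.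
move=> [] /IH {}IH; apply: (iffP and3P) => [[/eqP h1 /asboolP h2 /IH h3] [|m]|h].
- by [].
- by rewrite ltnS; exact: h3.
- have [h1 h2] := h 0%N isT; split; [exact/eqP|exact/asboolP|].
  by apply/IH => m mw; exact: (h m.+1).
Qed.

Variable x0 : X.

Let states (w : @word R X d) (m : nat) : X :=
  if m is m'.+1 then (nth (x0, setT) w m').1 else x0.

Let boxes (w : @word R X d) (m : nat) : set (borel_rV R d) :=
  if m is m'.+1 then (nth (x0, setT) w m').2 else setT.

Let weightE_from (x : X) (w : @word R X d) : weight P q x w =
  \prod_(0 <= m < size w)
    (P (nth (x0, setT) ((x, setT) :: w) m).1 (nth (x0, setT) w m).1 *
     fine (q (nth (x0, setT) ((x, setT) :: w) m).1 (nth (x0, setT) w m).1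
        (nth (x0, setT) w m).2)).
Proof.
elim: w x => [|L w IH] x /=; first by rewrite big_geq.
by rewrite big_nat_recl //= IH; congr (_ * _); apply: eq_bigr => -[|m] _.
Qed.

Let weightE w : weight P q x0 w = \prod_(0 <= m < size w)
    (P (states w m) (states w m.+1) *
     fine (q (states w m) (states w m.+1) (boxes w m.+1))).
Proof.
by rewrite weightE_from; apply: eq_bigr => -[|m] _.
Qed.

Let bounded_measurable M w m : bounded_word M w -> measurable (boxes w m).
Proof.
case: m => [|m] //= ; elim: w m => [|L w IH] [|m] //= [mL _ bw] //.
exact: IH.
Qed.

Definition word_event (w : word) : set Omega :=
  [set om | Xs 0%N om = x0 /\ fits w (observed (size w) om)].

Lemma word_eventE w :
  word_event w = marks_in (size w) (boxes w) `&` path_event Xs (size w) (states w).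
Proof.
apply/seteqP; split=> om /=.
  move=> [e /(fitsP x0)]; rewrite size_observed => /(_ erefl) h.
  have no m : (m < size w)%N -> nth (x0, 0) (observed (size w) om) m
      = (Xs m.+1 om, A m.+1 om) by move=> mw; rewrite -e nth_observed.
  split=> [[|m] //= mw|[_|m mw]].
  - by have := h m mw; rewrite no // => -[].
  - exact: e.
  - by have := h m mw; rewrite no // => -[].
move=> [hB hX]; have e : Xs 0%N om = x0 by exact: (hX 0%N).
split=> //; apply/(fitsP x0); rewrite ?size_observed // => m mw.
have -> : nth (x0, 0) (observed (size w) om) m = (Xs m.+1 om, A m.+1 om).
  by rewrite -e nth_observed.
split; first by rewrite /= (hX m.+1).
exact: (hB m.+1).
Qed.

Lemma measurable_word_event M w : bounded_word M w -> measurable (word_event w).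
Proof.
move=> bw; rewrite word_eventE; apply: measurableI.
  by apply: measurable_marks_in => m; exact: bounded_measurable bw.
exact: measurable_path_event.
Qed.

Lemma mass_word M w : bounded_word M w ->
  mass (word_event w) = mass [set om | Xs 0%N om = x0] * weight P q x0 w.
Proof.
move=> bw; rewrite word_eventE mass_marked_path; last first.
  by move=> m; exact: bounded_measurable bw.
by rewrite mass_path -mulrA -big_split weightE.
Qed.

Lemma mass_disjoint (I : finType) (sel : pred I) (F : I -> set Omega) :
  (forall i, sel i -> measurable (F i)) ->
  (forall i j w, sel i -> sel j -> F i w -> F j w -> i = j) ->
  mass (\bigcup_(i in [set` sel]) F i) = \sum_(i | sel i) mass (F i).
Proof.
move=> mF dis; rewrite /mass measure_fin_bigcup //=; last first.
  by move=> i j /= si sj [w [Fi Fj]]; exact: dis Fi Fj.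
rewrite -(bigfs _ (r := index_enum I)) ?index_enum_uniq //; last first.
  by move=> i _; rewrite mem_index_enum.
rewrite (eq_bigr (fun i => (mass (F i))%:E)) => [|i si]; last by rewrite massE //; exact: mF.
by rewrite sumEFin.
Qed.

(** A trajectory fits at most one of the words, so the events are disjoint. *)
Lemma word_mass_le (I : finType) (sel : pred I) (W : I -> word) (M : R) n S :
  measurable S ->
  (forall i, sel i -> size (W i) = n /\ bounded_word M (W i)) ->
  (forall s, (\sum_(i | sel i) fits (W i) s <= 1)%N) ->
  (forall i w, sel i -> Xs 0%N w = x0 -> fits (W i) (observed n w) -> S w) ->
  mass [set om | Xs 0%N om = x0] * \sum_(i | sel i) weight P q x0 (W i) <= mass S.
Proof.
move=> mS len dis sub; rewrite mulr_sumr.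
have mev i : sel i -> measurable (word_event (W i)).
  by case/len => _; exact: measurable_word_event.
rewrite (eq_bigr (fun i => mass (word_event (W i)))) => [|i /len[_ bw]]; last first.
  by rewrite (mass_word bw).
rewrite -mass_disjoint //.
  apply: le_mass => //.
    by apply: fin_bigcup_measurable => // i; exact: mev.
  move=> w [i si [e]]; have [-> _] := len _ si; exact: sub.
move=> i j w si sj [_ fi] [_ fj]; have [li _] := len _ si; have [lj _] := len _ sj.
rewrite li in fi; rewrite lj in fj.
apply/eqP; apply: contraT => ij; have := dis (observed n w).
rewrite (bigD1 i) //= fi (bigD1 j) /=; last by rewrite sj eq_sym.
by rewrite fj.
Qed.

Lemma attains_mass_le1 m c U : 0 < mass [set om | Xs 0%N om = x0] ->
  attains P q x0 m c U -> c <= 1.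
Proof.
move=> pos [I [sel [W [M [len dis _ h]]]]]; apply: (le_trans h).
rewrite -(ler_pM2l pos) mulr1.
apply: (@word_mass_le _ _ _ M m) => //; first exact: measurable_state.
by move=> i /len[].
Qed.

Lemma stochastic_le1 x y : P x y <= 1.
Proof.
have [[P0 P1] _ _] := markov; rewrite -(P1 x) (bigD1 y) //= lerDl.
by apply: sumr_ge0.
Qed.

Lemma weight_le1 M x (w : word) : bounded_word M w -> weight P q x w <= 1.
Proof.
have [[P0 P1] _ _] := markov.
elim: w x => //= L w IH x [mL _ bw].
rewrite -[leRHS]mulr1 -[X in _ <= X * _]mulr1.
apply: ler_pM; rewrite ?weight_ge0 ?mulr_ge0 ?fine_ge0 ?IH //.
apply: ler_pM; rewrite ?fine_ge0 ?stochastic_le1 //.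
by rewrite -lee_fin fineK ?fin_num_measure // probability_le1.
Qed.

(** * Measurability of the empirical pair *)

Definition increments n w j : R := total_vec (Xs 0%N w) (observed n w) j.

Lemma incrementsE n w j : increments n w j =
  \sum_(1 <= m < n.+1) step_vec (Xs m.-1 w) (Xs m w) (A m w) j.
Proof.
elim: n => [|n IH]; first by rewrite big_geq.
rewrite big_nat_recr //= -IH /increments /= -cats1 total_vec_cat endpoint_observed.
by rewrite /= addr0.
Qed.

Lemma state_coord_emp n w j :
  state_coord (emp_pair Xs A n w) j = n.+1%:R^-1 * increments n.+1 w j.
Proof.
rewrite incrementsE; case: j => -[x y] [i|]; rewrite /state_coord /=.
  rewrite mxE; congr (_ * _); rewrite summxE; apply: eq_bigr => m _.
  by rewrite mxE.
by rewrite set_valE /= /emp_Theta; congr (_ * _); apply: eq_bigr => m _; rewrite /step_vec /= mulr1.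
Qed.

Lemma measurable_state_coord n j :
  measurable_fun setT (fun w => state_coord (emp_pair Xs A n w) j).
Proof.
rewrite (_ : (fun w => _) = fun w => n.+1%:R^-1 *
  \sum_(1 <= m < n.+2) step_vec (Xs m.-1 w) (Xs m w) (A m w) j); last first.
  by apply/funext => w; rewrite state_coord_emp incrementsE.
apply: measurable_funM => //.
rewrite [X in measurable_fun _ X](_ : _ = fun w =>
  \sum_(m <- index_iota 1 n.+2) (\1_([set w | Xs m.-1 w = j.1.1] `&`
     [set w | Xs m w = j.1.2]) w *
   (if j.2 is Some i then A (m.-1).+1 w 0 i else 1))); last first.
  apply/funext => w; rewrite big_nat [RHS]big_nat; apply: eq_bigr => m /andP[m1 _].
  rewrite /step_vec prednK //; congr (_ * _).
  rewrite indicE; congr (_%:R); apply: congr1.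
  by apply/andP/idP => [[/eqP h1 /eqP h2]|/set_mem[/= -> ->]//]; apply/mem_set.
apply: measurable_sum => m; apply: measurable_funM.
  by apply: measurable_indic; apply: measurableI; exact: measurable_state.
case: j.2 => [i|] //.
by apply: (measurableT_comp (measurable_coord i)); exact: measA.
Qed.

(** An open set is a countable union of coordinate boxes with rational centers and
    radii [1 / (k + 1)]. *)
Lemma measurable_emp_pair n (O : set (state_space R X d)) :
  open O -> measurable (emp_pair Xs A n @^-1` O).
Proof.
move=> oO.
pose B (b : {ffun (X * X) * option 'I_d -> rat} * nat) : set (state_space R X d) :=
  [set z | forall j, `|state_coord z j - ratr (b.1 j)| < b.2.+1%:R^-1].
have -> : emp_pair Xs A n @^-1` O =
    \bigcup_(b in [set b | B b `<=` O]) (emp_pair Xs A n @^-1` B b).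
  apply/seteqP; split=> [w Ow|w [b bO Bw]]; last exact: bO.
  have [e e0 eO] := nbhs_coord (open_nbhs_nbhs (conj oO Ow)).
  have [k ke] : exists k : nat, k.+1%:R^-1 < e / 2.
    exists (Num.bound (e / 2)^-1); rewrite invf_plt ?posrE ?divr_gt0 //.
    apply: (lt_trans (archi_boundP _)); first by rewrite invr_ge0 ltW ?divr_gt0.
    by rewrite ltr_nat.
  have /choice[f fP] j : exists q : rat,
      `|state_coord (emp_pair Xs A n w) j - ratr q| < k.+1%:R^-1.
    have k0 : 0 < k.+1%:R^-1 :> R by rewrite invr_gt0.
    move: (k.+1%:R^-1 : R) (state_coord _ j) k0 => t s t0.
    have [r] := @rat_in_itvoo R (s - t) (s + t) ltac:(lra).
    rewrite in_itv /= => /andP[h1 h2]; exists r.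
    by rewrite ltr_norml; apply/andP; split; lra.
  exists ([ffun j => f j], k); last by move=> j; rewrite /= ffunE.
  move=> z Bz; apply: eO => j; have := Bz j; rewrite /= ffunE => h1.
  have := fP j => h2.
  rewrite (_ : state_coord z j - _ = (state_coord z j - ratr (f j)) -
    (state_coord (emp_pair Xs A n w) j - ratr (f j))); last by ring.
  by apply: (le_lt_trans (ler_normB _ _)); move: (k.+1%:R^-1) h1 h2 ke => t h1 h2 ke; lra.
have mB b : measurable (emp_pair Xs A n @^-1` B b).
  rewrite (_ : _ @^-1` _ = \bigcap_(j in setT)
    [set w | `|state_coord (emp_pair Xs A n w) j - ratr (b.1 j)| < b.2.+1%:R^-1]).
    apply: fin_bigcap_measurable => // j _.
    have mj : measurable_fun setT
        (fun w => `|state_coord (emp_pair Xs A n w) j - ratr (b.1 j)|).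
      apply: measurableT_comp => //; apply: measurable_funB => //.
      exact: measurable_state_coord.
    have := mj measurableT _ (measurable_itv `]-oo, (b.2.+1%:R^-1 : R)[).
    by rewrite setTI; congr measurable; apply/seteqP; split=> w /=; rewrite in_itv.
  by apply/seteqP; split=> w /= h j; [move=> _|]; exact: h.
rewrite bigcup_mkcond; apply: countable_bigcupT_measurable; first exact: countableP.
by move=> b; case: ifP.
Qed.

End process.

(** * The lower bound *)

Lemma limn_einf_ge {R : realType} (u : (\bar R)^nat) (c : \bar R) N :
  (forall n, (N <= n)%N -> (c <= u n)%E) -> (c <= limn_einf u)%E.
Proof.
move=> h; rewrite /limn_einf /limn_esup -/(limf_einf u \oo) limf_einfE.
apply: (@le_trans _ _ (ereal_inf (u @` [set n | (N <= n)%N]))).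
  by apply: le_ereal_inf_tmp => _ [n Nn <-]; exact: h.
by apply: ereal_sup_ubound; exists [set n | (N <= n)%N] => //; exists N.
Qed.

Lemma limn_esup_le {R : realType} (u : (\bar R)^nat) (c : \bar R) N :
  (forall n, (N <= n)%N -> (u n <= c)%E) -> (limn_esup u <= c)%E.
Proof.
move=> h; apply: (@le_trans _ _ (ereal_sup (u @` [set n | (N <= n)%N]))).
  by apply: ereal_inf_lbound; exists [set n | (N <= n)%N] => //; exists N.
by apply: ge_ereal_sup => _ [n Nn <-]; exact: h.
Qed.

Section lower.
Context {R : realType} {dsp : measure_display} {Omega : measurableType dsp}.
Variable Pr : probability Omega R.
Context {X : finType} {d : nat}.
Variables (P : X -> X -> R) (Xs : nat -> Omega -> X) (A : nat -> Omega -> 'rV[R]_d)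
  (q : X -> X -> probability (borel_rV R d) R).
Hypothesis markov : homogeneous_markov_chain Pr P Xs.
Hypothesis irr : irreducible P.
Hypothesis measA : forall m, (0 < m)%N ->
  measurable_fun [set: Omega] (A m : Omega -> borel_rV R d).
Hypothesis indep : cond_product_law Pr Xs A q.
Hypothesis fin : forall x y s, (\int[q x y]_a (expR (s * norm1 a))%:E < +oo)%E.
Implicit Types (z : state_space R X d).

Lemma total_vec_bound M (w : word) (s : @traj R X d) x j :
  bounded_word M w -> fits w s ->
  `|total_vec x s j| <= (size w)%:R * (1 + `|M|).
Proof.
elim: w s x => [|L w IH] [|l s] x //=; first by rewrite normr0 mul0r.
move=> [_ bL bw] /and3P[_ /asboolP Ll f].
apply: (le_trans (ler_normD _ _)); rewrite -natr1 mulrDl mul1r addrC.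
apply: lerD; first exact: IH.
rewrite /step_vec normrM -[leRHS]mul1r; apply: ler_pM => //.
  by case: (_ && _); rewrite ?normr1 ?normr0.
case: j.2 => [i|]; last by rewrite normr1 lerDl.
apply: (le_trans (bL _ Ll i)); apply: (le_trans (ler_norm _)).
by rewrite lerDr.
Qed.

Lemma exists_initial_state : exists x, 0 < mass Pr [set w | Xs 0%N w = x].
Proof.
apply: contrapT => no.
have : mass Pr setT = \sum_(x : X | predT x) mass Pr [set w | Xs 0%N w = x].
  rewrite -mass_disjoint //.
  - congr (mass Pr _); apply/seteqP; split=> // w _.
    by exists (Xs 0%N w).
  - by move=> x _; exact: (measurable_state markov).
  - by move=> x y w _ _ /= -> ->.
rewrite /mass probability_setT /= big1 => [/eqP|x _]; first by rewrite oner_eq0.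
apply/eqP; rewrite eq_le mass_ge0 andbT leNgt; apply/negP => pos.
by apply: no; exists x.
Qed.

(** A time [n = k m + r] is filled with [k] loops of length [m] and a piece of
    bounded length of one of these loops. *)
Lemma open_lower_bound z (O : set (state_space R X d)) (I eps : R) :
  open O -> O z -> (rate P q z <= I%:E)%E -> 0 < eps ->
  exists N, forall n, (N <= n)%N ->
    ((- (I + eps))%:E <=
      (n.+1%:R^-1)%:E * lne (Pr (emp_pair Xs A n @^-1` O)))%E.
Proof.
move=> oO Oz zI eps0; have [[P0 P1] _ _] := markov.
have [x0 x0_pos] := exists_initial_state.
have [e e0 eO] := nbhs_coord (open_nbhs_nbhs (conj oO Oz)).
have I0 : 0 <= I by rewrite -lee_fin; apply: le_trans zI; exact: rate_ge0.
have e20 : 0 < e / 2 by rewrite divr_gt0.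
have eps20 : 0 < eps / 2 by rewrite divr_gt0.
have [m m0 att] := attains_rate P0 P1 irr fin
  (fun m c U => @attains_mass_le1 _ _ _ Pr _ _ P Xs A q markov measA indep x0 m c U x0_pos)
  e20 eps20 zI.
set c := expR _ in att.
have c0 : 0 < c by exact: expR_gt0.
have [w0 [M [size0 bw0 pos0]]] : exists w0 M,
    [/\ size w0 = m, bounded_word M w0 & 0 < weight P q x0 w0].
  have [J [sel [W [M [len _ _ massW]]]]] := att.
  apply: contrapT => no; move: massW; apply/negP; rewrite -ltNge.
  apply: le_lt_trans c0; apply: sumr_le0 => i /len[li bi _].
  by rewrite leNgt; apply/negP => pos; apply: no; exists (W i), M.
pose a := mass Pr [set w | Xs 0%N w = x0] * weight P q x0 w0.
have a0 : 0 < a by rewrite mulr_gt0.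
pose Z := \sum_j `|state_coord z j|.
have Zj j : `|state_coord z j| <= Z.
  by rewrite /Z (bigD1 j) //= lerDl; exact: sumr_ge0.
(* [D] bounds the contribution of the incomplete loop to the sum of increments;
   [B] makes it, and the constant [a], negligible. *)
pose D := m%:R * (1 + `|M| + Z).
have D0 : 0 <= D by rewrite mulr_ge0 // !addr_ge0 //; exact: sumr_ge0.
pose B := D / (e / 4) + `|ln a| / (eps / 2).
exists (Num.bound B) => n Nn; set N := n.+1.
have NB : B < N%:R.
  apply: (lt_le_trans (archi_boundP _)).
    by rewrite addr_ge0 // divr_ge0 // ltW ?divr_gt0.
  by rewrite ler_nat (leq_trans Nn).
have NR : 0 < N%:R :> R by rewrite ltr0n.
have DN : D <= N%:R * (e / 4).
  rewrite -ler_pdivrMr ?divr_gt0 //; apply: le_trans (ltW NB).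
  by rewrite lerDl divr_ge0 // ltW.
have aN : - ln a <= N%:R * (eps / 2).
  rewrite -ler_pdivrMr //; apply: le_trans (ltW NB).
  apply: (@le_trans _ _ (`|ln a| / (eps / 2))).
    by rewrite ler_wpM2r ?invr_ge0 ?(ltW eps20) // -normrN ler_norm.
  by rewrite lerDr divr_ge0 // ltW ?divr_gt0.
pose k := (N %/ m)%N; pose r := (N %% m)%N.
have NE : N = (k * m + r)%N by exact: divn_eq.
have rm : (r < m)%N by exact: ltn_pmod.
have [J [sel [W [Mk [len dis inn massW]]]]] := attains_cube_iter k (ltW c0) att.
pose v := take r w0.
have size_v : size v = r by rewrite size_takel // size0 ltnW.
have bv : bounded_word M v.
  by move: bw0; rewrite -(cat_take_drop r w0) => /bounded_word_cat[].
have weight_v : weight P q x0 w0 <= weight P q x0 v.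
  rewrite -{1}(cat_take_drop r w0) weight_cat -[leRHS]mulr1.
  apply: ler_wpM2l; first exact: weight_ge0.
  have bd : bounded_word M (drop r w0).
    by move: bw0; rewrite -{1}(cat_take_drop r w0) => /bounded_word_cat[].
  exact: (weight_le1 q markov _ bd).
have mY : measurable (emp_pair Xs A n @^-1` O) by exact: (measurable_emp_pair markov).
have sizeW i : sel i -> size (W i) = (k * m)%N by case/len.
have main : a * c ^+ k <= mass Pr (emp_pair Xs A n @^-1` O).
  apply: le_trans (word_mass_le markov measA indep (x0 := x0) (n := N) (sel := sel)
    (W := fun i => W i ++ v) (M := Num.max Mk M) mY _ _ _).
  - rewrite (eq_bigr (fun i => weight P q x0 (W i) * weight P q x0 v)) => [|i si].
      rewrite -mulr_suml /a -!mulrA ler_wpM2l ?mass_ge0 // mulrC.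
      by apply: ler_pM => //; [rewrite exprn_ge0 // ltW|exact: ltW].
    by rewrite weight_cat; have [_ _ ->] := len _ si.
  - move=> i si; have [li bi _] := len _ si; split.
      by rewrite size_cat li size_v.
    apply/bounded_word_cat; split.
      by apply: bounded_word_le bi; rewrite le_max lexx.
    by apply: bounded_word_le bv; rewrite le_max lexx orbT.
  - move=> s; apply: leq_trans (dis (take (k * m) s)).
    apply: leq_sum => i si; rewrite fits_cat (sizeW _ si).
    by case: (fits (W i) _) => //=; rewrite leq_b1.
  - move=> i w si Xw; rewrite fits_cat (sizeW _ si) => /andP[f1 f2].
    apply: eO => j; rewrite state_coord_emp /increments Xw.
    set s := observed _ _ _ _ in f1 f2 *.
    rewrite -(cat_take_drop (k * m) s) total_vec_cat.
    have h1 := inn _ _ si f1 j.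
    have h2 := total_vec_bound (endpoint x0 (take (k * m) s)) j bv f2.
    set t1 := total_vec x0 _ j in h1 *; set t2 := total_vec _ _ j in h2 *.
    rewrite -(ltr_pM2l NR) -[X in X * `|_|](ger0_norm (ltW NR)) -normrM.
    rewrite mulrBr mulrA mulfV ?gt_eqF // mul1r.
    have -> : t1 + t2 - N%:R * state_coord z j =
       (t1 - (k * m)%:R * state_coord z j) + (t2 - r%:R * state_coord z j).
      by rewrite {1}NE natrD; ring.
    apply: (le_lt_trans (ler_normD _ _)).
    have h3 : `|t2 - r%:R * state_coord z j| <= D.
      apply: (le_trans (ler_normB _ _)); rewrite normrM normr_nat.
      rewrite size_v in h2.
      apply: (@le_trans _ _ (r%:R * (1 + `|M| + Z))).
        by rewrite mulrDr; apply: lerD => //; rewrite ler_wpM2l.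
      by rewrite /D ler_wpM2r ?ler_nat ?(ltnW rm) // !addr_ge0 //; exact: sumr_ge0.
    have h4 : (k * m)%:R * (e / 2) <= N%:R * (e / 2).
      by rewrite ler_wpM2r ?(ltW e20) // ler_nat NE leq_addr.
    have h5 : 0 < N%:R * e by rewrite mulr_gt0.
    move: h1 h3 DN h4 h5; move: (`|t1 - _|) (`|t2 - _|) => u1 u2 h1 h3 h6 h4 h5.
    by move: (N%:R) h4 h5 h6 => Nr h4 h5 h6; lra.
have ck : expR (- (N%:R * (I + eps / 2))) <= c ^+ k.
  rewrite /c -expRM_natl ler_expR mulrN lerN2 mulrA -natrM.
  by rewrite ler_wpM2r ?addr_ge0 ?(ltW eps20) // ler_nat NE leq_addr.
have ck0 : 0 < c ^+ k by rewrite exprn_gt0.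
have mpos : 0 < mass Pr (emp_pair Xs A n @^-1` O).
  by apply: lt_le_trans main; rewrite mulr_gt0.
rewrite massE // lne_EFin // -EFinM lee_fin -(ler_pM2l NR) mulrA mulfV ?gt_eqF // mul1r.
apply: (@le_trans _ _ (ln (a * c ^+ k))).
  rewrite lnM ?posrE //.
  have : - (N%:R * (I + eps / 2)) <= ln (c ^+ k).
    by rewrite -[leLHS]expRK ler_ln ?posrE ?expR_gt0.
  move: aN; move: (ln a) (ln _) (N%:R : R) => u1 u2 u3; lra.
by rewrite ler_ln ?posrE // mulr_gt0.
Qed.

Lemma ldp_lower (O : set (state_space R X d)) : open O ->
  (- ereal_inf (rate P q @` O) <=
   limn_einf (fun n => (n.+1%:R^-1)%:E * lne (Pr (emp_pair Xs A n @^-1` O))))%E.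
Proof.
move=> oO; rewrite leeNl; apply: le_ereal_inf_tmp => _ [z Oz <-]; rewrite leeNl.
have rate0 : (0 <= rate P q z)%E.
  by have [[P0 _] _ _] := markov; exact: rate_ge0.
case E : (rate P q z) rate0 => [I||] // _; last by rewrite leNye.
have zI : (rate P q z <= I%:E)%E by rewrite E.
apply/lee_addgt0Pr => e e0; rewrite -leeBlDr // -EFinN -EFinB -opprD.
have [N HN] := open_lower_bound oO Oz zI e0; exact: limn_einf_ge HN.
Qed.

End lower.

(** * Integration of a mark against its law *)

Section replace.
Context {R : realType} {d1 d2 : measure_display} {T1 : measurableType d1}
  {T2 : measurableType d2}.
Variables (mu : {measure set T1 -> \bar R}) (nu : {measure set T2 -> \bar R}).
Variables (D : set T1) (Z : T1 -> T2) (h : T1 -> R) (c : R).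
Hypothesis mD : measurable D.
Hypothesis mZ : measurable_fun setT Z.
Hypothesis mh : measurable_fun setT h.
Hypothesis h0 : forall w, 0 <= h w.
Hypothesis indic : forall B, measurable B ->
  (\int[mu]_(w in D) (\1_B (Z w) * h w)%:E = c%:E * nu B)%E.

Import HBNNSimple.

Let replace_nnsfun (f : {nnsfun T2 >-> R}) :
  (\int[mu]_(w in D) (f (Z w) * h w)%:E = c%:E * \int[nu]_a (f a)%:E)%E.
Proof.
rewrite integralT_nnsfun sintegralE ge0_mule_fsumr; last first.
  by move=> r; exact: nnsfun_mulemu_ge0.
have E w : (f (Z w) * h w)%:E = \sum_(y \in range f)
    (y * (\1_(f @^-1` [set y]) (Z w) * h w))%:E.
  rewrite fimfunE mulr_fsuml fsumEFin //.
  by congr EFin; apply: eq_fsbigr => y _; rewrite mulrA.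
under eq_integral do rewrite E.
have mi y : measurable_fun setT
    (fun w => \1_(f @^-1` [set y]) (Z w) * h w).
  apply: measurable_funM => //; apply: (measurableT_comp _ mZ).
  exact: measurable_indic.
have i0 y w : 0 <= \1_(f @^-1` [set y]) (Z w) * h w :> R by rewrite mulr_ge0.
rewrite ge0_integral_fsum //; last 2 first.
- move=> y; apply/measurable_EFinP; apply: measurable_funM => //.
  exact: measurable_funTS.
- move=> y w _; rewrite lee_fin.
  have [y0|y0] := leP 0 y; first by rewrite mulr_ge0.
  rewrite (_ : f @^-1` [set y] = set0) ?indic0 ?mul0r ?mulr0 //.
  by apply/seteqP; split=> // a /= fa; move: y0; rewrite -fa ltNge fun_ge0.
apply: eq_fsbigr => y; rewrite inE => -[a _ <-].
under eq_integral do rewrite EFinM.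
rewrite ge0_integralZl //; last 3 first.
- by apply/measurable_EFinP; exact: measurable_funTS.
- by move=> w _; rewrite lee_fin.
- by rewrite lee_fin fun_ge0.
by rewrite indic // muleCA.
Qed.

(** A mark can be integrated out against its law, by approximation with simple
    functions, once this is known for indicators. *)
Lemma integral_replace (f : T2 -> R) : measurable_fun setT f ->
  (forall a, 0 <= f a) ->
  (\int[mu]_(w in D) (f (Z w) * h w)%:E = c%:E * \int[nu]_a (f a)%:E)%E.
Proof.
move=> mf f0; have mEf : measurable_fun setT (EFin \o f) by exact/measurable_EFinP.
pose f_ := nnsfun_approx measurableT mEf.
have f_cvg a : (f_ n a)%:E @[n --> \oo] --> (f a)%:E.
  by apply: (cvg_nnsfun_approx measurableT mEf) => // b _; rewrite lee_fin.
have f_nd n m a : (n <= m)%N -> f_ n a <= f_ m a.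
  by move=> nm; have /lefP/(_ a) := nd_nnsfun_approx measurableT mEf nm.
have mfh n : measurable_fun D (fun w => (f_ n (Z w) * h w)%:E).
  apply/measurable_EFinP; apply: measurable_funTS; apply: measurable_funM => //.
  exact: measurableT_comp.
transitivity (limn (fun n => \int[mu]_(w in D) (f_ n (Z w) * h w)%:E))%E.
  rewrite -monotone_convergence //=.
  - apply: eq_integral => w _; apply/esym/cvg_lim => //.
    under eq_fun do rewrite EFinM.
    by rewrite EFinM; apply: cvgeMr => //; exact: f_cvg.
  - by move=> n w _; rewrite lee_fin mulr_ge0.
  - by move=> w _ n m nm; rewrite lee_fin ler_wpM2r // f_nd.
have -> : (\int[nu]_a (f a)%:E = limn (fun n => \int[nu]_a (f_ n a)%:E))%E.
  rewrite -monotone_convergence //=.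
  - by apply: eq_integral => a _; apply/esym/cvg_lim => //; exact: f_cvg.
  - by move=> n; exact/measurable_EFinP.
  - by move=> n a _; rewrite lee_fin.
  - by move=> a _ n m nm; rewrite lee_fin f_nd.
rewrite -limeMl //.
  by apply: congr_lim; apply/funext => n; exact: replace_nnsfun.
apply: ereal_nondecreasing_is_cvgn => n m nm; apply: ge0_le_integral => //=.
- by move=> a _; rewrite lee_fin.
- exact/measurable_EFinP.
- exact/measurable_EFinP.
- by move=> a _; rewrite lee_fin f_nd.
Qed.

End replace.

(** * Exponential moments of the process *)

Section moments.
Context {R : realType} {dsp : measure_display} {Omega : measurableType dsp}.
Variable Pr : probability Omega R.
Context {X : finType} {d : nat}.
Variables (P : X -> X -> R) (Xs : nat -> Omega -> X) (A : nat -> Omega -> 'rV[R]_d)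
  (q : X -> X -> probability (borel_rV R d) R).
Hypothesis markov : homogeneous_markov_chain Pr P Xs.
Hypothesis measA : forall m, (0 < m)%N ->
  measurable_fun [set: Omega] (A m : Omega -> borel_rV R d).
Hypothesis indep : cond_product_law Pr Xs A q.

Section path.
Variables (n : nat) (x : nat -> X) (f : nat -> borel_rV R d -> R) (k : nat -> R).
Hypothesis mf : forall m, measurable_fun setT (f m).
Hypothesis f0 : forall m a, 0 <= f m a.
Hypothesis fk : forall m, (\int[q (x m) (x m.+1)]_a (f m a)%:E = (k m)%:E)%E.

Let k0 m : 0 <= k m.
Proof.
by rewrite -lee_fin -fk; apply: integral_ge0 => a _; rewrite lee_fin.
Qed.

Let marks_after j (B : nat -> set (borel_rV R d)) : set Omega :=
  [set w | forall m, (j < m <= n)%N -> B m (A m w)].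

Let measurable_marks_after j B : (forall m, measurable (B m)) ->
  measurable (marks_after j B).
Proof.
move=> mB.
have -> : marks_after j B = marks_in A n (fun m => if (m <= j)%N then setT else B m).
  apply/seteqP; split=> w h m /andP[h1 h2] //=.
    by case: leqP => // jm; apply: h; rewrite jm.
  have := h m; rewrite h2 (leq_ltn_trans _ h1) // leqNgt h1 /=; exact.
by apply: (measurable_marks_in measA) => m; case: ifP.
Qed.

Let partial_prod j w := \prod_(0 <= m < j) f m (A m.+1 w).

Let measurable_mark m : measurable_fun setT (fun w => f m (A m.+1 w)).
Proof. by apply: (measurableT_comp (mf m)); exact: measA. Qed.

Let measurable_partial_prod j : measurable_fun setT (partial_prod j).
Proof.
elim: j => [|j IH].
  rewrite (_ : partial_prod 0 = cst 1) //.
  by apply/funext => w; rewrite /partial_prod big_geq.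
rewrite (_ : partial_prod j.+1 = partial_prod j \* (fun w => f j (A j.+1 w))).
  exact: measurable_funM.
by apply/funext => w; rewrite /partial_prod big_nat_recr.
Qed.

Let partial_prod_ge0 j w : 0 <= partial_prod j w.
Proof. by apply: prodr_ge0. Qed.

(* The marks are integrated out one after the other; the marks that remain are
   restricted to measurable sets. *)
Let moment_after j B : (j <= n)%N -> (forall m, measurable (B m)) ->
  (\int[Pr]_(w in marks_after j B `&` path_event Xs n x) (partial_prod j w)%:E =
   (mass Pr (path_event Xs n x) * \prod_(0 <= m < j) k m *
    \prod_(j <= m < n) fine (q (x m) (x m.+1) (B m.+1)))%:E)%E.
Proof.
have mp := measurable_path_event markov n x.
elim: j B => [|j IH] B jn mB.
  under eq_integral do rewrite /partial_prod big_geq //.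
  rewrite [X in (\int[_]_(_ in X) _)%E](_ : _ = marks_in A n B `&` path_event Xs n x) //.
  have mm := measurableI _ _ (measurable_marks_in measA n mB) mp.
  rewrite integral_cst // mul1e.
  transitivity (mass Pr (marks_in A n B `&` path_event Xs n x))%:E; first exact: massE.
  rewrite (mass_marked_path markov measA indep) //.
  by rewrite [X in _ = (_ * X * _)%:E]big_geq // mulr1.
pose D := marks_after j.+1 B `&` path_event Xs n x.
have mD : measurable D by apply: measurableI => //; exact: measurable_marks_after.
pose c := mass Pr (path_event Xs n x) * \prod_(0 <= m < j) k m *
  \prod_(j.+1 <= m < n) fine (q (x m) (x m.+1) (B m.+1)).
have indic (B' : set (borel_rV R d)) : measurable B' ->
    (\int[Pr]_(w in D) (\1_B' (A j.+1 w) * partial_prod j w)%:E =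
     c%:E * q (x j) (x j.+1) B')%E.
  move=> mB'; pose B2 m := if m == j.+1 then B' else B m.
  have := IH B2 (ltnW jn) _.
  rewrite (_ : marks_after j B2 `&` path_event Xs n x = D `&` A j.+1 @^-1` B').
    move=> h; rewrite (_ : (_ * _)%E = (mass Pr (path_event Xs n x) *
      \prod_(0 <= m < j) k m *
      \prod_(j <= m < n) fine (q (x m) (x m.+1) (B2 m.+1)))%:E); last first.
      rewrite -[q _ _ B']fineK ?fin_num_measure // -EFinM; congr EFin.
      rewrite [X in _ = _ * X]big_ltn // {1}/B2 eqxx /c.
      rewrite [X in _ = _ * (_ * X)](_ : _ =
        \prod_(j.+1 <= m < n) fine (q (x m) (x m.+1) (B m.+1))); first by ring.
      rewrite big_nat [RHS]big_nat; apply: eq_bigr => m /andP[jm _].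
      by rewrite /B2 eqSS gtn_eqF.
    rewrite -h => [|m]; last by rewrite /B2; case: ifP.
    rewrite [RHS]integral_mkcondr; apply: eq_integral => w _; rewrite patchE.
    case: ifPn => [/set_mem/= wB|/negP wB]; rewrite indicE.
      by rewrite mem_set // mul1r.
    by rewrite memNset ?mul0r // => wB'; apply: wB; exact: mem_set.
  apply/seteqP; split=> w /=.
    move=> [h hp]; split; last by have := h j.+1; rewrite ltnSn jn /B2 eqxx; exact.
    split=> // m /andP[jm mn]; have := h m; rewrite mn (ltnW jm) /B2 gtn_eqF //.
    exact.
  move=> [[h hp] hB]; split=> // m /andP[jm mn]; rewrite /B2.
  case: eqP => [->//|/eqP nm]; apply: h; rewrite mn andbT ltn_neqAle eq_sym nm.
  exact: jm.
have := integral_replace mD (measA (ltn0Sn j)) (measurable_partial_prod j)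
  (partial_prod_ge0 j) indic (mf j) (f0 j).
rewrite fk -EFinM => h.
transitivity (c * k j)%:E; last by rewrite /c big_nat_recr //=; congr EFin; ring.
by rewrite -h; apply: eq_integral => w _; rewrite /partial_prod big_nat_recr //= mulrC.
Qed.

Lemma path_moment :
  (\int[Pr]_(w in path_event Xs n x) (\prod_(0 <= m < n) f m (A m.+1 w))%:E =
   (mass Pr (path_event Xs n x) * \prod_(0 <= m < n) k m)%:E)%E.
Proof.
have := moment_after (leqnn n) (fun=> measurableT).
rewrite (_ : marks_after n _ = setT); first by rewrite setTI [X in _ * X]big_geq // mulr1.
by apply/seteqP; split.
Qed.

End path.

Fixpoint path_weight (g : X -> X -> R) (x : X) (t : seq X) : R :=
  if t is y :: t' then g x y * path_weight g y t' else 1.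

Lemma path_weightE g x0 x t : path_weight g x t =
  \prod_(0 <= m < size t) g (nth x0 (x :: t) m) (nth x0 t m).
Proof.
elim: t x => [|y t IH] x /=; first by rewrite big_geq.
by rewrite big_nat_recl //= IH.
Qed.

Lemma path_weight_sum_le1 g n x : (forall x y, 0 <= g x y) ->
  (forall x, \sum_y g x y <= 1) -> \sum_(t : n.-tuple X) path_weight g x t <= 1.
Proof.
move=> g0 g1; elim: n x => [|n IH] x.
  rewrite (bigD1 [tuple]) //= big1 ?addr0 // => t /eqP []; exact: tuple0.
rewrite (big_tuple_cons _ (path_weight g x)) /=.
apply: le_trans (g1 x); apply: ler_sum => y _.
by rewrite -mulr_sumr -[leRHS]mulr1 ler_wpM2l.
Qed.

(** The space is partitioned by the path; on each piece the marks are integrated out,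
    and what remains is the weight of the path in a substochastic matrix. *)
Lemma process_moment n (u : X -> X -> borel_rV R d -> R) (k : X -> X -> R) :
  (forall x y, measurable_fun setT (u x y)) ->
  (forall x y, (\int[q x y]_a (expR (u x y a))%:E = (k x y)%:E)%E) ->
  (forall x, \sum_y P x y * k x y <= 1) ->
  measurable_fun setT
    (fun w => \sum_(0 <= m < n) u (Xs m w) (Xs m.+1 w) (A m.+1 w)) ->
  (\int[Pr]_w (expR (\sum_(0 <= m < n) u (Xs m w) (Xs m.+1 w) (A m.+1 w)))%:E
   <= 1)%E.
Proof.
move=> mu uk Pk ms; have [[P0 _] _ _] := markov.
set S := fun w : Omega => \sum_(0 <= m < n) _ in ms *.
have k0 x y : 0 <= k x y.
  by rewrite -lee_fin -uk; apply: integral_ge0 => a _; rewrite lee_fin expR_ge0.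
pose pth (p : X * n.-tuple X) (m : nat) : X := nth p.1 (p.1 :: p.2) m.
pose F p := path_event Xs n (pth p).
have mF p : measurable (F p) by exact: (measurable_path_event markov).
have FT : \big[setU/set0]_(p <- enum {: X * n.-tuple X}) F p = setT.
  apply/seteqP; split=> // w _; rewrite -bigcup_seq.
  exists (Xs 0%N w, [tuple Xs i.+1 w | i < n]); first by rewrite /= mem_enum.
  move=> [|m] //= mn; rewrite /pth /=.
  by rewrite (nth_map (Ordinal mn)) ?size_enum_ord // nth_enum_ord.
have Fdis : trivIset [set` enum {: X * n.-tuple X}] F.
  move=> [x t] [y t'] _ _ [w [h1 h2]].
  have e : x = y by rewrite -[LHS](h1 0%N) // -[RHS](h2 0%N).
  congr (_, _); first exact: e.
  apply: val_inj; apply: (@eq_from_nth _ x); rewrite ?size_tuple // => m mn.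
  have := h1 m.+1 mn; have := h2 m.+1 mn; rewrite /pth /= => -> <-.
  by apply: set_nth_default; rewrite size_tuple.
have mES : measurable_fun setT (fun w => (expR (S w))%:E).
  by apply/measurable_EFinP; apply: (measurableT_comp (@measurable_expR R) ms).
rewrite -FT ge0_integral_bigsetU ?enum_uniq //; last first.
  exact: measurable_funTS.
pose g x y := P x y * k x y.
rewrite big_enum /= (eq_bigr (fun p : X * n.-tuple X =>
  (mass Pr [set w | Xs 0%N w = p.1] * path_weight g p.1 p.2)%:E)); last first.
  move=> p _.
  transitivity (\int[Pr]_(w in F p) (\prod_(0 <= m < n)
      (expR (u (pth p m) (pth p m.+1) (A m.+1 w))))%:E)%E.
    apply: eq_integral => w /set_mem h; congr EFin.
    rewrite /S expR_sum; apply: eq_big_nat => m /andP[_ mn].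
    by rewrite !h // ltnW.
  rewrite (path_moment n (x := pth p) (f := fun m a => expR (u (pth p m) (pth p m.+1) a))
    (k := fun m => k (pth p m) (pth p m.+1))).
  - rewrite (mass_path markov); congr EFin; rewrite -mulrA -big_split /=.
    by rewrite (path_weightE g p.1) size_tuple.
  - by move=> m; apply: (measurableT_comp (@measurable_expR R)); exact: mu.
  - by move=> m a; exact: expR_ge0.
  - by move=> m; exact: uk.
rewrite sumEFin lee_fin -(pair_big predT predT (fun x (t : n.-tuple X) =>
  mass Pr [set w | Xs 0%N w = x] * path_weight g x t)) /=.
apply: (@le_trans _ _ (\sum_x mass Pr [set w | Xs 0%N w = x])).
  apply: ler_sum => x _; rewrite -mulr_sumr -[leRHS]mulr1 ler_wpM2l ?mass_ge0 //.
  by apply: path_weight_sum_le1 => // x' y; rewrite mulr_ge0.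
rewrite -(mass_disjoint Pr (sel := predT)).
- by rewrite -lee_fin -massE ?probability_le1 //;
    apply: fin_bigcup_measurable => // x _; exact: (measurable_state markov).
- by move=> x _; exact: (measurable_state markov).
- by move=> x y w _ _ /= -> ->.
Qed.

Lemma process_chernoff n (u : X -> X -> borel_rV R d -> R) (k : X -> X -> R) (c : R) S :
  (forall x y, measurable_fun setT (u x y)) ->
  (forall x y, (\int[q x y]_a (expR (u x y a))%:E = (k x y)%:E)%E) ->
  (forall x, \sum_y P x y * k x y <= 1) ->
  measurable_fun setT
    (fun w => \sum_(0 <= m < n) u (Xs m w) (Xs m.+1 w) (A m.+1 w)) ->
  measurable S ->
  (forall w, S w -> c <= \sum_(0 <= m < n) u (Xs m w) (Xs m.+1 w) (A m.+1 w)) ->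
  mass Pr S <= expR (- c).
Proof.
move=> mu uk Pk ms mS Sc; have := process_moment mu uk Pk ms.
set T := fun w : Omega => \sum_(0 <= m < n) _ in ms Sc *.
have mET : measurable_fun setT (fun w => (expR (T w))%:E).
  by apply/measurable_EFinP; apply: (measurableT_comp (@measurable_expR R) ms).
have T0 w : (0 <= (expR (T w))%:E)%E by rewrite lee_fin expR_ge0.
move=> le1.
have : ((expR c)%:E * Pr S <= 1)%E.
  apply: le_trans le1; rewrite -integral_cst //.
  apply: (@le_trans _ _ (\int[Pr]_(w in S) (expR (T w))%:E)%E).
    apply: ge0_le_integral => //=; first exact: measurable_funTS.
    by move=> w Sw; rewrite lee_fin ler_expR; exact: Sc.
  exact: ge0_subset_integral.
rewrite massE // -EFinM lee_fin expRN mulrC => h.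
by rewrite -[leRHS]mul1r ler_pdivlMr ?expR_gt0.
Qed.

End moments.

(** * The upper bound *)

Lemma le_of_lt_EFin {R : realType} (s t : \bar R) :
  (forall c : R, (c%:E < s)%E -> (c%:E <= t)%E) -> (s <= t)%E.
Proof.
case: s => [r||] h; last by rewrite leNye.
  apply/lee_addgt0Pr => e e0; rewrite -leeBlDr // -EFinB; apply: h.
  by rewrite lte_fin ltrBlDr ltrDl.
case: t h => [t||] h //.
  have /h : ((t + 1)%:E < +oo)%E by rewrite ltry.
  by rewrite lee_fin gerDl ler10.
have /h : (0%:E < +oo :> \bar R)%E by rewrite ltry.
by [].
Qed.

(** The finite lists of points, ordered by inclusion, form the filter to which the
    near-covering form of compactness is applied. *)
Lemma finite_subcover (T : topologicalType) (K : set T) (U : T -> set T) :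
  compact K -> (forall x, K x -> U x x) -> (forall x, open (U x)) ->
  exists s : seq T, K `<=` \bigcup_(x in [set` s]) U x.
Proof.
move=> /compact_near_coveringP cK KU oU.
pose F : set_system (seq T) :=
  [set S : set (seq T) |
    exists s0 : seq T, forall s : seq T, {subset s0 <= s} -> S s].
have FF : Filter F.
  split.
  - by exists [::].
  - move=> S S' [s1 h1] [s2 h2]; exists (s1 ++ s2) => s sub; split.
      by apply: h1 => x xs; apply: sub; rewrite mem_cat xs.
    by apply: h2 => x xs; apply: sub; rewrite mem_cat xs orbT.
  - by move=> S S' SS' [s0 h]; exists s0 => s /h/SS'.
have [x Kx|s0 h] := cK _ F (fun s x => (\bigcup_(y in [set` s]) U y) x) FF.
  exists (U x, [set s : seq T | x \in s]).
    split=> /=; first by apply: open_nbhs_nbhs; split; [exact: oU|exact: KU].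
    by exists [:: x] => s; apply; rewrite inE.
  by move=> [x' s] /= [Ux' xs]; exists x.
by exists s0; exact: h.
Qed.

Section upper.
Context {R : realType} {dsp : measure_display} {Omega : measurableType dsp}.
Variable Pr : probability Omega R.
Context {X : finType} {d : nat}.
Variables (P : X -> X -> R) (Xs : nat -> Omega -> X) (A : nat -> Omega -> 'rV[R]_d)
  (q : X -> X -> probability (borel_rV R d) R).
Hypothesis markov : homogeneous_markov_chain Pr P Xs.
Hypothesis measA : forall m, (0 < m)%N ->
  measurable_fun [set: Omega] (A m : Omega -> borel_rV R d).
Hypothesis indep : cond_product_law Pr Xs A q.
Hypothesis fin : forall x y s, (\int[q x y]_a (expR (s * norm1 a))%:E < +oo)%E.
Implicit Types (z : state_space R X d) (U C : set (state_space R X d)).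

Let Y := emp_pair Xs A.

Let P_ge0 x y : 0 <= P x y.
Proof. by case: markov => -[]. Qed.

Let P_sum x : \sum_y P x y = 1.
Proof. by case: markov => -[]. Qed.

Let measurable_Y n U : open U -> measurable (Y n @^-1` U).
Proof. exact: (measurable_emp_pair markov). Qed.

Lemma pairing_increments u n w : pairing u (increments Xs A n w) =
  \sum_(0 <= m < n) pairing u (step_vec (Xs m w) (Xs m.+1 w) (A m.+1 w)).
Proof.
rewrite /pairing exchange_big /=; apply: eq_bigr => j _.
by rewrite incrementsE big_add1 /= mulr_sumr.
Qed.

Lemma pairing_emp u n w : n.+1%:R * pairing u (state_coord (Y n w)) =
  \sum_(0 <= m < n.+1) pairing u (step_vec (Xs m w) (Xs m.+1 w) (A m.+1 w)).
Proof.
rewrite -pairing_increments /pairing mulr_sumr; apply: eq_bigr => j _.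
by rewrite state_coord_emp mulrCA; congr (_ * _); rewrite mulrA mulfV ?pnatr_eq0 // mul1r.
Qed.

Lemma measurable_pairing_emp u n :
  measurable_fun setT (fun w => pairing u (state_coord (Y n w))).
Proof.
apply: measurable_sum => j; apply: measurable_funM => //.
exact: (measurable_state_coord markov).
Qed.

Lemma open_pairing_gt (v : (X * X) * option 'I_d -> R) c :
  open [set z | c < pairing v (state_coord z)].
Proof.
apply: (@open_comp _ _ (fun z => pairing v (state_coord z)) [set r | c < r]).
  by move=> z _; exact: continuous_pairing_coord.
exact: open_gt.
Qed.

(** The exponential of a dual functional along the process has mean at most one:
    a step from [x] contributes [exp (- D) (1 + D) <= 1]. *)
Lemma dual_vector_chernoff lam g n c :
  mass Pr (Y n @^-1` [set z | c < pairing (dual_vector P q lam g) (state_coord z)])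
  <= expR (- (n.+1%:R * c)).
Proof.
pose D x := \sum_y' P x y' * (expR (g x y') - 1).
pose u x y (a : borel_rV R d) := pairing (dual_vector P q lam g) (step_vec x y a).
have uE x y a : u x y a = dot (lam x y) a + (g x y - ln (mgf (q x y) (lam x y)) - D x).
  by rewrite /u /dual_vector pairing_step_vec.
have mu x y : measurable_fun setT (u x y).
  rewrite (_ : u x y = fun a => dot (lam x y) a
    + (g x y - ln (mgf (q x y) (lam x y)) - D x)); last exact/funext/uE.
  by apply: measurable_funD => //; exact: measurable_dot.
apply: (@process_chernoff _ _ _ Pr _ _ P Xs A q markov measA indep n.+1 u
  (fun x y => expR (g x y - D x))) => //.
- move=> x y.
  pose s := expR (g x y - ln (mgf (q x y) (lam x y)) - D x).
  under eq_integral => a _ do rewrite uE expRD mulrC EFinM.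
  rewrite ge0_integralZl //.
  + rewrite integral_exp_dot // -EFinM; congr EFin.
    rewrite !expRD !expRN lnK ?posrE ?mgf_gt0 //.
    by field; rewrite !gt_eqF ?expR_gt0 ?mgf_gt0.
  + apply/measurable_EFinP; apply: (measurableT_comp (@measurable_expR R)).
    exact: measurable_dot.
- move=> x.
  under eq_bigr => y _ do rewrite expRB mulrA.
  rewrite -mulr_suml ler_pdivrMr ?expR_gt0 // mul1r.
  apply: le_trans (expR_ge1Dx _).
  rewrite /D; under [in leRHS]eq_bigr => y _ do rewrite mulrBr mulr1.
  by rewrite sumrB P_sum addrC subrK.
- rewrite (_ : (fun w => _) = fun w =>
    n.+1%:R * pairing (dual_vector P q lam g) (state_coord (Y n w))).
    by apply: measurable_funM => //; exact: measurable_pairing_emp.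
  by apply/funext => w; rewrite pairing_emp.
- exact/measurable_Y/open_pairing_gt.
- move=> w /= cw; rewrite -pairing_emp ler_pM2l ?ltr0n //; exact: ltW.
Qed.

Lemma abs_theta_le1 z p : `|state_coord z (p, None)| <= 1.
Proof.
by rewrite ger0_norm; [exact: theta_le1|exact: theta_ge0].
Qed.

Lemma open_outside_box (M : R) :
  open [set z : state_space R X d | exists j, M < `|state_coord z j|].
Proof.
rewrite (_ : [set z | _] = \bigcup_j
    ((fun z => `|state_coord z j|) @^-1` [set r | M < r])).
  apply: bigcup_open => j _; apply: open_comp; last exact: open_gt.
  move=> z _; apply: (@continuous_comp _ _ _ (fun z => state_coord z j)
    (fun r => `|r|)); first exact: continuous_coord_state.
  exact: norm_continuous.
by apply/seteqP; split=> z /=; [move=> [j h]; exists j|move=> [j _ h]; exists j].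
Qed.

(** Exponential tightness, by the exponential moment of order one of the norms of the
    marks; the entries of [theta] never exceed one. *)
Lemma exponential_tightness (c : R) : exists M, forall n,
  mass Pr (Y n @^-1` [set z | exists j, M < `|state_coord z j|])
  <= expR (- (n.+1%:R * c)).
Proof.
pose I x y := fine (\int[q x y]_a (expR (1 * norm1 a))%:E).
have IE x y : (\int[q x y]_a (expR (1 * norm1 a))%:E = (I x y)%:E)%E.
  rewrite fineK // ge0_fin_numE //.
  by apply: integral_ge0 => a _; rewrite lee_fin expR_ge0.
have I0 x y : 0 <= I x y.
  by rewrite fine_ge0 //; apply: integral_ge0 => a _; rewrite lee_fin expR_ge0.
pose S := 1 + \sum_p I p.1 p.2.
have S0 : 0 < S by apply: ltr_pwDl => //; exact: sumr_ge0.
have IS x y : I x y <= S.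
  rewrite /S (bigD1 (x, y)) //= addrCA lerDl addr_ge0 //; exact: sumr_ge0.
pose u (x y : X) (a : borel_rV R d) := 1 * norm1 a - ln S.
have mu x y : measurable_fun setT (u x y).
  by apply: measurable_funB => //; apply: measurable_funM => //; exact: measurable_norm1.
exists (Num.max 1 (c + ln S)) => n.
apply: (@process_chernoff _ _ _ Pr _ _ P Xs A q markov measA indep n.+1 u
  (fun x y => I x y / S)) => //.
- move=> x y; rewrite /u.
  under eq_integral => a _ do rewrite expRB lnK ?posrE // mulrC EFinM.
  rewrite ge0_integralZl //.
  + by rewrite IE -EFinM mulrC.
  + apply/measurable_EFinP; apply: (measurableT_comp (@measurable_expR R)).
    by apply: measurable_funM => //; exact: measurable_norm1.
  + by rewrite lee_fin invr_ge0 ltW.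
- move=> x; rewrite -[leRHS](P_sum x); apply: ler_sum => y _.
  by rewrite -[leRHS]mulr1 ler_wpM2l // ler_pdivrMr // mul1r.
- apply: measurable_sum => m; apply: measurable_funB => //.
  apply: measurable_funM => //; apply: (measurableT_comp (@measurable_norm1 R d)).
  exact: measA.
- exact/measurable_Y/open_outside_box.
- move=> w /= [[p [i|]]]; last first.
    rewrite gt_max => /andP[h _].
    by move: h; rewrite ltNge abs_theta_le1.
  rewrite gt_max state_coord_emp incrementsE big_add1 /= => /andP[_ h].
  rewrite /u sumrB sumr_const_nat subn0 -[ln S *+ _]mulr_natl lerBrDl -mulrDr.
  have NR : 0 < n.+1%:R :> R by rewrite ltr0n.
  rewrite normrM ger0_norm ?invr_ge0 ?(ltW NR) // mulrC ltr_pdivlMr // in h.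
  rewrite [ln S + c]addrC mulrC; apply: (le_trans (ltW h)).
  apply: (le_trans (ler_norm_sum _ _ _)); apply: ler_sum => m _.
  rewrite mul1r /step_vec /= normrM.
  apply: (@le_trans _ _ `|A m.+1 w 0 i|).
    rewrite -[leRHS]mul1r ler_wpM2r //.
    by case: (_ && _); rewrite ?normr1 ?normr0.
  rewrite /norm1 (bigD1 i) //= lerDl; exact: sumr_ge0.
Qed.

(** The flow through a state telescopes along a path, so it vanishes in the limit. *)
Lemma flux_emp x n w : `|pairing (flux x) (state_coord (Y n w))| <= n.+1%:R^-1.
Proof.
have NR : 0 < n.+1%:R :> R by rewrite ltr0n.
rewrite -(ler_pM2l NR) mulfV ?gt_eqF // -{1}(ger0_norm (ltW NR)) -normrM pairing_emp.
rewrite (eq_bigr (fun m => (Xs m w == x)%:R - (Xs m.+1 w == x)%:R)); last first.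
  move=> m _; rewrite /flux pairing_step_vec /dot big1 ?add0r // => i _.
  by rewrite mxE mul0r.
rewrite (telescope_sumr_eq (fun m => - (Xs m w == x)%:R)) // => [|m _]; last first.
  by rewrite opprK addrC.
by rewrite opprK; case: (Xs n.+1 w == x); case: (Xs 0%N w == x);
  rewrite ler_norml; apply/andP; split; rewrite /=; lra.
Qed.

Let mass_le1 S : measurable S -> mass Pr S <= 1.
Proof. by move=> mS; rewrite -lee_fin -massE // probability_le1. Qed.

Let massU S T : measurable S -> measurable T ->
  mass Pr (S `|` T) <= mass Pr S + mass Pr T.
Proof.
move=> mS mT; rewrite -lee_fin EFinD -!massE //; last exact: measurableU.
exact: measureU2.
Qed.

(** On a balanced point a dual functional exceeds [c]; around an unbalanced point the
    empirical pair is eventually absent, by [flux_emp]. *)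
Lemma local_upper_bound z (c : R) : (c%:E < rate P q z)%E ->
  exists U N, [/\ open U, U z &
    forall n, (N <= n)%N -> mass Pr (Y n @^-1` U) <= expR (- (n.+1%:R * c))].
Proof.
move=> cz; have [bal|unbal] := pselect (balanced z).
  have [c' cc' c'z] := lt_EFin_between cz.
  have [lam [g c'L]] := dual_ge P_ge0 fin bal c'z.
  exists [set z | c < pairing (dual_vector P q lam g) (state_coord z)], 0%N; split.
  - exact: open_pairing_gt.
  - exact: lt_le_trans cc' c'L.
  - by move=> n _; exact: dual_vector_chernoff.
have [x nx] : exists x, pairing (flux x) (state_coord z) != 0.
  apply: contrapT => h; apply: unbal; apply/balanced_flux => x.
  by apply/eqP; apply: contrapT => nx; apply: h; exists x; apply/negP.
pose del := `|pairing (flux x) (state_coord z)|.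
have del0 : 0 < del by rewrite normr_gt0.
exists [set z' | del / 2 < `|pairing (flux x) (state_coord z')|],
  (Num.bound (del / 2)^-1); split.
- apply: (@open_comp _ _ (fun z => `|pairing (flux x) (state_coord z)|)
    [set r | del / 2 < r]); last exact: open_gt.
  move=> z' _; apply: (@continuous_comp _ _ _
    (fun z => pairing (flux x) (state_coord z)) (fun r => `|r|)).
    exact: continuous_pairing_coord.
  exact: norm_continuous.
- by rewrite /= -/del; lra.
- move=> n Nn; rewrite (_ : Y n @^-1` _ = set0).
    by rewrite /mass measure0 expR_ge0.
  apply/seteqP; split=> // w /=; rewrite ltNge => /negP; apply.
  apply: (le_trans (flux_emp x n w)).
  have d0 : 0 <= (del / 2)^-1 by rewrite invr_ge0 divr_ge0 // ltW.
  rewrite -[leRHS]invrK lef_pV2 ?posrE ?ltr0n // ?invr_gt0 ?divr_gt0 //.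
  apply: (le_trans (ltW (archi_boundP d0))); rewrite ler_nat; exact: leqW.
Qed.

Lemma finite_upper_bound (I : choiceType) (c : R) (U : I -> set (state_space R X d))
    (s : seq I) :
  (forall i, i \in s -> open (U i) /\ exists N, forall n, (N <= n)%N ->
     mass Pr (Y n @^-1` U i) <= expR (- (n.+1%:R * c))) ->
  exists N, forall n, (N <= n)%N ->
    mass Pr (Y n @^-1` \bigcup_(i in [set` s]) U i)
    <= (size s)%:R * expR (- (n.+1%:R * c)).
Proof.
elim: s => [|i s IH] Us.
  exists 0%N => n _; rewrite mul0r (_ : _ @^-1` _ = set0) ?/mass ?measure0 //.
  by apply/seteqP; split=> // w [].
have [N1 N1P] : exists N, forall n, (N <= n)%N ->
    mass Pr (Y n @^-1` \bigcup_(i in [set` s]) U i)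
    <= (size s)%:R * expR (- (n.+1%:R * c)).
  by apply: IH => j js; apply: Us; rewrite inE js orbT.
have [oUi [N2 N2P]] := Us i (mem_head _ _).
have os : open (\bigcup_(i in [set` s]) U i).
  by apply: bigcup_open => j /= js; apply: (Us j _).1; rewrite inE js orbT.
exists (maxn N1 N2) => n; rewrite geq_max => /andP[n1 n2].
rewrite (_ : \bigcup_(i in [set` i :: s]) U i = U i `|` \bigcup_(i in [set` s]) U i).
  rewrite preimage_setU /= -[(size s).+1%:R]natr1 mulrDl mul1r [leRHS]addrC.
  apply: (le_trans (massU (measurable_Y n oUi) (measurable_Y n os))).
  by apply: lerD; [exact: N2P|exact: N1P].
apply/seteqP; split=> z /=.
  move=> [j]; rewrite /= inE => /orP[/eqP -> ?|js ?]; [by left|right].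
  by exists j.
by move=> [?|[j /= js ?]]; [exists i; rewrite //= mem_head|exists j; rewrite //= inE js orbT].
Qed.

Lemma ldp_upper C : closed C ->
  (limn_esup (fun n => (n.+1%:R^-1)%:E * lne (Pr (Y n @^-1` C))) <=
   - ereal_inf (rate P q @` C))%E.
Proof.
move=> cC; rewrite leeNr; apply: le_of_lt_EFin => c cI; rewrite leeNr -EFinN.
(* the room between [c] and [c'] absorbs the number of sets in the cover *)
have [c' cc' c'I] := lt_EFin_between cI.
have [M HM] := exponential_tightness c'.
pose box := [set z : state_space R X d | forall j, `|state_coord z j| <= M].
pose out := [set z : state_space R X d | exists j, M < `|state_coord z j|].
have outE : out = ~` box.
  apply/seteqP; split=> z /=.
    by move=> [j h] /(_ j); rewrite leNgt h.
  move=> nb; apply: contrapT => no; apply: nb => j; rewrite leNgt.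
  by apply/negP => h; apply: no; exists j.
have cbox : compact box by exact: compact_coord_box.
have cK : compact (C `&` box) by rewrite setIC; exact: compact_closedI.
have /choice[U UP] z : exists U : set (state_space R X d),
    (C z -> U z) /\ (open U /\ exists N, forall n, (N <= n)%N ->
       mass Pr (Y n @^-1` U) <= expR (- (n.+1%:R * c'))).
  have [Cz|nCz] := pselect (C z).
    have [|U [N [oU Uz h]]] := @local_upper_bound z c'.
      by apply: (lt_le_trans c'I); apply: ereal_inf_lbound; exists z.
    by exists U; split=> //; split=> //; exists N.
  exists set0; split=> //; split; first exact: open0.
  by exists 0%N => n _; rewrite preimage_set0 /mass measure0 expR_ge0.
have [D cover] := finite_subcover cK (fun z (Kz : (C `&` box) z) => (UP z).1 Kz.1)
  (fun z => (UP z).2.1).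
pose V := \bigcup_(z in [set` D]) U z.
have [N1 N1P] := finite_upper_bound (fun z (_ : z \in D) => (UP z).2).
have oV : open V by apply: bigcup_open => z /= zD; exact: (UP z).2.1.
have oout : open out by exact: open_outside_box.
pose K : R := (size D)%:R + 1.
have K0 : 0 < K by rewrite ltr_wpDl.
pose B := ln K / (c' - c).
have B0 : 0 <= B.
  by rewrite divr_ge0 ?subr_ge0 ?(ltW cc') // ln_ge0 // lerDr.
apply: (@limn_esup_le _ _ _ (maxn N1 (Num.bound B))) => n.
rewrite geq_max => /andP[n1 nB].
have NR : 0 < n.+1%:R :> R by rewrite ltr0n.
have BN : B <= n.+1%:R.
  by apply: (le_trans (ltW (archi_boundP B0))); rewrite ler_nat leqW.
have mC : measurable (Y n @^-1` C).
  rewrite -[C]setCK preimage_setC; apply: measurableC.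
  exact: (measurable_Y n (closed_openC cC)).
have CK : mass Pr (Y n @^-1` C) <= K * expR (- (n.+1%:R * c')).
  apply: (@le_trans _ _ (mass Pr (Y n @^-1` V `|` Y n @^-1` out))).
    apply: le_mass => //.
      exact: measurableU (measurable_Y n oV) (measurable_Y n oout).
    move=> w Cw; have [bw|nbw] := pselect (box (Y n w)); last first.
      by right; rewrite /= outE.
    by left; exact: cover.
  apply: (le_trans (massU (measurable_Y n oV) (measurable_Y n oout))).
  by rewrite /K mulrDl mul1r; apply: lerD; [exact: N1P|exact: HM].
have [pos|zero] := ltP 0 (mass Pr (Y n @^-1` C)); last first.
  have -> : lne (Pr (Y n @^-1` C)) = -oo%E.
    by rewrite massE // le0_lneNy // lee_fin.
  by rewrite gt0_muleNy ?leNye // lte_fin invr_gt0.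
rewrite massE // lne_EFin // -EFinM lee_fin.
rewrite mulrC ler_pdivrMr // mulNr mulrC.
apply: (@le_trans _ _ (ln (K * expR (- (n.+1%:R * c'))))).
  by rewrite ler_ln ?posrE // mulr_gt0 ?expR_gt0.
rewrite lnM ?posrE ?expR_gt0 // expRK.
have : ln K <= n.+1%:R * (c' - c) by rewrite -ler_pdivrMr ?subr_gt0.
rewrite mulrBr; lra.
Qed.

End upper.

(** * The large deviation principle *)

Theorem theorem1p1 (R : realType) (dsp : measure_display)
  (Omega : measurableType dsp) (Pr : probability Omega R)
  (X : finType) (d : nat)
  (P : X -> X -> R) (Xs : nat -> Omega -> X)
  (A : nat -> Omega -> 'rV[R]_d)
  (q : X -> X -> probability (borel_rV R d) R)
  (markov : homogeneous_markov_chain Pr P Xs)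
  (irr : irreducible P)
  (measA : forall m, (0 < m)%N ->
     measurable_fun [set: Omega] (A m : Omega -> borel_rV R d))
  (lawq : is_cond_law Pr Xs A q)
  (indep : cond_product_law Pr Xs A q)
  (superlinear : forall x y,
     limf_einf (fun r : R => phi_abs_star (q x y) r * (r^-1)%:E)%E +oo
     = +oo%E) :
  good_rate_functional (rate P q) /\
  large_deviation_principle Pr (fun n => n.+1%:R) (emp_pair Xs A) (rate P q).
Proof.
have fin x y := finite_exp_moment (superlinear x y).
have [[P_ge0 _] _ _] := markov.
split; first exact: rate_good.
split.
- by move=> n O; exact: (measurable_emp_pair markov).
- exact: (ldp_lower markov irr measA indep fin).
- exact: (ldp_upper markov measA indep fin).
Qed.
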